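(* There exists an explicitly determined rational function $W\in\mathbb{Q}(X,Y)$ (its explicit expression as a sum of 15 summands is recorded in the context) such that, for all primes $p$ and all finite extensions $\mathfrak{o}$ of $\mathbb{Z}_p$, with residue field cardinality $q$, $$\zeta^{\triangleleft_{\mathrm{gr}}}_{\mathfrak{f}_{3,3}(\mathfrak{o})}(s)=W(q,q^{-s}).$$ It may be written as $W=N/D$, where \begin{align*} D(X,Y)=\;&(1-Y)(1-XY)(1-X^2Y)(1-X^3Y^4)(1-XY^5)(1-X^2Y^5)(1-Y^6)\\ &(1-X^7Y^7)(1-X^8Y^7)(1-X^8Y^8)(1-X^{12}Y^8)(1-X^6Y^9)(1-X^{15}Y^9)\\ &(1-X^{16}Y^{10})(1-X^{15}Y^{11})(1-X^{12}Y^{12})(1-X^7Y^{13})(1-Y^{14}), \end{align*} a polynomial of degree $115$ in $X$ and $131$ in $Y$, and $N\in\mathbb{Q}[X,Y]$ is a polynomial of degree $81$ in $X$ and $108$ in $Y$. The rational function $W$ satisfies the functional equation $$W(X^{-1},Y^{-1})=X^{34}Y^{23}\,W(X,Y).$$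
   Context: For $c\ge 1$, $d\ge 2$, $\mathfrak{f}_{c,d}$ denotes the free nilpotent Lie ring of nilpotency class $c$ on $d$ generators, i.e. the quotient of the free $\mathbb{Z}$-Lie algebra on $d$ generators by the $(c+1)$-th term of its lower central series. For a commutative ring $R$ set $\mathfrak{f}_{c,d}(R)=\mathfrak{f}_{c,d}\otimes_{\mathbb{Z}}R$, an $R$-Lie algebra. For an $R$-Lie algebra $L$, nilpotent of class $c$ and free of finite rank over $R$, with lower central series $(\gamma_i(L))$, set $L^{(i)}=\gamma_i(L)/\gamma_{i+1}(L)$ and let $\mathrm{gr}L=\bigoplus_{i=1}^c L^{(i)}$ be the associated graded $R$-Lie algebra. An $R$-ideal $I$ of $\mathrm{gr}L$ is graded if $I=\bigoplus_{i=1}^c (I\cap L^{(i)})$. The graded ideal zeta function of $L$ is $\zeta^{\triangleleft_{\mathrm{gr}}}_L(s)=\sum_{I}|\mathrm{gr}L:I|^{-s}$, the sum over graded $R$-ideals $I$ of finite index in $\mathrm{gr}L$; it converges on a complex half-plane. A finite extension $\mathfrak{o}$ of $\mathbb{Z}_p$ means the ring of integers of a finite extension of $\mathbb{Q}_p$. Explicit form of $W$. Write $\binom{a}{b}=\prod_{k=1}^{b}\frac{1-q^{-(a-b+k)}}{1-q^{-k}}$ for the Gaussian binomial at $q^{-1}$ and, for $S=\{s_1<\dots<s_k\}\subseteq\{1,\dots,n-1\}$, $\binom{n}{S}=\binom{n}{s_k}\binom{s_k}{s_{k-1}}\cdots\binom{s_2}{s_1}$ (equal to $1$ if $S=\varnothing$).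 For $n\ge1$ put $$I_n(X_1,\dots,X_n)=\frac{1}{1-X_n}\sum_{S\subseteq\{1,\dots,n-1\}}\binom{n}{S}\prod_{i\in S}\frac{X_i}{1-X_i},\qquad I_n^\circ(X_1,\dots,X_n)=X_n I_n(X_1,\dots,X_n).$$ Put $x_i=q^{i(8-i)}t^{6+i}$ and $y_i=q^{2+i(5-i)}t^{5+i}$. Then $$W(q,t)=\frac{1}{(1-t)(1-qt)(1-q^2t)}\Big(A+\sum_{j=1}^5B_j+\sum_{j=1}^5C_j+\sum_{j=1}^4E_j\Big),$$ where $A=I_3(q^2t^3,q^2t^5,t^6)\,I_8(x_1,\dots,x_8)$; $B_j=\binom5j\binom31 I_2(q^2t^3,q^2t^5)\,I_j^\circ(y_1,\dots,y_j)\,I_1(x_j)\,I_{8-j}(x_{j+1},\dots,x_8)$ for $1\le j\le5$; $C_1=\binom31\binom21 I_1(q^2t^3)\,I_1^\circ(q^3t^4)\,I_2(q^6t^6,q^7t^7)\,I_7(x_2,\dots,x_8)$; $C_j=\binom4{j-1}\binom31\binom21^2 I_1(q^2t^3)\,I_1^\circ(q^3t^4)\,I_1(q^6t^6)\,I_{j-1}^\circ(y_2,\dots,y_j)\,I_1(x_j)\,I_{8-j}(x_{j+1},\dots,x_8)$ for $2\le j\le5$; $E_1=\binom31 I_1(q^2t^3)\,I_2^\circ(q^3t^4,q^2t^5)\,I_2(q^8t^7,q^{12}t^8)\,I_6(x_3,\dots,x_8)$; $E_j=\binom3{j-1}\binom31\binom21 I_1(q^2t^3)\,I_2^\circ(q^3t^4,q^2t^5)\,I_1(q^8t^7)\,I_{j-1}^\circ(y_3,\dots,y_{j+1})\,I_1(x_{j+1})\,I_{7-j}(x_{j+2},\dots,x_8)$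 for $2\le j\le4$. *)

(* Defs.v *)
From HB Require Import structures.
From mathcomp Require Import all_boot all_order all_algebra all_field.
From mathcomp Require Import all_classical all_reals all_analysis.
From mathcomp Require Import generic_quotient finmap polyXY complex summability.
From mathcomp Require Import zify.
Set Implicit Arguments.
Unset Strict Implicit.
Unset Printing Implicit Defensive.
Import Order.TTheory GRing.Theory Num.Theory numFieldNormedType.Exports.
Local Open Scope ring_scope.
Local Open Scope classical_set_scope.
Local Open Scope quotient_scope.
(* The inverse limit of the rings Z/p^n; residue n is the representative in
   [0, p^n) of the n-th component. *)
Record padic_int (p : nat) (p_pr : prime p) := PadicInt {
  residue :> nat -> int;
  residueP : forall n, residue n = (residue n.+1 %% (p ^ n)%N)%Z }.

Section PadicIntegers.
Variables (p : nat) (p_pr : prime p).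
Local Notation Zp := (padic_int p_pr).
Implicit Types x y z : Zp.

HB.instance Definition _ := gen_eqMixin Zp.
HB.instance Definition _ := gen_choiceMixin Zp.

Let q n : int := (p ^ n)%N.

Lemma residue_modz x n : (x n %% q n)%Z = x n.
Proof. by rewrite residueP modz_mod. Qed.

Lemma modz_powS (a : int) n : ((a %% q n.+1)%Z %% q n)%Z = (a %% q n)%Z.
Proof.
rewrite {2}(divz_eq a (q n.+1)) /q expnS PoszM mulrA.
by rewrite modzMDl.
Qed.

Lemma padic_eqP x y : (forall n, (x n = y n %[mod q n])%Z) -> x = y.
Proof.
move=> xy; have {xy} : residue x = residue y.
  by apply/funext => n; have := xy n; rewrite !residue_modz.
case: x y => [f fP] [g gP] /= fg; case: _ / fg gP => gP.
by congr PadicInt; exact: Prop_irrelevance.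
Qed.

Definition coherent (f : nat -> int) := forall n, (f n = f n.+1 %[mod q n])%Z.

Fact padic_mk_subproof f : coherent f ->
  forall n, (f n %% q n)%Z = ((f n.+1 %% q n.+1)%Z %% q n)%Z.
Proof. by move=> fP n; rewrite modz_powS -fP. Qed.

Definition padic_mk f (fP : coherent f) : Zp :=
  PadicInt p_pr (padic_mk_subproof fP).

Lemma padic_coherent x : coherent x.
Proof. by move=> n; rewrite residue_modz -residueP. Qed.

Fact cst_coherent (a : int) : coherent (fun=> a).
Proof. by []. Qed.

Fact opp_coherent x : coherent (fun n => - x n).
Proof. by move=> n; rewrite -modzNm padic_coherent modzNm. Qed.

Fact add_coherent x y : coherent (fun n => x n + y n).
Proof. by move=> n; rewrite -modzDm (padic_coherent x) (padic_coherent y) modzDm. Qed.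

Fact mul_coherent x y : coherent (fun n => x n * y n).
Proof. by move=> n; rewrite -modzMm (padic_coherent x) (padic_coherent y) modzMm. Qed.

Definition padic_int_of (a : int) := padic_mk (cst_coherent a).
Definition padic_opp x := padic_mk (opp_coherent x).
Definition padic_add x y := padic_mk (add_coherent x y).
Definition padic_mul x y := padic_mk (mul_coherent x y).

Fact padic_addA : associative padic_add.
Proof.
move=> x y z; apply: padic_eqP => n /=.
by rewrite !modz_mod modzDml modzDmr addrA.
Qed.

Fact padic_addC : commutative padic_add.
Proof. by move=> x y; apply: padic_eqP => n /=; rewrite addrC. Qed.

Fact padic_add0 : left_id (padic_int_of 0) padic_add.
Proof. by move=> x; apply: padic_eqP => n /=; rewrite !modz_mod modzDml add0r. Qed.

Fact padic_addN : left_inverse (padic_int_of 0) padic_opp padic_add.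
Proof. by move=> x; apply: padic_eqP => n /=; rewrite !modz_mod modzDml addNr. Qed.

HB.instance Definition _ :=
  GRing.isZmodule.Build Zp padic_addA padic_addC padic_add0 padic_addN.

Fact padic_mulA : associative padic_mul.
Proof.
move=> x y z; apply: padic_eqP => n /=.
by rewrite !modz_mod modzMml modzMmr mulrA.
Qed.

Fact padic_mulC : commutative padic_mul.
Proof. by move=> x y; apply: padic_eqP => n /=; rewrite mulrC. Qed.

Fact padic_mul1 : left_id (padic_int_of 1) padic_mul.
Proof. by move=> x; apply: padic_eqP => n /=; rewrite !modz_mod modzMml mul1r. Qed.

Fact padic_mulD : left_distributive padic_mul padic_add.
Proof.
move=> x y z; apply: padic_eqP => n /=.
by rewrite !modz_mod modzMml modzDm mulrDl.
Qed.

Fact padic_1neq0 : padic_int_of 1 != 0.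
Proof.
apply/eqP => /(congr1 (fun x : Zp => x 1%N)) /=.
rewrite /q expn1 mod0z modz_small //.
by rewrite ltz_nat prime_gt1.
Qed.

HB.instance Definition _ := GRing.Zmodule_isComNzRing.Build Zp
  padic_mulA padic_mulC padic_mul1 padic_mulD padic_1neq0.

Definition padic_unit : pred Zp := fun x => `[< exists y, y * x = 1 >].
Definition padic_inv x : Zp := if x \in padic_unit then xget 0 [set y | y * x = 1] else x.

Fact padic_mulV : {in padic_unit, left_inverse 1 padic_inv *%R}.
Proof.
move=> x xU; rewrite /padic_inv xU.
by have /asboolP [y yx] := xU; case: xgetP => [z _ //|/(_ y)].
Qed.

Fact padic_unitP x y : y * x = 1 -> padic_unit x.
Proof. by move=> yx; apply/asboolP; exists y. Qed.

Fact padic_invN : {in [predC padic_unit], padic_inv =1 id}.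
Proof. by move=> x; rewrite inE /= /padic_inv => /negbTE ->. Qed.

HB.instance Definition _ :=
  GRing.ComNzRing_hasMulInverse.Build Zp padic_mulV padic_unitP padic_invN.

Lemma residue_eq0_le x m n : (m <= n)%N -> x m != 0 -> ~~ (q m %| x n)%Z.
Proof.
move=> /subnK <-; elim: (n - m)%N => [|k IHk] xm0.
  apply: contra xm0; rewrite add0n => /dvdz_mod0P; rewrite residue_modz.
  by move/eqP.
apply: contra (IHk xm0) => mxk; rewrite addSn in mxk.
rewrite residueP; apply/dvdz_mod0P.
have qd : (q m %| q (k + m)%N)%Z by rewrite dvdzE /= dvdn_exp2l // leq_addl.
have/dvdz_mod0P <- := mxk.
rewrite {2}(divz_eq (x (k + m).+1) (q (k + m)%N)).
by rewrite -/(q (k + m)%N); case/dvdzP: qd => c qd; rewrite {3}qd mulrA modzMDl.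
Qed.

Fact padic_domain x y : x * y = 0 -> (x == 0) || (y == 0).
Proof.
move=> xy0; apply/orP; apply: contrapT => /not_orP [/negP x0 /negP y0].
have nz z : z != 0 -> exists n, z n != 0.
  move=> z0; apply: contrapT => /forallNP zn; case/eqP: z0.
  apply: padic_eqP => n; have -> : z n = 0.
    by apply/eqP; move: (zn n) => /negP; rewrite negbK.
  by rewrite /= !mod0z.
have [m /(residue_eq0_le (leq_addr _ _)) xm] := nz _ x0.
have [n /(residue_eq0_le (leq_addl _ _)) yn] := nz _ y0.
move: (xm n) (yn m) => {}xm {}yn.
set N := (m + n)%N in xm yn.
have : (q N %| x N * y N)%Z.
  by apply/dvdz_mod0P; have /(congr1 (fun z : Zp => z N)) /= -> := xy0; rewrite mod0z.
have gt0 (a : int) k : ~~ (q k %| a)%Z -> (0 < `|a|)%N.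
  by rewrite absz_gt0; apply: contraNneq => ->.
rewrite dvdzE abszM /= pfactor_dvdn ?muln_gt0 ?(gt0 _ _ xm) ?(gt0 _ _ yn) //.
rewrite lognM ?(gt0 _ _ xm) ?(gt0 _ _ yn) //.
move: (xm) (yn); rewrite !dvdzE /= !pfactor_dvdn ?(gt0 _ _ xm) ?(gt0 _ _ yn) //.
by rewrite /N; lia.
Qed.

HB.instance Definition _ :=
  GRing.ComUnitRing_isIntegral.Build Zp padic_domain.

Definition padic := {fraction Zp}.
HB.instance Definition _ := GRing.Field.on padic.

Section IntegerRing.
Variable K : fieldExtType padic.

Definition padic_int_embed (x : Zp) : K := in_alg K (tofrac x).
HB.instance Definition _ := GRing.RMorphism.copy padic_int_embed (in_alg K \o (@tofrac Zp : Zp -> padic)).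

Definition integral_pred : {pred K} := fun x : K => `[< integralOver padic_int_embed x >].

Fact integral_subring : subring_closed integral_pred.
Proof.
split=> [|x y /asboolP xi /asboolP yi|x y /asboolP xi /asboolP yi]; apply/asboolP.
- exact: integral1.
- exact: integral_sub.
- exact: integral_mul.
Qed.
HB.instance Definition _ := GRing.isSubringClosed.Build K integral_pred integral_subring.

Record integer_ring := IntegerRing {
  integer_val :> K; _ : integer_val \in integral_pred }.
HB.instance Definition _ := [isSub for integer_val].
HB.instance Definition _ := [Choice of integer_ring by <:].
HB.instance Definition _ := [SubChoice_isSubComNzRing of integer_ring by <:].
End IntegerRing.
End PadicIntegers.

HB.mixin Record Lmodule_isLie (R : comNzRingType) L of GRing.Lmodule R L := {
  lie : L -> L -> L;
  lie_linearl : forall a x y z, lie (a *: x + y) z = a *: lie x z + lie y z;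
  lie_linearr : forall a x y z, lie z (a *: x + y) = a *: lie z x + lie z y;
  liexx : forall x, lie x x = 0;
  lie_jacobi : forall x y z,
    lie x (lie y z) + lie y (lie z x) + lie z (lie x y) = 0 }.

#[short(type="lieAlgType")]
HB.structure Definition LieAlgebra (R : comNzRingType) :=
  { L of Lmodule_isLie R L & GRing.Lmodule R L }.

Section Submodules.
Variables (R : comNzRingType) (V : lmodType R).

Definition is_submod (N : set V) :=
  N 0 /\ forall a x y, N x -> N y -> N (a *: x + y).

Record submod := Submod {
  submod_set :> V -> Prop;
  submodP : is_submod submod_set }.

Definition lspan (A : set V) : set V := smallest is_submod A.

Lemma lspan_submod A : is_submod (lspan A).
Proof.
split=> [N [[N0 _] _]//|a x y Ax Ay N NA].
by have [[_ NE] _] := NA; apply: NE; [exact: Ax|exact: Ay].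
Qed.

Lemma lspan_sub A : A `<=` lspan A.
Proof. by move=> x Ax N [_]; exact. Qed.

Lemma lspan_min A N : is_submod N -> A `<=` N -> lspan A `<=` N.
Proof. by move=> NP AN x; apply. Qed.

Definition mcoset (N : set V) (x : V) : set V := [set y | N (y - x)].

(* The index of a submodule, as the number of its cosets; mod_index is 0 when
   there are infinitely many. *)
Definition finite_index (N : set V) := finite_set (range (mcoset N)).
Definition mod_index (N : set V) : nat := #|` fset_set (range (mcoset N))|.

Section SubmodTheory.
Variable N : submod.

Lemma submod0 : N 0.
Proof. by have [] := submodP N. Qed.

Lemma submodD x y : N x -> N y -> N (x + y).
Proof. by move=> Nx Ny; rewrite -[x]scale1r; have [_] := submodP N; apply. Qed.

Lemma submodZ a x : N x -> N (a *: x).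
Proof. by move=> Nx; rewrite -[_ *: _]addr0; have [N0] := submodP N; apply. Qed.

Lemma submodN x : N x -> N (- x).
Proof. by move=> Nx; rewrite -scaleN1r; exact: submodZ. Qed.

Lemma submodB x y : N x -> N y -> N (x - y).
Proof. by move=> Nx Ny; apply: submodD => //; exact: submodN. Qed.

Lemma submod_sum I (r : seq I) (P : pred I) (f : I -> V) :
  (forall i, P i -> N (f i)) -> N (\sum_(i <- r | P i) f i).
Proof.
by move=> Nf; elim/big_ind: _ => //; [exact: submod0|exact: submodD].
Qed.

Lemma cosetP x y : mcoset N x = mcoset N y <-> N (x - y).
Proof.
split=> [xy|Nxy].
  have : mcoset N x x by rewrite /mcoset /= subrr; exact: submod0.
  by rewrite xy.
rewrite /mcoset; apply/seteqP; split=> z /= Nz.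
  by rewrite -(subrKA x); exact: submodD.
have -> : z - x = (z - y) - (x - y) by rewrite opprB addrA subrK.
exact: submodB.
Qed.
End SubmodTheory.
End Submodules.

(* For N contained in M, subquotient M N is the module M / N: its elements are
   the cosets x + N with x in M. *)
Section Subquotient.
Variables (R : comNzRingType) (V : lmodType R) (M N : submod V).

Record subquotient := Subquotient {
  subquotient_set : set V;
  subquotientP : exists2 x, M x & subquotient_set = mcoset N x }.

HB.instance Definition _ := gen_eqMixin subquotient.
HB.instance Definition _ := gen_choiceMixin subquotient.

Definition coset_class (x : V) : subquotient :=
  match pselect (M x) with
  | left Mx => Subquotient (ex_intro2 _ _ x Mx erefl)
  | right _ => Subquotient (ex_intro2 _ _ 0 (submod0 M) erefl)
  end.

Definition coset_rep (A : subquotient) : V := s2val (cid2 (subquotientP A)).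

Lemma rep_in A : M (coset_rep A).
Proof. by rewrite /coset_rep; case: cid2. Qed.

Lemma subquotient_inj : injective subquotient_set.
Proof.
case=> [A AP] [B BP] /= AB; case: _ / AB BP => BP.
by congr Subquotient; exact: Prop_irrelevance.
Qed.

Lemma class_set x : M x -> subquotient_set (coset_class x) = mcoset N x.
Proof. by rewrite /coset_class; case: pselect. Qed.

Lemma repK A : coset_class (coset_rep A) = A.
Proof.
apply: subquotient_inj; rewrite class_set; last exact: rep_in.
by rewrite /coset_rep; case: cid2.
Qed.

Lemma classP x y : M x -> M y -> coset_class x = coset_class y <-> N (x - y).
Proof.
move=> Mx My; rewrite -cosetP -(class_set Mx) -(class_set My).
by split=> [->//|/subquotient_inj].
Qed.

Lemma rep_class x : M x -> N (coset_rep (coset_class x) - x).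
Proof. by move=> Mx; apply/classP => //; [exact: rep_in|exact: repK]. Qed.

Definition subquotient_add A B := coset_class (coset_rep A + coset_rep B).
Definition subquotient_opp A := coset_class (- coset_rep A).
Definition subquotient_scale a A := coset_class (a *: coset_rep A).

Let classD' x y : M x -> M y -> subquotient_add (coset_class x) (coset_class y) = coset_class (x + y).
Proof.
move=> Mx My; apply/classP; try by apply: submodD => //; exact: rep_in.
by rewrite opprD addrACA; apply: submodD; exact: rep_class.
Qed.

Let classN' x : M x -> subquotient_opp (coset_class x) = coset_class (- x).
Proof.
move=> Mx; apply/classP; try by apply: submodN => //; exact: rep_in.
by rewrite -opprD; apply: submodN; exact: rep_class.
Qed.

Let classZ' a x : M x -> subquotient_scale a (coset_class x) = coset_class (a *: x).
Proof.
move=> Mx; apply/classP; try by apply: submodZ => //; exact: rep_in.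
by rewrite -scalerBr; apply: submodZ; exact: rep_class.
Qed.

Lemma subquotient_ind (P : subquotient -> Prop) :
  (forall x, M x -> P (coset_class x)) -> forall A, P A.
Proof. by move=> Pc A; rewrite -(repK A); apply: Pc; exact: rep_in. Qed.

Fact subquotient_addA : associative subquotient_add.
Proof.
elim/subquotient_ind=> x Mx; elim/subquotient_ind=> y My.
elim/subquotient_ind=> z Mz.
by rewrite !classD' ?addrA //; exact: submodD.
Qed.

Fact subquotient_addC : commutative subquotient_add.
Proof. by move=> A B; rewrite /subquotient_add addrC. Qed.

Fact subquotient_add0 : left_id (coset_class 0) subquotient_add.
Proof.
by elim/subquotient_ind=> x Mx; rewrite classD' ?add0r //; exact: submod0.
Qed.

Fact subquotient_addN : left_inverse (coset_class 0) subquotient_opp subquotient_add.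
Proof.
elim/subquotient_ind=> x Mx; rewrite classN' // classD' ?addNr //.
exact: submodN.
Qed.

HB.instance Definition _ := GRing.isZmodule.Build subquotient
  subquotient_addA subquotient_addC subquotient_add0 subquotient_addN.

Fact subquotient_scaleA a b A :
  subquotient_scale a (subquotient_scale b A) = subquotient_scale (a * b) A.
Proof.
elim/subquotient_ind: A => x Mx.
by rewrite !classZ' ?scalerA //; exact: submodZ.
Qed.

Fact subquotient_scale1 : left_id 1 subquotient_scale.
Proof. by elim/subquotient_ind=> x Mx; rewrite classZ' // scale1r. Qed.

Fact subquotient_scaleDr : right_distributive subquotient_scale +%R.
Proof.
move=> a; elim/subquotient_ind=> x Mx; elim/subquotient_ind=> y My.
rewrite [coset_class x + _]classD' // !classZ' ?scalerDr //; last exact: submodD.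
by rewrite [RHS]classD' //; exact: submodZ.
Qed.

Fact subquotient_scaleDl A : {morph subquotient_scale^~ A : a b / a + b}.
Proof.
elim/subquotient_ind: A => x Mx a b.
by rewrite !classZ' // [RHS]classD' ?scalerDl //; exact: submodZ.
Qed.

HB.instance Definition _ := GRing.Zmodule_isLmodule.Build R subquotient
  subquotient_scaleA subquotient_scale1 subquotient_scaleDr subquotient_scaleDl.

Lemma classD x y : M x -> M y -> coset_class (x + y) = coset_class x + coset_class y.
Proof. by move=> *; rewrite [RHS]classD'. Qed.

Lemma classZ a x : M x -> coset_class (a *: x) = a *: coset_class x.
Proof. by move=> *; rewrite [RHS]classZ'. Qed.

Lemma class0 : coset_class 0 = 0.
Proof. by []. Qed.
End Subquotient.

Section LieTheory.
Variables (R : comNzRingType) (L : lieAlgType R).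
Implicit Types x y z : L.

Lemma lieDl x y z : lie (x + y) z = lie x z + lie y z.
Proof. by rewrite -[x]scale1r lie_linearl !scale1r. Qed.

Lemma lieDr x y z : lie z (x + y) = lie z x + lie z y.
Proof. by rewrite -[x]scale1r lie_linearr !scale1r. Qed.

Lemma lie0l z : lie 0 z = 0 :> L.
Proof. by apply: (addrI (lie 0 z)); rewrite -lieDl !addr0. Qed.

Lemma lie0r z : lie z 0 = 0 :> L.
Proof. by apply: (addrI (lie z 0)); rewrite -lieDr !addr0. Qed.

Lemma lieZl a x z : lie (a *: x) z = a *: lie x z.
Proof. by rewrite -[a *: x]addr0 lie_linearl lie0l addr0. Qed.

Lemma lieZr a x z : lie z (a *: x) = a *: lie z x.
Proof. by rewrite -[a *: x]addr0 lie_linearr lie0r addr0. Qed.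

Lemma lieNl x z : lie (- x) z = - lie x z.
Proof. by rewrite -scaleN1r lieZl scaleN1r. Qed.

Lemma lieNr x z : lie z (- x) = - lie z x.
Proof. by rewrite -scaleN1r lieZr scaleN1r. Qed.

Lemma lie_suml I (r : seq I) P (f : I -> L) z :
  lie (\sum_(i <- r | P i) f i) z = \sum_(i <- r | P i) lie (f i) z.
Proof. by apply: (big_morph (lie^~ z)) => [x y|]; rewrite ?lieDl ?lie0l. Qed.

Lemma lie_sumr I (r : seq I) P (f : I -> L) z :
  lie z (\sum_(i <- r | P i) f i) = \sum_(i <- r | P i) lie z (f i).
Proof. by apply: (big_morph (lie z)) => [x y|]; rewrite ?lieDr ?lie0r. Qed.

Lemma lieC x y : lie x y = - lie y x.
Proof.
apply/eqP; rewrite -addr_eq0; apply/eqP.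
by have := liexx (x + y); rewrite lieDl !lieDr !liexx add0r addr0.
Qed.

Definition is_lie_ideal (I : set L) :=
  is_submod I /\ forall x y, I x -> I (lie x y).

Record lie_ideal := Ideal {
  ideal_submod :> submod L;
  idealP : forall x y, ideal_submod x -> ideal_submod (lie x y) }.

(* lcs_set n is the term of index n + 1 of the lower central series. *)
Fixpoint lcs_set (n : nat) : set L :=
  if n is m.+1 then lspan [set lie x y | x in lcs_set m & y in setT] else setT.

Fact lcs_submod n : is_submod (lcs_set n).
Proof. by case: n => [|n] //; exact: lspan_submod. Qed.

Lemma lie_lcs n x y : lcs_set n x -> lcs_set n.+1 (lie x y).
Proof. by move=> nx; apply: lspan_sub; exists x => //; exists y. Qed.

Lemma lcs_decr n : lcs_set n.+1 `<=` lcs_set n.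
Proof.
elim: n => [//|n IHn]; apply: lspan_min; first exact: lcs_submod.
by move=> _ [x nx [y _ <-]]; apply: lie_lcs; exact: IHn.
Qed.

Fact lcs_ideal n x y : Submod (lcs_submod n) x -> Submod (lcs_submod n) (lie x y).
Proof. by move=> nx; apply: lcs_decr; exact: lie_lcs. Qed.

Definition lcs n : lie_ideal := Ideal (@lcs_ideal n).

Lemma lie_lcs2 m n x y : lcs m x -> lcs n y -> lcs (m + n).+1 (lie x y).
Proof.
have lcsN k z : lcs k z -> lcs k (- z) by exact: submodN.
elim: n m x y => [|n IHn] m x y mx ny; first by rewrite addn0; exact: lie_lcs.
pose P := [set y | forall m x, lcs m x -> lcs (m + n.+1).+1 (lie x y)].
suff : lcs n.+1 `<=` P by move/(_ y ny); apply.
apply: lspan_min => [|_ [u nu [v _ <-]]].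
  split=> [k z _|a u v Pu Pv k z kz]; first by rewrite lie0r; exact: submod0.
  by rewrite lie_linearr; apply: submodD; [apply: submodZ; exact: Pu|exact: Pv].
move=> {mx ny} {}m {}x mx; rewrite addnS.
have -> : lie x (lie u v) = lie (lie x u) v - lie (lie x v) u.
  apply/eqP; rewrite -subr_eq0 opprB addrA (lieC (lie x u)) opprK.
  by rewrite (lieC (lie x v)) (lieC x v) lieNr opprK lie_jacobi.
apply: submodB; first by apply: lie_lcs; exact: IHn.
by rewrite -addSn; apply: IHn => //; exact: lie_lcs.
Qed.

Fact full_submodP : is_submod (@setT L).
Proof. by []. Qed.
Definition full_submod := Submod full_submodP.

Section Quotient.
Variable I : lie_ideal.

Definition lie_quotient := subquotient full_submod I.
HB.instance Definition _ := GRing.Lmodule.on lie_quotient.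

Let cls (x : L) : lie_quotient := coset_class full_submod I x.

Definition lie_quotient_lie (A B : lie_quotient) : lie_quotient :=
  cls (lie (coset_rep A) (coset_rep B)).

Let clsE x y : lie_quotient_lie (cls x) (cls y) = cls (lie x y).
Proof.
apply/classP => //.
rewrite -(subrKA (lie x (coset_rep (cls y)))) -lieNl -lieDl -lieNr -lieDr.
apply: submodD; first by apply: idealP; exact: rep_class.
by rewrite lieC; apply: submodN; apply: idealP; exact: rep_class.
Qed.

Fact lie_quotient_linearl a (A B C : lie_quotient) :
  lie_quotient_lie (a *: A + B) C = a *: lie_quotient_lie A C + lie_quotient_lie B C.
Proof.
elim/subquotient_ind: A => x _; elim/subquotient_ind: B => y _.
elim/subquotient_ind: C => z _.
by rewrite -classZ // -classD // !clsE lie_linearl /cls classD // classZ.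
Qed.

Fact lie_quotient_linearr a (A B C : lie_quotient) :
  lie_quotient_lie C (a *: A + B) = a *: lie_quotient_lie C A + lie_quotient_lie C B.
Proof.
elim/subquotient_ind: A => x _; elim/subquotient_ind: B => y _.
elim/subquotient_ind: C => z _.
by rewrite -classZ // -classD // !clsE lie_linearr /cls classD // classZ.
Qed.

Fact lie_quotient_xx A : lie_quotient_lie A A = 0.
Proof. by elim/subquotient_ind: A => x _; rewrite clsE liexx. Qed.

Fact lie_quotient_jacobi A B C :
  lie_quotient_lie A (lie_quotient_lie B C) +
  lie_quotient_lie B (lie_quotient_lie C A) +
  lie_quotient_lie C (lie_quotient_lie A B) = 0.
Proof.
elim/subquotient_ind: A => x _; elim/subquotient_ind: B => y _.
elim/subquotient_ind: C => z _.
rewrite (clsE y z) (clsE z x) (clsE x y) !clsE.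
by rewrite -[RHS]/(cls 0) -(lie_jacobi x y z) /cls !classD.
Qed.

HB.instance Definition _ := Lmodule_isLie.Build R lie_quotient
  lie_quotient_linearl lie_quotient_linearr lie_quotient_xx lie_quotient_jacobi.
End Quotient.

Section Graded.
Variable c : nat.

(* The summand of index i : 'I_c is the quotient of the (i+1)-st by the
   (i+2)-nd term of the lower central series. *)
Definition gr := forall i : 'I_c, subquotient (lcs i) (lcs i.+1).

HB.instance Definition _ := gen_eqMixin gr.
HB.instance Definition _ := gen_choiceMixin gr.

Definition gr_add (a b : gr) : gr := fun i => a i + b i.
Definition gr_opp (a : gr) : gr := fun i => - a i.
Definition gr_zero : gr := fun i => 0.
Definition gr_scale r (a : gr) : gr := fun i => r *: a i.

Lemma grP (a b : gr) : (forall i, a i = b i) -> a = b.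
Proof. by move=> ab; exact: functional_extensionality_dep. Qed.

Fact gr_addA : associative gr_add.
Proof. by move=> x y z; apply: grP => i; exact: addrA. Qed.
Fact gr_addC : commutative gr_add.
Proof. by move=> x y; apply: grP => i; exact: addrC. Qed.
Fact gr_add0 : left_id gr_zero gr_add.
Proof. by move=> x; apply: grP => i; exact: add0r. Qed.
Fact gr_addN : left_inverse gr_zero gr_opp gr_add.
Proof. by move=> x; apply: grP => i; exact: addNr. Qed.
HB.instance Definition _ :=
  GRing.isZmodule.Build gr gr_addA gr_addC gr_add0 gr_addN.

Fact gr_scaleA a b (x : gr) : gr_scale a (gr_scale b x) = gr_scale (a * b) x.
Proof. by apply: grP => i; exact: scalerA. Qed.
Fact gr_scale1 : left_id 1 gr_scale.
Proof. by move=> x; apply: grP => i; exact: scale1r. Qed.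
Fact gr_scaleDr : right_distributive gr_scale +%R.
Proof. by move=> a x y; apply: grP => i; exact: scalerDr. Qed.
Fact gr_scaleDl (x : gr) : {morph gr_scale^~ x : a b / a + b}.
Proof. by move=> a b; apply: grP => i; exact: scalerDl. Qed.
HB.instance Definition _ := GRing.Zmodule_isLmodule.Build R gr
  gr_scaleA gr_scale1 gr_scaleDr gr_scaleDl.

Lemma grDE (a b : gr) i : (a + b) i = a i + b i.
Proof. by []. Qed.
Lemma grZE r (a : gr) i : (r *: a) i = r *: a i.
Proof. by []. Qed.
Lemma gr0E i : (0 : gr) i = 0.
Proof. by []. Qed.

(* Since the i-th summand comes from the (i+1)-st term of the series, brackets
   of the summands i and j land in the summand i + j + 1. *)
Definition gr_lie (a b : gr) : gr := fun k =>
  \sum_(i < c) \sum_(j < c | (i + j).+1 == k)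
    coset_class (lcs k) (lcs k.+1) (lie (coset_rep (a i)) (coset_rep (b j))).

Let gr_of (u : 'I_c -> L) : gr := fun i => coset_class (lcs i) (lcs i.+1) (u i).

Let gr_ind (P : gr -> Prop) :
  (forall u : 'I_c -> L, (forall i : 'I_c, lcs i (u i)) -> P (gr_of u)) -> forall a, P a.
Proof.
move=> Pu a; have -> : a = gr_of (fun i => coset_rep (a i)).
  by apply: grP => i; rewrite /gr_of repK.
by apply: (Pu (fun i => coset_rep (a i))) => i; exact: rep_in.
Qed.

Let class_sum k (I : finType) (P : pred I) (f : I -> L) :
    (forall i, P i -> lcs k (f i)) ->
  \sum_(i | P i) coset_class (lcs k) (lcs k.+1) (f i) =
  coset_class (lcs k) (lcs k.+1) (\sum_(i | P i) f i).
Proof.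
move=> kf.
suff [] : \sum_(i | P i) coset_class (lcs k) (lcs k.+1) (f i) =
  coset_class (lcs k) (lcs k.+1) (\sum_(i | P i) f i) /\ lcs k (\sum_(i | P i) f i) by [].
apply: (big_ind2 (fun A x => A = coset_class (lcs k) (lcs k.+1) x /\ lcs k x)).
- by split; [rewrite class0|exact: submod0].
- move=> _ x _ y [-> kx] [-> ky]; split; last exact: submodD.
  by rewrite classD.
- by move=> i Pi; split=> //; exact: kf.
Qed.

Let lcs_eq m n x : m = n -> lcs m x -> lcs n x.
Proof. by move=> ->. Qed.

Let gr_lieE (u v : 'I_c -> L) k :
    (forall i : 'I_c, lcs i (u i)) -> (forall i : 'I_c, lcs i (v i)) ->
  gr_lie (gr_of u) (gr_of v) k = coset_class (lcs k) (lcs k.+1)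
    (\sum_(i < c) \sum_(j < c | (i + j).+1 == k) lie (u i) (v j)).
Proof.
move=> uP vP; rewrite -class_sum => [|i _]; last first.
  apply: submod_sum => j /eqP ijk.
  by apply: (lcs_eq ijk); apply: lie_lcs2; [exact: uP|exact: vP].
apply: eq_bigr => i _; rewrite -class_sum => [|j /eqP ijk]; last first.
  by apply: (lcs_eq ijk); apply: lie_lcs2; [exact: uP|exact: vP].
apply: eq_bigr => j /eqP ijk; apply/classP.
- by apply: (lcs_eq ijk); apply: lie_lcs2; exact: rep_in.
- by apply: (lcs_eq ijk); apply: lie_lcs2; [exact: uP|exact: vP].
set a := coset_rep _; set b := coset_rep _.
rewrite -(subrKA (lie (u i) b)) -lieNl -lieDl -lieNr -lieDr.
apply: submodD.
  apply: (@lcs_eq (i.+1 + j).+1); first by rewrite addSn ijk.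
  by apply: lie_lcs2; [apply: rep_class; exact: uP|exact: rep_in].
apply: (@lcs_eq (i + j.+1).+1); first by rewrite addnS ijk.
by apply: lie_lcs2; [exact: uP|apply: rep_class; exact: vP].
Qed.

Let lie_in (u v : 'I_c -> L) (k : 'I_c) :
    (forall i : 'I_c, lcs i (u i)) -> (forall i : 'I_c, lcs i (v i)) ->
  lcs k (\sum_(i < c) \sum_(j < c | (i + j).+1 == k) lie (u i) (v j)).
Proof.
move=> uP vP; apply: submod_sum => i _; apply: submod_sum => j /eqP ijk.
by apply: (lcs_eq ijk); apply: lie_lcs2; [exact: uP|exact: vP].
Qed.

Let gr_ofD a (u v : 'I_c -> L) : (forall i : 'I_c, lcs i (u i)) -> (forall i : 'I_c, lcs i (v i)) ->
  a *: gr_of u + gr_of v = gr_of (fun i => a *: u i + v i).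
Proof.
move=> uP vP; apply: grP => i; rewrite /gr_of classD ?classZ //.
exact: submodZ.
Qed.

Fact gr_lie_linearl r (a b d : gr) : gr_lie (r *: a + b) d = r *: gr_lie a d + gr_lie b d.
Proof.
elim/gr_ind: a => u uP; elim/gr_ind: b => v vP; elim/gr_ind: d => w wP.
apply: grP => k; rewrite gr_ofD // gr_lieE //; last first.
  by move=> i; apply: submodD => //; exact: submodZ.
rewrite grDE grZE !gr_lieE //.
have -> : \sum_(i < c) \sum_(j < c | (i + j).+1 == k) lie (r *: u i + v i) (w j) =
    r *: (\sum_(i < c) \sum_(j < c | (i + j).+1 == k) lie (u i) (w j)) +
    \sum_(i < c) \sum_(j < c | (i + j).+1 == k) lie (v i) (w j).
  rewrite scaler_sumr -big_split; apply: eq_bigr => i _ /=.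
  by rewrite scaler_sumr -big_split; apply: eq_bigr => j _; rewrite lie_linearl.
by rewrite classD ?classZ //; try apply: submodZ; exact: lie_in.
Qed.

Fact gr_lie_linearr r (a b d : gr) : gr_lie d (r *: a + b) = r *: gr_lie d a + gr_lie d b.
Proof.
elim/gr_ind: a => u uP; elim/gr_ind: b => v vP; elim/gr_ind: d => w wP.
apply: grP => k; rewrite gr_ofD // gr_lieE //; last first.
  by move=> i; apply: submodD => //; exact: submodZ.
rewrite grDE grZE !gr_lieE //.
have -> : \sum_(i < c) \sum_(j < c | (i + j).+1 == k) lie (w i) (r *: u j + v j) =
    r *: (\sum_(i < c) \sum_(j < c | (i + j).+1 == k) lie (w i) (u j)) +
    \sum_(i < c) \sum_(j < c | (i + j).+1 == k) lie (w i) (v j).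
  rewrite scaler_sumr -big_split; apply: eq_bigr => i _ /=.
  by rewrite scaler_sumr -big_split; apply: eq_bigr => j _; rewrite lie_linearr.
by rewrite classD ?classZ //; try apply: submodZ; exact: lie_in.
Qed.

Fact gr_lie_xx a : gr_lie a a = 0.
Proof.
elim/gr_ind: a => u uP; apply: grP => k; rewrite gr_lieE //.
rewrite gr0E -class0; congr coset_class.
under eq_bigr do rewrite big_mkcond /=.
have half (P : rel nat) : 
  \sum_(i < c) \sum_(j < c) (if P i j then if (i + j).+1 == k then lie (u i) (u j) else 0 else 0) =
  - \sum_(i < c) \sum_(j < c) (if P j i then if (i + j).+1 == k then lie (u i) (u j) else 0 else 0).
  rewrite exchange_big -sumrN; apply: eq_bigr => j _; rewrite -sumrN.
  apply: eq_bigr => i _; rewrite [(j + i)%N]addnC (lieC (u i)).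
  by case: (P i j); rewrite ?oppr0 //; case: eqP; rewrite ?oppr0.
apply: (@etrans _ _
 (\sum_(i < c) \sum_(j < c) (if (i < j)%N then if (i + j).+1 == k then lie (u i) (u j) else 0 else 0)
 + \sum_(i < c) \sum_(j < c) (if (j < i)%N then if (i + j).+1 == k then lie (u i) (u j) else 0 else 0))); last first.
  by rewrite (half (fun i j => i < j)%N) addNr.
rewrite -big_split; apply: eq_bigr => i _; rewrite -big_split; apply: eq_bigr => j _ /=.
by case: ltngtP => [||/ord_inj ->]; rewrite ?addr0 ?add0r // liexx if_same.
Qed.

Let lie3E (u v w : 'I_c -> L) (k : 'I_c) :
    (forall i : 'I_c, lcs i (u i)) -> (forall i : 'I_c, lcs i (v i)) -> (forall i : 'I_c, lcs i (w i)) ->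
  gr_lie (gr_of u) (gr_lie (gr_of v) (gr_of w)) k = coset_class (lcs k) (lcs k.+1)
    (\sum_(i < c) \sum_(j < c) \sum_(l < c | (i + j + l).+2 == k)
       lie (u i) (lie (v j) (w l))).
Proof.
move=> uP vP wP.
have -> : gr_lie (gr_of v) (gr_of w) = gr_of (fun m =>
    \sum_(i < c) \sum_(j < c | (i + j).+1 == m) lie (v i) (w j)).
  by apply: grP => m; rewrite gr_lieE.
rewrite gr_lieE //; last by move=> m; exact: lie_in.
congr coset_class; apply: eq_bigr => i _.
under eq_bigr do rewrite lie_sumr.
rewrite exchange_big; apply: eq_bigr => j _ /=.
under eq_bigr do rewrite lie_sumr big_mkcond.
rewrite exchange_big [RHS]big_mkcond; apply: eq_bigr => l _ /=.
case: eqP => ijl.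
  have jlc : ((j + l).+1 < c)%N.
    by apply: leq_ltn_trans (ltn_ord k); rewrite -ijl -addnA ltnS leqW // leq_addl.
  rewrite (bigD1 (Ordinal jlc)) /=; last by rewrite addnS addnA ijl.
  rewrite eqxx big1 ?addr0 // => m /andP[_ mjl].
  by case: eqP => // jlm; case/eqP: mjl; apply: val_inj.
rewrite big1 // => m /eqP imk; case: eqP => // jlm; case: ijl.
by rewrite -imk -jlm addnS addnA.
Qed.

Fact gr_lie_jacobi a b d :
  gr_lie a (gr_lie b d) + gr_lie b (gr_lie d a) + gr_lie d (gr_lie a b) = 0.
Proof.
elim/gr_ind: a => u uP; elim/gr_ind: b => v vP; elim/gr_ind: d => w wP.
apply: grP => k.
rewrite !grDE !lie3E //.
have in3 (x y z : 'I_c -> L) :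
    (forall i : 'I_c, lcs i (x i)) -> (forall i : 'I_c, lcs i (y i)) -> (forall i : 'I_c, lcs i (z i)) ->
    lcs k (\sum_(i < c) \sum_(j < c) \sum_(l < c | (i + j + l).+2 == k)
       lie (x i) (lie (y j) (z l))).
  move=> xP yP zP; apply: submod_sum => i _; apply: submod_sum => j _.
  apply: submod_sum => l /eqP ijl; apply: (@lcs_eq (i + (j + l).+1).+1).
    by rewrite addnS addnA.
  by apply: lie_lcs2; [exact: xP|apply: lie_lcs2; [exact: yP|exact: zP]].
have sum0 (x y z : L) : lcs k x -> lcs k y -> lcs k z -> x + y + z = 0 ->
    coset_class (lcs k) (lcs k.+1) x + coset_class (lcs k) (lcs k.+1) y +
    coset_class (lcs k) (lcs k.+1) z = 0.
  by move=> kx ky kz xyz0; rewrite -class0 -xyz0 !classD //; exact: submodD.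
rewrite gr0E; apply: sum0; [exact: in3|exact: in3|exact: in3|].
have -> : \sum_(i < c) \sum_(j < c) \sum_(l < c | (i + j + l).+2 == k)
       lie (v i) (lie (w j) (u l)) =
  \sum_(i < c) \sum_(j < c) \sum_(l < c | (i + j + l).+2 == k)
       lie (v j) (lie (w l) (u i)).
  under eq_bigr do under eq_bigr do rewrite big_mkcond.
  under [RHS]eq_bigr do under eq_bigr do rewrite big_mkcond.
  rewrite [RHS]exchange_big; apply: eq_bigr => j _.
  rewrite [RHS]exchange_big; apply: eq_bigr => l _.
  by apply: eq_bigr => i _ /=; rewrite addnC addnA.
have -> : \sum_(i < c) \sum_(j < c) \sum_(l < c | (i + j + l).+2 == k)
       lie (w i) (lie (u j) (v l)) =
  \sum_(i < c) \sum_(j < c) \sum_(l < c | (i + j + l).+2 == k)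
       lie (w l) (lie (u i) (v j)).
  under eq_bigr do under eq_bigr do rewrite big_mkcond.
  under [RHS]eq_bigr do under eq_bigr do rewrite big_mkcond.
  rewrite exchange_big; apply: eq_bigr => i _; rewrite exchange_big.
  by apply: eq_bigr => j _; apply: eq_bigr => l _; rewrite -addnA addnC.
rewrite -!big_split big1 // => i _; rewrite -!big_split big1 // => j _.
by rewrite -!big_split big1 // => l _; rewrite /= lie_jacobi.
Qed.

HB.instance Definition _ := Lmodule_isLie.Build R gr
  gr_lie_linearl gr_lie_linearr gr_lie_xx gr_lie_jacobi.

Definition gr_part (i : 'I_c) (a : gr) : gr := fun j => if j == i then a j else 0.

End Graded.
End LieTheory.

Section FreeLie.
Variables (R : comNzRingType) (X : Type).

Inductive lie_term :=
  | LieGen of X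
  | LieZero
  | LieAdd of lie_term & lie_term
  | LieOpp of lie_term
  | LieScale of R & lie_term
  | LieBracket of lie_term & lie_term.

(* The congruence on terms generated by the axioms of Lie algebras over R. *)
Inductive lie_eqv : lie_term -> lie_term -> Prop :=
  | lie_eqv_refl t : lie_eqv t t
  | lie_eqv_sym t u : lie_eqv t u -> lie_eqv u t
  | lie_eqv_trans t u v : lie_eqv t u -> lie_eqv u v -> lie_eqv t v
  | lie_eqv_add t t' u u' : lie_eqv t t' -> lie_eqv u u' ->
      lie_eqv (LieAdd t u) (LieAdd t' u')
  | lie_eqv_opp t t' : lie_eqv t t' -> lie_eqv (LieOpp t) (LieOpp t')
  | lie_eqv_scale a t t' : lie_eqv t t' ->
      lie_eqv (LieScale a t) (LieScale a t')
  | lie_eqv_bracket t t' u u' : lie_eqv t t' -> lie_eqv u u' ->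
      lie_eqv (LieBracket t u) (LieBracket t' u')
  | lie_eqv_addA t u v :
      lie_eqv (LieAdd t (LieAdd u v)) (LieAdd (LieAdd t u) v)
  | lie_eqv_addC t u : lie_eqv (LieAdd t u) (LieAdd u t)
  | lie_eqv_add0 t : lie_eqv (LieAdd LieZero t) t
  | lie_eqv_addN t : lie_eqv (LieAdd (LieOpp t) t) LieZero
  | lie_eqv_scaleA a b t :
      lie_eqv (LieScale a (LieScale b t)) (LieScale (a * b) t)
  | lie_eqv_scale1 t : lie_eqv (LieScale 1 t) t
  | lie_eqv_scaleDr a t u :
      lie_eqv (LieScale a (LieAdd t u)) (LieAdd (LieScale a t) (LieScale a u))
  | lie_eqv_scaleDl a b t :
      lie_eqv (LieScale (a + b) t) (LieAdd (LieScale a t) (LieScale b t))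
  | lie_eqv_linearl a t u v :
      lie_eqv (LieBracket (LieAdd (LieScale a t) u) v)
              (LieAdd (LieScale a (LieBracket t v)) (LieBracket u v))
  | lie_eqv_linearr a t u v :
      lie_eqv (LieBracket v (LieAdd (LieScale a t) u))
              (LieAdd (LieScale a (LieBracket v t)) (LieBracket v u))
  | lie_eqv_xx t : lie_eqv (LieBracket t t) LieZero
  | lie_eqv_jacobi t u v :
      lie_eqv (LieAdd (LieAdd (LieBracket t (LieBracket u v))
                              (LieBracket u (LieBracket v t)))
                      (LieBracket v (LieBracket t u))) LieZero.

HB.instance Definition _ := gen_eqMixin lie_term.
HB.instance Definition _ := gen_choiceMixin lie_term.

Definition lie_eqvb (t u : lie_term) := `[< lie_eqv t u >].

Fact lie_eqvb_refl : reflexive lie_eqvb.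
Proof. by move=> t; apply/asboolP; exact: lie_eqv_refl. Qed.
Fact lie_eqvb_sym : symmetric lie_eqvb.
Proof. by move=> t u; apply/asboolP/asboolP; exact: lie_eqv_sym. Qed.
Fact lie_eqvb_trans : transitive lie_eqvb.
Proof.
move=> u t v /asboolP tu /asboolP uv.
by apply/asboolP; exact: lie_eqv_trans uv.
Qed.

Canonical lie_equiv :=
  EquivRel lie_eqvb lie_eqvb_refl lie_eqvb_sym lie_eqvb_trans.

Definition free_lie := {eq_quot lie_equiv}.
HB.instance Definition _ := Choice.on free_lie.

Local Notation pi := (\pi_({eq_quot lie_equiv}) : lie_term -> free_lie).

Definition free_lie_gen (x : X) : free_lie := pi (LieGen x).

Lemma free_lieP t u : lie_eqv t u <-> pi t = pi u.
Proof.
split=> [tu|/eqmodP/asboolP //]; by apply/eqmodP/asboolP.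
Qed.

Lemma free_lie_ind (P : free_lie -> Prop) :
  (forall t, P (pi t)) -> forall x, P x.
Proof. by move=> Pt x; rewrite -[x]reprK; exact: Pt. Qed.

Definition free_lie_add (x y : free_lie) := pi (LieAdd (repr x) (repr y)).
Definition free_lie_opp (x : free_lie) := pi (LieOpp (repr x)).
Definition free_lie_scale a (x : free_lie) := pi (LieScale a (repr x)).
Definition free_lie_lie (x y : free_lie) := pi (LieBracket (repr x) (repr y)).

Let repr_pi t : lie_eqv (repr (pi t)) t.
Proof. by apply/free_lieP; rewrite reprK. Qed.

Let addE t u : free_lie_add (pi t) (pi u) = pi (LieAdd t u).
Proof. by apply/free_lieP; apply: lie_eqv_add; exact: repr_pi. Qed.
Let oppE t : free_lie_opp (pi t) = pi (LieOpp t).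
Proof. by apply/free_lieP; apply: lie_eqv_opp; exact: repr_pi. Qed.
Let scaleE a t : free_lie_scale a (pi t) = pi (LieScale a t).
Proof. by apply/free_lieP; apply: lie_eqv_scale; exact: repr_pi. Qed.
Let lieE t u : free_lie_lie (pi t) (pi u) = pi (LieBracket t u).
Proof. by apply/free_lieP; apply: lie_eqv_bracket; exact: repr_pi. Qed.

Fact free_lie_addA : associative free_lie_add.
Proof.
elim/free_lie_ind=> t; elim/free_lie_ind=> u; elim/free_lie_ind=> v.
by rewrite !addE; apply/free_lieP; exact: lie_eqv_addA.
Qed.
Fact free_lie_addC : commutative free_lie_add.
Proof.
elim/free_lie_ind=> t; elim/free_lie_ind=> u.
by rewrite !addE; apply/free_lieP; exact: lie_eqv_addC.
Qed.
Fact free_lie_add0 : left_id (pi LieZero) free_lie_add.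
Proof.
by elim/free_lie_ind=> t; rewrite addE; apply/free_lieP; exact: lie_eqv_add0.
Qed.
Fact free_lie_addN : left_inverse (pi LieZero) free_lie_opp free_lie_add.
Proof.
elim/free_lie_ind=> t; rewrite oppE addE.
by apply/free_lieP; exact: lie_eqv_addN.
Qed.
HB.instance Definition _ := GRing.isZmodule.Build free_lie
  free_lie_addA free_lie_addC free_lie_add0 free_lie_addN.

Fact free_lie_scaleA a b x :
  free_lie_scale a (free_lie_scale b x) = free_lie_scale (a * b) x.
Proof.
elim/free_lie_ind: x => t; rewrite !scaleE.
by apply/free_lieP; exact: lie_eqv_scaleA.
Qed.
Fact free_lie_scale1 : left_id 1 free_lie_scale.
Proof.
by elim/free_lie_ind=> t; rewrite scaleE; apply/free_lieP; exact: lie_eqv_scale1.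
Qed.
Fact free_lie_scaleDr : right_distributive free_lie_scale +%R.
Proof.
move=> a; elim/free_lie_ind=> t; elim/free_lie_ind=> u.
rewrite [pi t + _]addE !scaleE [RHS]addE.
by apply/free_lieP; exact: lie_eqv_scaleDr.
Qed.
Fact free_lie_scaleDl x : {morph free_lie_scale^~ x : a b / a + b}.
Proof.
elim/free_lie_ind: x => t a b; rewrite !scaleE [RHS]addE.
by apply/free_lieP; exact: lie_eqv_scaleDl.
Qed.
HB.instance Definition _ := GRing.Zmodule_isLmodule.Build R free_lie
  free_lie_scaleA free_lie_scale1 free_lie_scaleDr free_lie_scaleDl.

Let addrE t u : pi t + pi u = pi (LieAdd t u).
Proof. exact: addE. Qed.
Let scalerE a t : a *: pi t = pi (LieScale a t).
Proof. exact: scaleE. Qed.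

Fact free_lie_linearl a x y z :
  free_lie_lie (a *: x + y) z = a *: free_lie_lie x z + free_lie_lie y z.
Proof.
elim/free_lie_ind: x => t; elim/free_lie_ind: y => u; elim/free_lie_ind: z => v.
rewrite scalerE addrE !lieE scalerE addrE.
by apply/free_lieP; exact: lie_eqv_linearl.
Qed.
Fact free_lie_linearr a x y z :
  free_lie_lie z (a *: x + y) = a *: free_lie_lie z x + free_lie_lie z y.
Proof.
elim/free_lie_ind: x => t; elim/free_lie_ind: y => u; elim/free_lie_ind: z => v.
rewrite scalerE addrE !lieE scalerE addrE.
by apply/free_lieP; exact: lie_eqv_linearr.
Qed.
Fact free_lie_xx x : free_lie_lie x x = 0.
Proof.
by elim/free_lie_ind: x => t; rewrite lieE; apply/free_lieP; exact: lie_eqv_xx.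
Qed.
Fact free_lie_jacobi x y z :
  free_lie_lie x (free_lie_lie y z) + free_lie_lie y (free_lie_lie z x) +
  free_lie_lie z (free_lie_lie x y) = 0.
Proof.
elim/free_lie_ind: x => t; elim/free_lie_ind: y => u; elim/free_lie_ind: z => v.
rewrite (lieE u v) (lieE v t) (lieE t u) !lieE !addrE.
by apply/free_lieP; exact: lie_eqv_jacobi.
Qed.
HB.instance Definition _ := Lmodule_isLie.Build R free_lie
  free_lie_linearl free_lie_linearr free_lie_xx free_lie_jacobi.
End FreeLie.

Definition free_nilpotent_lie (c d : nat) :=
  lie_quotient (lcs (free_lie int 'I_d) c).
HB.instance Definition _ c d := LieAlgebra.on (free_nilpotent_lie c d).

(* The tensor product over the integers of a Lie ring L with R. *)
Section BaseChange.
Variables (L : lieAlgType int) (R : comNzRingType).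

Inductive tensor_term :=
  | TPure of L & R
  | TZero
  | TAdd of tensor_term & tensor_term
  | TOpp of tensor_term.

Inductive tensor_eqv : tensor_term -> tensor_term -> Prop :=
  | tensor_eqv_refl t : tensor_eqv t t
  | tensor_eqv_sym t u : tensor_eqv t u -> tensor_eqv u t
  | tensor_eqv_trans t u v :
      tensor_eqv t u -> tensor_eqv u v -> tensor_eqv t v
  | tensor_eqv_add t t' u u' : tensor_eqv t t' -> tensor_eqv u u' ->
      tensor_eqv (TAdd t u) (TAdd t' u')
  | tensor_eqv_opp t t' : tensor_eqv t t' -> tensor_eqv (TOpp t) (TOpp t')
  | tensor_eqv_addA t u v :
      tensor_eqv (TAdd t (TAdd u v)) (TAdd (TAdd t u) v)
  | tensor_eqv_addC t u : tensor_eqv (TAdd t u) (TAdd u t)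
  | tensor_eqv_add0 t : tensor_eqv (TAdd TZero t) t
  | tensor_eqv_addN t : tensor_eqv (TAdd (TOpp t) t) TZero
  | tensor_eqv_pureDl x y r :
      tensor_eqv (TPure (x + y) r) (TAdd (TPure x r) (TPure y r))
  | tensor_eqv_pureDr x r s :
      tensor_eqv (TPure x (r + s)) (TAdd (TPure x r) (TPure x s))
  | tensor_eqv_pureZ n x r :
      tensor_eqv (TPure (n *: x) r) (TPure x (n%:~R * r)).

HB.instance Definition _ := gen_eqMixin tensor_term.
HB.instance Definition _ := gen_choiceMixin tensor_term.

Definition tensor_eqvb (t u : tensor_term) := `[< tensor_eqv t u >].

Fact tensor_eqvb_refl : reflexive tensor_eqvb.
Proof. by move=> t; apply/asboolP; exact: tensor_eqv_refl. Qed.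
Fact tensor_eqvb_sym : symmetric tensor_eqvb.
Proof. by move=> t u; apply/asboolP/asboolP; exact: tensor_eqv_sym. Qed.
Fact tensor_eqvb_trans : transitive tensor_eqvb.
Proof.
move=> u t v /asboolP tu /asboolP uv.
by apply/asboolP; exact: tensor_eqv_trans uv.
Qed.

Canonical tensor_equiv :=
  EquivRel tensor_eqvb tensor_eqvb_refl tensor_eqvb_sym tensor_eqvb_trans.

Definition base_change := {eq_quot tensor_equiv}.
HB.instance Definition _ := Choice.on base_change.

Local Notation pi := (\pi_({eq_quot tensor_equiv}) : tensor_term -> base_change).

Definition pure_tensor (x : L) (r : R) : base_change := pi (TPure x r).

Lemma base_changeP t u : tensor_eqv t u <-> pi t = pi u.
Proof.
split=> [tu|/eqmodP/asboolP //]; by apply/eqmodP/asboolP.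
Qed.

Let pi_ind (P : base_change -> Prop) : (forall t, P (pi t)) -> forall x, P x.
Proof. by move=> Pt x; rewrite -[x]reprK; exact: Pt. Qed.

Definition base_change_add (x y : base_change) := pi (TAdd (repr x) (repr y)).
Definition base_change_opp (x : base_change) := pi (TOpp (repr x)).

Let repr_pi t : tensor_eqv (repr (pi t)) t.
Proof. by apply/base_changeP; rewrite reprK. Qed.

Let addE t u : base_change_add (pi t) (pi u) = pi (TAdd t u).
Proof. by apply/base_changeP; apply: tensor_eqv_add; exact: repr_pi. Qed.
Let oppE t : base_change_opp (pi t) = pi (TOpp t).
Proof. by apply/base_changeP; apply: tensor_eqv_opp; exact: repr_pi. Qed.

Fact base_change_addA : associative base_change_add.
Proof.
elim/pi_ind=> t; elim/pi_ind=> u; elim/pi_ind=> v.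
by rewrite !addE; apply/base_changeP; exact: tensor_eqv_addA.
Qed.
Fact base_change_addC : commutative base_change_add.
Proof.
elim/pi_ind=> t; elim/pi_ind=> u.
by rewrite !addE; apply/base_changeP; exact: tensor_eqv_addC.
Qed.
Fact base_change_add0 : left_id (pi TZero) base_change_add.
Proof.
by elim/pi_ind=> t; rewrite addE; apply/base_changeP; exact: tensor_eqv_add0.
Qed.
Fact base_change_addN : left_inverse (pi TZero) base_change_opp base_change_add.
Proof.
elim/pi_ind=> t; rewrite oppE addE.
by apply/base_changeP; exact: tensor_eqv_addN.
Qed.
HB.instance Definition _ := GRing.isZmodule.Build base_change
  base_change_addA base_change_addC base_change_add0 base_change_addN.

Let addrE t u : pi t + pi u = pi (TAdd t u).
Proof. exact: addE. Qed.
Let opprE t : - pi t = pi (TOpp t).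
Proof. exact: oppE. Qed.

Lemma pure_tensorDl x y r :
  pure_tensor (x + y) r = pure_tensor x r + pure_tensor y r.
Proof. by rewrite addrE; apply/base_changeP; exact: tensor_eqv_pureDl. Qed.

Lemma pure_tensorDr x r s :
  pure_tensor x (r + s) = pure_tensor x r + pure_tensor x s.
Proof. by rewrite addrE; apply/base_changeP; exact: tensor_eqv_pureDr. Qed.

Lemma pure_tensorZ n x r : pure_tensor (n *: x) r = pure_tensor x (n%:~R * r).
Proof. by apply/base_changeP; exact: tensor_eqv_pureZ. Qed.

Lemma pure_tensor0l r : pure_tensor 0 r = 0.
Proof. by apply: (addrI (pure_tensor 0 r)); rewrite -pure_tensorDl !addr0. Qed.

Lemma base_change_ind (P : base_change -> Prop) :
  (forall x r, P (pure_tensor x r)) ->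
  (forall a b, P a -> P b -> P (a + b)) -> forall a, P a.
Proof.
move=> Ppure Padd; elim/pi_ind; elim=> [x r||t Pt u Pu|t Pt].
- exact: Ppure.
- rewrite (_ : pi TZero = 0) // -(pure_tensor0l 0); exact: Ppure.
- by rewrite -addrE; exact: Padd.
suff [] : P (pi t) /\ P (- pi t) by rewrite opprE.
elim: t {Pt} => [x r||t [Pt PNt] u [Pu PNu]|t [Pt PNt]].
- split; first exact: Ppure.
  suff -> : - pi (TPure x r) = pure_tensor (- x) r by exact: Ppure.
  apply/eqP; rewrite eq_sym -addr_eq0; apply/eqP.
  by rewrite -[pi _]/(pure_tensor x r) -pure_tensorDl addNr pure_tensor0l.
- rewrite (_ : pi TZero = 0) // oppr0 -(pure_tensor0l 0); split; exact: Ppure.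
- by rewrite -addrE opprD; split; exact: Padd.
- by rewrite -opprE opprK.
Qed.

(* Balanced biadditive maps factor through the tensor product. *)
Section Lift.
Variables (M : zmodType) (f : L -> R -> M).
Hypothesis fDl : forall x y r, f (x + y) r = f x r + f y r.
Hypothesis fDr : forall x r s, f x (r + s) = f x r + f x s.
Hypothesis fZ : forall n x r, f (n *: x) r = f x (n%:~R * r).

Fixpoint tensor_eval (t : tensor_term) : M :=
  match t with
  | TPure x r => f x r
  | TZero => 0
  | TAdd t u => tensor_eval t + tensor_eval u
  | TOpp t => - tensor_eval t
  end.

Lemma tensor_eval_eqv t u : tensor_eqv t u -> tensor_eval t = tensor_eval u.
Proof.
elim=> //= {t u}.
- by move=> t u v _ -> _ ->.
- by move=> t t' u u' _ -> _ ->.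
- by move=> t t' _ ->.
- by move=> t u v; rewrite addrA.
- by move=> t u; rewrite addrC.
- by move=> t; rewrite add0r.
- by move=> t; rewrite addNr.
Qed.

Definition tensor_lift (a : base_change) : M := tensor_eval (repr a).

Let lift_pi t : tensor_lift (pi t) = tensor_eval t.
Proof. by apply: tensor_eval_eqv; exact: repr_pi. Qed.

Lemma tensor_lift_pure x r : tensor_lift (pure_tensor x r) = f x r.
Proof. exact: lift_pi. Qed.

Lemma tensor_liftD a b : tensor_lift (a + b) = tensor_lift a + tensor_lift b.
Proof. by elim/pi_ind: a => t; elim/pi_ind: b => u; rewrite addrE !lift_pi. Qed.
End Lift.

Definition base_change_scale (a : R) : base_change -> base_change :=
  tensor_lift (fun x r => pure_tensor x (a * r)).

Definition base_change_lie (a b : base_change) : base_change :=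
  tensor_lift (fun x r =>
    tensor_lift (fun y s => pure_tensor (lie x y) (r * s)) b) a.

Lemma scale_pure a x r :
  base_change_scale a (pure_tensor x r) = pure_tensor x (a * r).
Proof.
rewrite /base_change_scale tensor_lift_pure // => [x' y' r'|x' r' s'|n x' r'].
- exact: pure_tensorDl.
- by rewrite mulrDr pure_tensorDr.
- by rewrite pure_tensorZ mulrCA.
Qed.

Let scaleD a x y : base_change_scale a (x + y) =
  base_change_scale a x + base_change_scale a y.
Proof.
rewrite /base_change_scale tensor_liftD // => [x' y' r'|x' r' s'|n x' r'].
- exact: pure_tensorDl.
- by rewrite mulrDr pure_tensorDr.
- by rewrite pure_tensorZ mulrCA.
Qed.

Fact base_change_scaleA a b x :
  base_change_scale a (base_change_scale b x) = base_change_scale (a * b) x.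
Proof.
elim/base_change_ind: x => [x r|x y IHx IHy]; first by rewrite !scale_pure mulrA.
by rewrite !scaleD IHx IHy.
Qed.
Fact base_change_scale1 : left_id 1 base_change_scale.
Proof.
elim/base_change_ind=> [x r|x y IHx IHy]; first by rewrite scale_pure mul1r.
by rewrite scaleD IHx IHy.
Qed.
Fact base_change_scaleDr : right_distributive base_change_scale +%R.
Proof. by move=> a x y; exact: scaleD. Qed.
Fact base_change_scaleDl x : {morph base_change_scale^~ x : a b / a + b}.
Proof.
move=> a b; elim/base_change_ind: x => [x r|x y IHx IHy].
  by rewrite !scale_pure mulrDl pure_tensorDr.
by rewrite !scaleD IHx IHy addrACA.
Qed.
HB.instance Definition _ := GRing.Zmodule_isLmodule.Build R base_change
  base_change_scaleA base_change_scale1 base_change_scaleDr base_change_scaleDl.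

Let inner x r b := tensor_lift (fun y s => pure_tensor (lie x y) (r * s)) b.

Let inner_pure x r y s : inner x r (pure_tensor y s) = pure_tensor (lie x y) (r * s).
Proof.
rewrite /inner tensor_lift_pure // => [x' y' r'|x' r' s'|n x' r'].
- by rewrite lieDr pure_tensorDl.
- by rewrite mulrDr pure_tensorDr.
- by rewrite lieZr pure_tensorZ mulrCA.
Qed.

Let innerD x r a b : inner x r (a + b) = inner x r a + inner x r b.
Proof.
rewrite /inner tensor_liftD // => [x' y' r'|x' r' s'|n x' r'].
- by rewrite lieDr pure_tensorDl.
- by rewrite mulrDr pure_tensorDr.
- by rewrite lieZr pure_tensorZ mulrCA.
Qed.

Let innerDl x y r b : inner (x + y) r b = inner x r b + inner y r b.
Proof.
elim/base_change_ind: b => [z s|a b IHa IHb].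
  by rewrite !inner_pure lieDl pure_tensorDl.
by rewrite !innerD IHa IHb addrACA.
Qed.
Let innerDr x r s b : inner x (r + s) b = inner x r b + inner x s b.
Proof.
elim/base_change_ind: b => [z t|a b IHa IHb].
  by rewrite !inner_pure mulrDl pure_tensorDr.
by rewrite !innerD IHa IHb addrACA.
Qed.
Let innerZ n x r b : inner (n *: x) r b = inner x (n%:~R * r) b.
Proof.
elim/base_change_ind: b => [z t|a b IHa IHb].
  by rewrite !inner_pure lieZl pure_tensorZ mulrA.
by rewrite !innerD IHa IHb.
Qed.

Let lie_purel x r b : base_change_lie (pure_tensor x r) b = inner x r b.
Proof.
by apply: (tensor_lift_pure (f := fun x r => inner x r b)) => *;
  rewrite (innerDl, innerDr, innerZ).
Qed.

Lemma lie_pure x r y s : base_change_lie (pure_tensor x r) (pure_tensor y s) =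
  pure_tensor (lie x y) (r * s).
Proof.
by rewrite lie_purel inner_pure.
Qed.

Let lieDl a b d :
  base_change_lie (a + b) d = base_change_lie a d + base_change_lie b d.
Proof.
by apply: (tensor_liftD (f := fun x r => inner x r d)) => *;
  rewrite (innerDl, innerDr, innerZ).
Qed.

Let lieDr a b d :
  base_change_lie d (a + b) = base_change_lie d a + base_change_lie d b.
Proof.
elim/base_change_ind: d => [x r|d e IHd IHe].
  by rewrite !lie_purel innerD.
by rewrite !lieDl IHd IHe addrACA.
Qed.

Let lieZl a x y : base_change_lie (a *: x) y = a *: base_change_lie x y.
Proof.
elim/base_change_ind: x => [x r|x x' IHx IHx']; last first.
  by rewrite scalerDr !lieDl IHx IHx' scalerDr.
elim/base_change_ind: y => [y s|y y' IHy IHy']; last first.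
  by rewrite !lieDr IHy IHy' scalerDr.
rewrite [a *: pure_tensor x r]scale_pure !lie_pure [RHS]scale_pure.
by rewrite mulrA.
Qed.

Let lieZr a x y : base_change_lie y (a *: x) = a *: base_change_lie y x.
Proof.
elim/base_change_ind: x => [x r|x x' IHx IHx']; last first.
  by rewrite scalerDr !lieDr IHx IHx' scalerDr.
elim/base_change_ind: y => [y s|y y' IHy IHy']; last first.
  by rewrite !lieDl IHy IHy' scalerDr.
rewrite [a *: pure_tensor x r]scale_pure !lie_pure [RHS]scale_pure.
by rewrite mulrCA.
Qed.

Fact base_change_linearl a x y z :
  base_change_lie (a *: x + y) z = a *: base_change_lie x z + base_change_lie y z.
Proof. by rewrite lieDl lieZl. Qed.
Fact base_change_linearr a x y z :
  base_change_lie z (a *: x + y) = a *: base_change_lie z x + base_change_lie z y.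
Proof. by rewrite lieDr lieZr. Qed.

Let pure_tensorNl x r : pure_tensor (- x) r = - pure_tensor x r.
Proof.
by apply/eqP; rewrite -addr_eq0 -pure_tensorDl addNr pure_tensor0l.
Qed.

Let lieC' x y : base_change_lie x y = - base_change_lie y x.
Proof.
elim/base_change_ind: x => [x r|x x' IHx IHx']; last first.
  by rewrite lieDl lieDr IHx IHx' opprD.
elim/base_change_ind: y => [y s|y y' IHy IHy']; last first.
  by rewrite lieDl lieDr IHy IHy' opprD.
by rewrite !lie_pure lieC pure_tensorNl mulrC.
Qed.

Fact base_change_xx x : base_change_lie x x = 0.
Proof.
elim/base_change_ind: x => [x r|x y IHx IHy].
  by rewrite lie_pure liexx pure_tensor0l.
by rewrite lieDl !lieDr IHx IHy add0r addr0 (lieC' x) addNr.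
Qed.

Fact base_change_jacobi x y z :
  base_change_lie x (base_change_lie y z) +
  base_change_lie y (base_change_lie z x) +
  base_change_lie z (base_change_lie x y) = 0.
Proof.
have sum3 (a b d a' b' d' : base_change) : a + b + d = 0 -> a' + b' + d' = 0 ->
    (a + a') + (b + b') + (d + d') = 0.
  by move=> s s'; rewrite (addrACA a) (addrACA (a + b)) s s' addr0.
elim/base_change_ind: x => [x r|x x' IHx IHx']; last first.
  by rewrite !(lieDl, lieDr); exact: sum3.
elim/base_change_ind: y => [y s|y y' IHy IHy']; last first.
  by rewrite !(lieDl, lieDr); exact: sum3.
elim/base_change_ind: z => [z t|z z' IHz IHz']; last first.
  by rewrite !(lieDl, lieDr); exact: sum3.
rewrite !lie_pure [(s * (t * r))]mulrA [s * t * r]mulrC.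
rewrite [t * (r * s)]mulrC -[r * s * t]mulrA.
by rewrite -!pure_tensorDl lie_jacobi pure_tensor0l.
Qed.

HB.instance Definition _ := Lmodule_isLie.Build R base_change
  base_change_linearl base_change_linearr base_change_xx base_change_jacobi.
End BaseChange.

Section ZetaFunction.
Variables (A : comNzRingType) (L : lieAlgType A) (c : nat).

(* I is the direct sum of its intersections with the homogeneous summands: it
   consists of the elements all of whose homogeneous parts lie in I. *)
Definition is_graded (I : set (gr L c)) :=
  I = [set a | forall i, I (gr_part i a)].

Record graded_ideal := GradedIdeal {
  graded_ideal_set :> set (gr L c);
  graded_ideal_is_lie_ideal : is_lie_ideal graded_ideal_set;
  graded_ideal_is_graded : is_graded graded_ideal_set;
  graded_ideal_finite_index : finite_index graded_ideal_set }.

HB.instance Definition _ := gen_eqMixin graded_ideal.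
HB.instance Definition _ := gen_choiceMixin graded_ideal.
End ZetaFunction.

Section ComplexPowers.
Variable R : realType.
Local Open Scope complex_scope.

Definition complex_exp (z : R[i]) : R[i] :=
  (expR (complex.Re z))%:C * (cos (complex.Im z) +i* sin (complex.Im z)).

(* The complex power n ^ s, for n > 0. *)
Definition nat_cpow (n : nat) (s : R[i]) : R[i] :=
  complex_exp (s * (ln n%:R)%:C).
End ComplexPowers.

Definition has_sum (K : numFieldType) (T : choiceType) (f : T -> K) (l : K) :=
  partial_sum f @ totally --> l.

(* For L nilpotent of class c, the series defining the graded ideal zeta
   function of L converges unconditionally at s, with sum z. *)
Definition graded_ideal_zeta (R : realType) (A : comNzRingType)
    (L : lieAlgType A) (c : nat) (s z : R[i]) :=
  has_sum (fun I : graded_ideal L c => nat_cpow (mod_index I) (- s)) z.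

(* For a local ring A, whose maximal ideal consists of the non-units. *)
Definition maximal_ideal (A : comNzRingType) : set A :=
  [set x | ~ exists y, x * y = 1].
Definition residue_card (A : comNzRingType) : nat :=
  mod_index (@maximal_ideal A : set A^o).

Section IgusaFunctions.
Variables (F : fieldType) (q : F).

(* The Gaussian binomial coefficient at q^-1. *)
Definition gauss_binomial (a b : nat) : F :=
  \prod_(1 <= k < b.+1) ((1 - q ^- (a - b + k)) / (1 - q ^- k)).

Fixpoint gauss_flag (s : seq nat) : F :=
  match s with
  | a :: ((b :: _) as s') => gauss_binomial b a * gauss_flag s'
  | _ => 1
  end.

(* S stands for a subset of {1, ..., n - 1}; enum S is increasing. *)
Definition gauss_multinomial (n : nat) (S : {set 'I_n}) : F :=
  gauss_flag (rcons [seq val i | i <- enum S] n).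

(* The variable X_i is the entry i.-1 of the sequence X. *)
Definition igusa (X : seq F) : F :=
  let n := size X in
  (1 - X`_n.-1)^-1 *
  \sum_(S : {set 'I_n} | [forall i in S, (0 < i)%N])
    gauss_multinomial S * \prod_(i in S) (X`_i.-1 / (1 - X`_i.-1)).

Definition igusa_circ (X : seq F) : F := X`_(size X).-1 * igusa X.
End IgusaFunctions.

Definition W_formula (F : fieldType) (q t : F) : F :=
  let bin := gauss_binomial q in
  let I := igusa q in
  let I' := igusa_circ q in
  let x i := q ^+ (i * (8 - i)) * t ^+ (6 + i) in
  let y i := q ^+ (2 + i * (5 - i)) * t ^+ (5 + i) in
  let xs a b := [seq x i | i <- index_iota a b.+1] in
  let ys a b := [seq y i | i <- index_iota a b.+1] in
  let A := I [:: q ^+ 2 * t ^+ 3; q ^+ 2 * t ^+ 5; t ^+ 6] * I (xs 1 8) in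
  let B j := bin 5 j * bin 3 1 * I [:: q ^+ 2 * t ^+ 3; q ^+ 2 * t ^+ 5] *
    I' (ys 1 j) * I [:: x j] * I (xs j.+1 8) in
  let C1 := bin 3 1 * bin 2 1 * I [:: q ^+ 2 * t ^+ 3] *
    I' [:: q ^+ 3 * t ^+ 4] * I [:: q ^+ 6 * t ^+ 6; q ^+ 7 * t ^+ 7] *
    I (xs 2 8) in
  let C j := bin 4 j.-1 * bin 3 1 * bin 2 1 ^+ 2 * I [:: q ^+ 2 * t ^+ 3] *
    I' [:: q ^+ 3 * t ^+ 4] * I [:: q ^+ 6 * t ^+ 6] * I' (ys 2 j) *
    I [:: x j] * I (xs j.+1 8) in
  let E1 := bin 3 1 * I [:: q ^+ 2 * t ^+ 3] *
    I' [:: q ^+ 3 * t ^+ 4; q ^+ 2 * t ^+ 5] *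
    I [:: q ^+ 8 * t ^+ 7; q ^+ 12 * t ^+ 8] * I (xs 3 8) in
  let E j := bin 3 j.-1 * bin 3 1 * bin 2 1 * I [:: q ^+ 2 * t ^+ 3] *
    I' [:: q ^+ 3 * t ^+ 4; q ^+ 2 * t ^+ 5] * I [:: q ^+ 8 * t ^+ 7] *
    I' (ys 3 j.+1) * I [:: x j.+1] * I (xs j.+2 8) in
  (A + \sum_(1 <= j < 6) B j + (C1 + \sum_(2 <= j < 6) C j)
     + (E1 + \sum_(2 <= j < 5) E j))
  / ((1 - t) * (1 - q * t) * (1 - q ^+ 2 * t)).

(* Following polyXY, {poly {poly rat}} is the ring of polynomials in the outer
   variable 'X and the inner variable 'Y = 'X%:P. *)
Notation ratfun := {fraction {poly {poly rat}}}.

Definition Xfrac : ratfun := tofrac 'X.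
Definition Yfrac : ratfun := tofrac 'Y.

Definition poly_value (F : fieldType) (P : {poly {poly rat}}) (x y : F) : F :=
  (map_poly (map_poly (ratr : rat -> F)) P).[x, y].

(* For F of characteristic 0: W is defined at (x, y), with value v. *)
Definition ratfun_value (F : fieldType) (W : ratfun) (x y v : F) :=
  exists N D : {poly {poly rat}},
    [/\ W = tofrac N / tofrac D, poly_value D x y != 0 &
        v = poly_value N x y / poly_value D x y].

Definition W33 : ratfun := W_formula Xfrac Yfrac.

Definition D33 : {poly {poly rat}} :=
  (1 - 'Y) * (1 - 'X * 'Y) * (1 - 'X^2 * 'Y) * (1 - 'X^3 * 'Y ^+ 4) *
  (1 - 'X * 'Y ^+ 5) * (1 - 'X^2 * 'Y ^+ 5) * (1 - 'Y ^+ 6) *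
  (1 - 'X^7 * 'Y ^+ 7) * (1 - 'X^8 * 'Y ^+ 7) * (1 - 'X^8 * 'Y ^+ 8) *
  (1 - 'X^12 * 'Y ^+ 8) * (1 - 'X^6 * 'Y ^+ 9) * (1 - 'X^15 * 'Y ^+ 9) *
  (1 - 'X^16 * 'Y ^+ 10) * (1 - 'X^15 * 'Y ^+ 11) * (1 - 'X^12 * 'Y ^+ 12) *
  (1 - 'X^7 * 'Y ^+ 13) * (1 - 'Y ^+ 14).

(* Main.v *)
From Stdlib Require Import ZArith.
From HB Require Import structures.
Require Import Defs.
From mathcomp Require Import all_boot all_order all_algebra all_field.
From mathcomp Require Import all_classical all_reals all_analysis.
From mathcomp Require Import generic_quotient finmap polyXY complex fraction summability mxabelem.
From mathcomp Require Import zify ring ssrZ.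
Import Order.TTheory GRing.Theory Num.Theory numFieldNormedType.Exports.
Set Implicit Arguments.
Unset Strict Implicit.
Unset Printing Implicit Defensive.
Local Open Scope ring_scope.

Module Lattices.
Local Open Scope classical_set_scope.

Record uniformizer (o : comNzRingType) (pi : o) (F : finFieldType)
    (red : {rmorphism o -> F}) : Prop := Uniformizer {
  red_surj : forall a, exists x, red x = a;
  red_ker : forall x, red x = 0 <-> exists y, x = pi * y;
  pi_reg : forall x, pi * x = 0 -> x = 0;
  red_unit : forall x, red x != 0 -> exists y, x * y = 1 }.

Section Lattices.
Variables (o : comNzRingType) (pi : o) (F : finFieldType) (red : {rmorphism o -> F}).
Hypothesis piP : uniformizer pi red.

Let red_surj := red_surj piP.
Let red_ker := red_ker piP.
Let pi_reg := pi_reg piP.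
Let red_unit := red_unit piP.

Definition colon (V : lmodType o) (M : set V) : set V := [set x | M (pi *: x)].

Lemma colon_submod (V : lmodType o) (M : set V) :
  is_submod M -> is_submod (colon M).
Proof.
case=> M0 ML; split; rewrite /colon /=; first by rewrite scaler0.
by move=> a x y Mx My; rewrite scalerDr scalerA mulrC -scalerA; exact: ML.
Qed.

Lemma submod_scale (V : lmodType o) (M : set V) a x : is_submod M -> M x -> M (a *: x).
Proof. by case=> M0 ML Mx; rewrite -[_ *: _]addr0; exact: ML. Qed.

Lemma submod_add (V : lmodType o) (M : set V) x y : is_submod M -> M x -> M y -> M (x + y).
Proof. by case=> M0 ML Mx My; rewrite -[x]scale1r; exact: ML. Qed.

Lemma submod_sub (V : lmodType o) (M : set V) x y : is_submod M -> M x -> M y -> M (x - y).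
Proof.
move=> MP Mx My; apply: submod_add => //; rewrite -scaleN1r.
exact: submod_scale.
Qed.

Lemma submod_bigsum (V : lmodType o) (M : set V) I (r : seq I) (f : I -> V) :
  is_submod M -> (forall i, M (f i)) -> M (\sum_(i <- r) f i).
Proof.
move=> MP Mf; elim/big_ind: _ => //; first by case: MP.
by move=> x y; apply: submod_add.
Qed.

Lemma sub_colon (V : lmodType o) (M : set V) : is_submod M -> M `<=` colon M.
Proof. by move=> MP x; exact: submod_scale. Qed.

Definition lft (a : F) : o := s2val (cid2 (let: ex_intro x e := red_surj a in ex_intro2 (fun=> True) (fun x => red x = a) x I e)).

Lemma lftK : cancel lft red.
Proof. by move=> a; rewrite /lft; case: cid2. Qed.

Definition rowred m n (A : 'M[o]_(m, n)) : 'M[F]_(m, n) := map_mx red A.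
Definition rowlft m n (A : 'M[F]_(m, n)) : 'M[o]_(m, n) := map_mx lft A.

Lemma rowlftK m n (A : 'M[F]_(m, n)) : rowred (rowlft A) = A.
Proof. by apply/matrixP => i j; rewrite !mxE lftK. Qed.

Lemma rowred_ker m n (A : 'M[o]_(m, n)) : rowred A = 0 -> exists B, A = pi *: B.
Proof.
move=> A0; have h i j : exists b, A i j = pi * b.
  by apply/red_ker; have /matrixP/(_ i j) := A0; rewrite !mxE.
exists (\matrix_(i, j) xget 0 [set b | A i j = pi * b]).
apply/matrixP => i j; rewrite !mxE; case: xgetP => [b _ //|/= nb].
by case: (h i j) => b /nb.
Qed.

Lemma rowredZ m n (A : 'M[o]_(m, n)) : rowred (pi *: A) = 0.
Proof.
apply/matrixP => i j; rewrite !mxE rmorphM /= (_ : red pi = 0) ?mul0r //.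
by apply/red_ker; exists 1; rewrite mulr1.
Qed.

Lemma row_reg m n (A : 'M[o]_(m, n)) : pi *: A = 0 -> A = 0.
Proof.
by move=> /matrixP A0; apply/matrixP => i j; rewrite [RHS]mxE; apply: pi_reg; have := A0 i j; rewrite !mxE.
Qed.

Lemma row_inj m n (A B : 'M[o]_(m, n)) : pi *: A = pi *: B -> A = B.
Proof. by move=> AB; apply/subr0_eq/row_reg; rewrite scalerBr AB subrr. Qed.

(* The row space over the residue field of the image of M. *)
Definition spanF n (M : set 'rV[o]_n) : 'M[F]_n :=
  (\sum_(w : 'rV[F]_n | `[< exists2 v, M v & rowred v = w >]) <<w>>)%MS.

Lemma in_spanF n (M : set 'rV[o]_n) (w : 'rV[F]_n) : is_submod M ->
  (w <= spanF M)%MS <-> exists2 v, M v & rowred v = w.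
Proof.
move=> MP; split=> [/sub_sumsmxP [u ->]|vw]; last first.
  by apply: (sumsmx_sup w); [apply/asboolP|rewrite genmxE].
apply: (big_ind (fun x : 'rV[F]_n => exists2 v, M v & rowred v = x)) => [|x y [v Mv <-] [v' Mv' <-]|x /asboolP [v Mv vx]].
- by exists 0; [case: MP|rewrite /rowred map_mx0].
- by exists (v + v'); [exact: submod_add|rewrite /rowred map_mxD].
have : (u x *m <<x>> <= x)%MS by rewrite (submx_trans (submxMl _ _)) ?genmxE.
move=> /sub_rVP [a ->]; exists (lft a *: v); first exact: submod_scale.
by apply/rowP => i; rewrite !mxE rmorphM /= lftK -vx mxE.
Qed.

Definition corank n (M : set 'rV[o]_n) : nat := n - \rank (spanF M).

(* N is the free lattice with basis the rows of B. *)
Definition is_basis n (B : 'M[o]_n) (N : set 'rV[o]_n) :=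
  (forall w : 'rV_n, w *m B = 0 -> w = 0) /\ N = range (fun w : 'rV_n => w *m B).

(* The lattices between pi N and N, given by subspaces of N / pi N. *)
Definition sublat n (B : 'M[o]_n) (W : 'M[F]_n) : set 'rV[o]_n :=
  [set w *m B | w in [set w | (rowred w <= W)%MS]].

Lemma lift_submod n (B : 'M[o]_n) W : is_submod (sublat B W).
Proof.
split; first by exists 0; rewrite ?mul0mx //= /rowred map_mx0 sub0mx.
move=> a _ _ [v vW <-] [w wW <-]; exists (a *: v + w); last by rewrite mulmxDl scalemxAl.
by rewrite /= /rowred map_mxD map_mxZ addmx_sub // scalemx_sub.
Qed.

Lemma inv_mx_lift n (E : 'M[F]_n) : E \in unitmx ->
  exists G : 'M[o]_n, exists G', [/\ rowred G = E, G *m G' = 1%:M & G' *m G = 1%:M].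
Proof.
rewrite unitmxE unitfE -{1}(rowlftK E) /rowred det_map_mx => /red_unit [y dy].
exists (rowlft E), (y *: \adj (rowlft E)); split; first exact: rowlftK.
  by rewrite -scalemxAr mul_mx_adj -mul_scalar_mx -scalar_mxM mulrC dy.
by rewrite -scalemxAl mul_adj_mx -mul_scalar_mx -scalar_mxM mulrC dy.
Qed.

Lemma lift_basis n (B : 'M[o]_n) N W : is_basis B N -> exists B', is_basis B' (sublat B W).
Proof.
case=> Binj _; set d := \rank W.
have [G [G' [GE GG' G'G]]] := inv_mx_lift (row_ebase_unit W).
pose Dd : 'M[o]_n := diag_mx (\row_i if (i < d)%N then 1 else pi).
exists (Dd *m G *m B); split=> [w|].
  rewrite !mulmxA => /Binj wG.
  have : w *m Dd = 0 by rewrite -[LHS]mulmx1 -GG' mulmxA wG mul0mx.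
  rewrite /Dd mul_mx_diag => /rowP w0; apply/rowP => i; have := w0 i; rewrite !mxE.
  by case: ifP => _; rewrite ?mulr1 // mulrC; exact: pi_reg.
have WE : (W :=: (pid_mx d : 'M[F]_n) *m row_ebase W)%MS.
  rewrite -{1}[W]mulmx_ebase -mulmxA; apply: eqmxMfull.
  by rewrite row_full_unit col_ebase_unit.
apply/seteqP; split=> x /= [w]; last first.
  move=> _ <-; exists (w *m Dd *m G); last by rewrite !mulmxA.
  rewrite /= /rowred map_mxM -/(rowred G) GE WE submxMr //.
  have -> : map_mx red (w *m Dd) = map_mx red w *m pid_mx d.
    apply/rowP => i; rewrite mul_mx_diag !mxE (bigD1 i) //= big1 => [|j ji]; last first.
      by rewrite !mxE (_ : (j == i :> nat) = false) ?mulr0 //; apply/negbTE.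
    rewrite !mxE eqxx addr0 rmorphM /=; case: ifP => _; first by rewrite rmorph1.
    have -> : red pi = 0 by apply/red_ker; exists 1; rewrite mulr1.
    by [].
  exact: submxMl.
rewrite /= WE => wW <-; pose v := w *m G'.
have vP : (rowred v <= (pid_mx d : 'M[F]_n))%MS.
  have -> : rowred v = rowred w *m invmx (row_ebase W).
    rewrite /v /rowred map_mxM; congr (_ *m _).
    have := congr1 (map_mx red) GG'; rewrite map_mxM map_mx1 -/(rowred G) GE => e.
    by rewrite -[LHS]mul1mx -(mulVmx (row_ebase_unit W)) -mulmxA e mulmx1.
  have := submxMr (invmx (row_ebase W)) wW.
  by rewrite mulmxK ?row_ebase_unit.
have v0 (i : 'I_n) : ~~ (i < d)%N -> red (v 0 i) = 0.
  move=> id; case/submxP: vP => u /rowP /(_ i); rewrite !mxE => ->.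
  by rewrite big1 // => j _; rewrite !mxE; case: eqP => [->|]; rewrite ?(negbTE id) mulr0.
have : forall i, exists a, v 0 i = a * (if (i < d)%N then 1 else pi).
  move=> i; case: ifP => id; first by exists (v 0 i); rewrite mulr1.
  by have /red_ker [y ->] := v0 i (negbT id); exists y; rewrite mulrC.
move=> /choice [f fP]; exists (\row_i f i) => //.
rewrite -mulmxA mulmxA; have -> : (\row_i f i) *m Dd = v.
  by apply/rowP => i; rewrite mul_mx_diag fP !mxE.
by rewrite mulmxA /v -!mulmxA (mulmxA G') G'G mul1mx.
Qed.

(* M is determined by (M : pi) and the subspace M / pi (M : pi). *)
Lemma lift_colon n (B : 'M[o]_n) M : is_submod M -> is_basis B (colon M) ->
  M = sublat B (spanF [set w | M (w *m B)]).
Proof.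
move=> MP [Binj MB].
have SP : is_submod [set w : 'rV_n | M (w *m B)].
  split=> /=; first by rewrite mul0mx; case: MP.
  move=> a x y Mx My; rewrite mulmxDl -scalemxAl.
  by apply: submod_add => //; exact: submod_scale.
apply/seteqP; split=> x /=.
  move=> Mx; have : colon M x by exact: sub_colon.
  rewrite {1}MB => -[w _ wx]; exists w => //=.
  by apply/in_spanF => //; exists w => //=; rewrite wx.
case=> w /= /in_spanF -/(_ SP) [v /= Mv vw] <-.
have [z zE] : exists z, w - v = pi *: z.
  by apply: rowred_ker; rewrite /rowred map_mxB -!/(rowred _) vw subrr.
rewrite -(subrK v w) mulmxDl; apply: submod_add => //; rewrite zE -scalemxAl.
have : colon M (z *m B) by rewrite MB; exists z.
by [].
Qed.

Lemma basis_ex n (N : set 'rV[o]_n) K : is_submod N -> (forall x, N (pi ^+ K *: x)) ->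
  exists B, is_basis B N.
Proof.
elim: K N => [|K IHK] N NP NK.
  exists 1%:M; split=> [w|]; first by rewrite mulmx1.
  apply/seteqP; split=> x _; first by exists x; rewrite ?mulmx1.
  by have := NK x; rewrite expr0 scale1r.
have [|B BP] := IHK (colon N) (colon_submod NP).
  by move=> x; rewrite /colon /= scalerA -exprS.
rewrite (lift_colon NP BP); exact: lift_basis BP.
Qed.
End Lattices.

End Lattices.
Import Lattices.

Module SubspaceCount.
Section SubspaceCount.
Variables (F : finFieldType) (n : nat).
Local Notation q := #|F|.

Lemma card_row_space (A : 'M[F]_n) :
  #|[set v : 'rV[F]_n | (v <= A)%MS]| = (q ^ \rank A)%N.
Proof. by rewrite -card_rowg; apply: eq_card => v; rewrite !inE. Qed.

Lemma card_independent (W U : 'M[F]_n) d : (U <= W)%MS ->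
  #|[set A : 'M[F]_(d, n) | (A <= W)%MS & \rank (U + A)%MS == (\rank U + d)%N]| =
  \prod_(i < d) (q ^ \rank W - q ^ (\rank U + i))%N.
Proof.
move=> UW; elim: d => [|d IHd].
  rewrite big_ord0 (_ : [set _ | _ & _] = [set: _]%SET) ?cardsT ?card_mx ?mul0n //.
  by apply/setP => A; rewrite !inE (flatmx0 A) sub0mx addsmx0 addn0 eqxx.
rewrite big_ord_recr /= -IHd.
pose P (A : 'M[F]_(d, n)) := (A <= W)%MS && (\rank (U + A)%MS == (\rank U + d)%N).
pose Q (A : 'M[F]_(d, n)) (v : 'rV[F]_n) := (v <= W)%MS && ~~ (v <= U + A)%MS.
have rk (A : 'M[F]_(d, n)) (v : 'rV[F]_n) :
  (col_mx v A <= W)%MS && (\rank (U + col_mx v A)%MS == (\rank U + d.+1)%N) = P A && Q A v.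
  rewrite /P /Q -addsmxE addsmx_sub.
  have -> : \rank (U + col_mx v A)%MS = \rank ((U + A) + v)%MS.
    rewrite -addsmxA (addsmxC A); apply: eqmx_rank; apply/eqmxP.
    by apply: adds_eqmx => //; apply: eqmx_sym; apply: addsmxE.
  case: (boolP (v <= W)%MS) => //= vW; last by rewrite andbF.
  case: (boolP (A <= W)%MS) => //= AW.
  case: (boolP (v <= U + A)%MS) => /= vUA; rewrite ?andbF ?andbT.
    rewrite (addsmx_idPl vUA); apply/negbTE; rewrite neq_ltn -addnS.
    have := mxrank_adds_leqif U A => [[le _]].
    by have := rank_leq_row A; lia.
  have := mxrank_adds_leqif (U + A)%MS v => [[le _]].
  have le1 := rank_leq_row v.
  have lt : (\rank (U + A)%MS < \rank (U + A + v)%MS)%N.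
    by apply: rank_ltmx; rewrite /ltmx addsmxSl /= addsmx_sub submx_refl.
  have := mxrank_adds_leqif U A => [[le2 _]].
  by have := rank_leq_row A; lia.
have -> : #|[set A : 'M[F]_(d.+1, n) | (A <= W)%MS & \rank (U + A)%MS == (\rank U + d.+1)%N]| =
    #|[set x : 'M[F]_(d, n) * 'rV[F]_n | P x.1 && Q x.1 x.2]|.
  rewrite -(@card_in_imset _ _ (fun x : 'M[F]_(d, n) * 'rV[F]_n => (col_mx x.2 x.1 : 'M[F]_(d.+1, n)))); last first.
    by move=> [A v] [B w] _ _ /= e; have [-> ->] := @eq_col_mx _ 1 d n _ _ _ _ e.
  apply: eq_card => A; rewrite !inE; apply/idP/imsetP.
    rewrite -(vsubmxK (A : 'M[F]_(1 + d, n))) rk => h.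
    by exists (dsubmx (A : 'M[F]_(1 + d, n)), usubmx (A : 'M[F]_(1 + d, n))); rewrite ?inE.
  by case=> -[B v]; rewrite inE /= => h ->; rewrite (rk B v).
rewrite -sum1_card (eq_bigl (fun x => P x.1 && Q x.1 x.2)) => [|x]; last by rewrite inE.
rewrite -(pair_big_dep P Q (fun _ _ => 1%N)) /= -[X in _ = (X * _)%N]sum1_card big_distrl /=.
apply: eq_big => [A|A /andP[AW /eqP rA]]; first by rewrite inE.
rewrite mul1n sum1_card -rA -!card_row_space.
have -> : #|[pred v | Q A v]| = #|[set v : 'rV[F]_n | (v <= W)%MS] :\: [set v : 'rV[F]_n | (v <= U + A)%MS]|.
  by apply: eq_card => v; rewrite !inE /Q andbC.
rewrite cardsD (_ : _ :&: _ = [set v : 'rV[F]_n | (v <= U + A)%MS]) //.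
apply/setP => v; rewrite !inE; apply: andb_idl => vUA.
by rewrite (submx_trans vUA) // addsmx_sub UW.
Qed.

(* Subspaces that contain J, meet U trivially and have dimension dim J + d. *)
Definition disjoint_subspaces (J U : 'M[F]_n) d : {set 'M[F]_n} :=
  [set W | [&& W == <<W>>%MS, (J <= W)%MS, (W :&: U)%MS == 0 & \rank W == (\rank J + d)%N]].

Lemma card_disjoint_subspaces (J U : 'M[F]_n) d : (J :&: U = 0)%MS ->
  (#|disjoint_subspaces J U d| * \prod_(i < d) (q ^ (\rank J + d) - q ^ (\rank J + i)) =
  \prod_(i < d) (q ^ n - q ^ (\rank J + \rank U + i)))%N.
Proof.
move=> JU0.
have rJU : \rank (J + U)%MS = (\rank J + \rank U)%N by rewrite -mxrank_sum_cap JU0 mxrank0 addn0.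
rewrite -rJU; have := card_independent d (submx1 (J + U)%MS); rewrite mxrank1 => <-.
pose f (A : 'M[F]_(d, n)) := (<<(J + A)%MS>>)%MS.
have rUA (A : 'M[F]_(d, n)) : \rank (J + U + A)%MS = \rank ((J + A) + U)%MS.
  by rewrite -addsmxA (addsmxC U A) addsmxA.
rewrite -[RHS]sum1_card (partition_big f (mem (disjoint_subspaces J U d))) /=.
  rewrite -[X in (X * _)%N = _]sum1_card big_distrl /=; apply: eq_bigr => W.
  rewrite inE => /and4P [/eqP WW JW /eqP WU /eqP rW].
  rewrite mul1n sum1_card -rW -(card_independent d JW).
  apply: eq_card => A; rewrite !inE [RHS]unfold_in !inE submx1 /=; apply/andP/andP.
    case=> AW /eqP rA; have JAW : (J + A == W)%MS.
      by rewrite -(mxrank_leqif_eq _) ?rA ?rW // addsmx_sub JW.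
    rewrite /f (eq_genmx (eqmxP JAW)) -WW; split=> //; rewrite rUA rJU.
    have := mxrank_sum_cap (J + A)%MS U.
    have -> : \rank ((J + A) :&: U)%MS = 0%N.
      by apply/eqP; rewrite mxrank_eq0 -submx0 -WU capmxS //; case/andP: JAW.
    by rewrite rA addn0 => ->; apply/eqP; lia.
  case=> /eqP rA /eqP fA; rewrite -fA genmxE addsmxSr; split=> //.
  have := mxrank_sum_cap (J + A)%MS U; rewrite -rUA rA rJU.
  have := mxrank_adds_leqif J A => [[le _]].
  by have := rank_leq_row A; lia.
move=> A; rewrite !inE submx1 /f => /eqP rA.
rewrite genmx_id eqxx genmxE addsmxSl /=.
have cap : \rank ((J + A) :&: U)%MS = \rank (<<(J + A)%MS>> :&: U)%MS.
  by apply: eqmx_rank; apply/eqmxP; apply: cap_eqmx => //; apply: eqmx_sym; apply: genmxE.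
have := mxrank_sum_cap (J + A)%MS U; rewrite -rUA rA rJU -mxrank_eq0 -cap mxrank_gen.
have := mxrank_adds_leqif J A => [[le _]].
by have := rank_leq_row A => *; apply/andP; split; apply/eqP; lia.
Qed.
End SubspaceCount.

End SubspaceCount.
Import SubspaceCount.

Module Fibres.
Local Open Scope classical_set_scope.

Section Fibres.
Variables (o : comNzRingType) (pi : o) (F : finFieldType) (red : {rmorphism o -> F}).
Hypothesis piP : uniformizer pi red.

Local Notation colon := (colon pi).
Local Notation rowred := (rowred red).
Local Notation spanF := (spanF red).
Local Notation corank := (corank red).
Local Notation sublat := (sublat red).
Local Notation q := #|F|.

Lemma pullback_submod n (M : set 'rV[o]_n) (B : 'M[o]_n) : is_submod M ->
  is_submod [set w : 'rV_n | M (w *m B)].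
Proof.
move=> MP; split=> /=; first by rewrite mul0mx; case: MP.
move=> a x y Mx My; rewrite mulmxDl -scalemxAl.
by apply: submod_add => //; exact: submod_scale.
Qed.

Definition latbasis n (N : set 'rV[o]_n) : 'M[o]_n := xget 0 [set B | is_basis B N].

Definition coordF n (N J : set 'rV[o]_n) : 'M[F]_n :=
  spanF [set w : 'rV_n | J (w *m latbasis N)].

(* The lattices M with (M : pi) = N that contain J. *)
Definition fibre n (N J : set 'rV[o]_n) : seq (set 'rV[o]_n) :=
  [seq sublat (latbasis N) W | W : 'M[F]_n <- enum
    [set W : 'M[F]_n | [&& W == <<W>>%MS, (coordF N J <= W)%MS &
      (W :&: kermx (rowred (latbasis N)))%MS == 0]]%SET].

Definition bounded n (N : set 'rV[o]_n) := exists K, forall x, N (pi ^+ K *: x).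

Section OneFibre.
Variables (n : nat) (N J : set 'rV[o]_n).
Hypotheses (NP : is_submod N) (NK : bounded N) (JP : is_submod J).
Hypothesis JN : colon J `<=` N.

Local Notation Bs := (latbasis N).
Local Notation Bred := (rowred (latbasis N)).

Lemma latbasisP : is_basis Bs N.
Proof.
case: NK => K /(basis_ex piP NP) [B BP].
by rewrite /latbasis; case: xgetP => [B' _ //|/(_ B)].
Qed.

Lemma base_coord x : N x -> exists w : 'rV_n, w *m Bs = x.
Proof. by have [_ {1}->] := latbasisP; case=> w _ <-; exists w. Qed.

Lemma base_in w : N (w *m Bs).
Proof. by have [_ {1}->] := latbasisP; exists w. Qed.

Lemma spanF_basis (M : set 'rV[o]_n) : is_submod M -> M `<=` N ->
  (spanF M :=: spanF [set w : 'rV_n | M (w *m Bs)] *m Bred)%MS.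
Proof.
move=> MP MN; have [Binj NB] := latbasisP; apply/eqmxP/andP; split.
  apply/row_subP => i; have : (row i (spanF M) <= spanF M)%MS by exact: row_sub.
  case/(in_spanF piP) => // v Mv <-; have [w wv] := base_coord (MN _ Mv).
  rewrite -wv /Lattices.rowred map_mxM submxMr //.
  by apply/(in_spanF piP); [exact: pullback_submod|exists w => //=; rewrite wv].
apply/row_subP => i; rewrite row_mul.
have : (row i (spanF [set w : 'rV_n | M (w *m Bs)]) <= spanF [set w : 'rV_n | M (w *m Bs)])%MS.
  exact: row_sub.
case/(in_spanF piP); first exact: pullback_submod.
move=> w /= Mw <-; apply/(in_spanF piP) => //; exists (w *m Bs) => //.
by rewrite /Lattices.rowred map_mxM.
Qed.

Lemma colon_basis (M : set 'rV[o]_n) : is_submod M -> M `<=` N ->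
  colon M `<=` N <-> (spanF [set w : 'rV_n | M (w *m Bs)] :&: kermx Bred)%MS = 0.
Proof.
move=> MP MN; have [Binj NB] := latbasisP; split=> [CM|W0 x /= Mx].
  apply/eqP; rewrite -submx0; apply/row_subP => i.
  have := row_sub i (spanF [set w : 'rV_n | M (w *m Bs)] :&: kermx Bred)%MS.
  rewrite sub_capmx => /andP[/(in_spanF piP) -/(_ (pullback_submod Bs MP))].
  case=> w /= Mw <- /sub_kermxP; rewrite -map_mxM => /(rowred_ker piP) [y yE].
  have : colon M y by rewrite /Lattices.colon /= -yE.
  move/CM => /base_coord [w' w'y].
  have /(f_equal (fun v => v - pi *: (w' *m Bs))) : w *m Bs = pi *: (w' *m Bs).
    by rewrite w'y.
  rewrite subrr scalemxAl -mulmxBl => /Binj /subr0_eq ->.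
  by rewrite (rowredZ piP) sub0mx.
have [w wx] := base_coord (MN _ Mx).
have : (rowred w <= spanF [set w : 'rV_n | M (w *m Bs)] :&: kermx Bred)%MS.
  rewrite sub_capmx; apply/andP; split.
    by apply/(in_spanF piP); [exact: pullback_submod|exists w => //=; rewrite wx].
  by apply/sub_kermxP; rewrite -map_mxM wx; exact: (rowredZ piP).
rewrite W0 submx0 => /eqP /(rowred_ker piP) [y yE].
suff -> : x = y *m Bs by exact: base_in.
by apply: (row_inj piP); rewrite -wx yE scalemxAl.
Qed.

Lemma sub_fibre_base : J `<=` N.
Proof. by move=> x Jx; apply: JN; exact: sub_colon. Qed.

Lemma coord_lift (W : 'M[F]_n) : (spanF [set w : 'rV_n | sublat Bs W (w *m Bs)] :=: W)%MS.
Proof.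
have [Binj NB] := latbasisP; apply/eqmxP/andP; split; apply/row_subP => i.
  have := row_sub i (spanF [set w : 'rV_n | sublat Bs W (w *m Bs)]).
  case/(in_spanF piP); first by apply: pullback_submod; exact: lift_submod.
  move=> w /= [w' /= w'W ww'] <-; suff <- : w' = w by [].
  by apply/subr0_eq/Binj; rewrite mulmxBl ww' subrr.
apply/(in_spanF piP); first by apply: pullback_submod; exact: lift_submod.
exists (rowlft piP (row i W)); last exact: rowlftK.
by exists (rowlft piP (row i W)) => //=; rewrite rowlftK row_sub.
Qed.

Lemma lift_sub_base (W : 'M[F]_n) : sublat Bs W `<=` N.
Proof. by move=> _ [w _ <-]; exact: base_in. Qed.

Lemma scale_sub_lift (W : 'M[F]_n) : N `<=` colon (sublat Bs W).
Proof.
move=> x /base_coord [w <-].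
by rewrite /Lattices.colon /= scalemxAl; exists (pi *: w) => //=; rewrite (rowredZ piP) sub0mx.
Qed.

Lemma mem_fibre M : M \in fibre N J <-> [/\ is_submod M, colon M = N & J `<=` M].
Proof.
have [Binj NB] := latbasisP; split.
  move=> /mapP [W]; rewrite mem_enum inE => /and3P [_ JW /eqP Wk] ->.
  split; first exact: lift_submod.
    apply/seteqP; split; last exact: scale_sub_lift.
    apply/colon_basis; [exact: lift_submod|exact: lift_sub_base|].
    apply/eqP; rewrite -submx0 -Wk; apply: capmxS => //.
    by rewrite (coord_lift W).
  move=> x Jx; have [w wx] := base_coord (sub_fibre_base Jx).
  exists w => //=; apply: submx_trans JW.
  by apply/(in_spanF piP); [exact: pullback_submod|exists w => //=; rewrite wx].
move=> [MP MN JM]; have MB : is_basis Bs (colon M) by rewrite MN; exact: latbasisP.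
have ME := lift_colon piP MP MB.
apply/mapP; exists (<<spanF [set w : 'rV_n | M (w *m Bs)]>>)%MS; last first.
  rewrite {1}ME /Lattices.sublat; congr (_ @` _); apply/seteqP; split=> w /=; by rewrite genmxE.
have MsubN : M `<=` N by rewrite -MN; exact: sub_colon.
rewrite mem_enum inE genmx_id eqxx genmxE /=; apply/andP; split.
  apply/row_subP => i; have := row_sub i (coordF N J).
  case/(in_spanF piP); first exact: pullback_submod.
  move=> w /= Jw <-; apply/(in_spanF piP); first exact: pullback_submod.
  by exists w => //=; exact: JM.
have /colon_basis W0 : colon M `<=` N by rewrite MN.
by apply/eqP/eqP; rewrite -submx0 -(W0 MP MsubN); apply: capmxS; rewrite ?genmxE.
Qed.

Lemma fibre_uniq : uniq (fibre N J).
Proof.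
rewrite map_inj_in_uniq ?enum_uniq // => W W'; rewrite !mem_enum !inE.
case/and3P=> /eqP -> _ _ /and3P [/eqP -> _ _] WW'.
apply: eq_genmx; apply: eqmx_trans (coord_lift W').
apply: eqmx_trans (eqmx_sym (coord_lift W)) _.
have -> : sublat Bs W = sublat Bs W'; last by [].
move: WW'; rewrite /Lattices.sublat => WW'; apply/seteqP; split=> x.
  case=> w /= wW <-.
  have : [set w *m Bs | w in [set w | (rowred w <= <<W>>)%MS]] (w *m Bs).
    by exists w => //=; rewrite genmxE.
  by rewrite WW' => -[w' /=]; rewrite genmxE => w'W <-; exists w'.
case=> w /= wW <-.
have : [set w *m Bs | w in [set w | (rowred w <= <<W'>>)%MS]] (w *m Bs).
  by exists w => //=; rewrite genmxE.
by rewrite -WW' => -[w' /=]; rewrite genmxE => w'W <-; exists w'.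
Qed.

Lemma rank_Bred : \rank (kermx Bred) = corank N.
Proof.
rewrite mxrank_ker /Lattices.corank; congr (_ - _)%N; symmetry.
have [_ NB] := latbasisP.
apply: eqmx_rank; apply/eqmxP; apply: eqmx_trans (spanF_basis NP (@subset_refl _ N)) _.
rewrite -{2}[Bred]mul1mx; apply: eqmxMr; apply/eqmxP; rewrite submx1 /=.
apply/row_subP => i; apply/(in_spanF piP); first exact: pullback_submod.
exists (rowlft piP (row i 1%:M)); last exact: rowlftK.
exact: base_in.
Qed.

Lemma rank_coordF : \rank (coordF N J) = \rank (spanF J).
Proof.
rewrite (spanF_basis JP sub_fibre_base).
have := mxrank_mul_ker (coordF N J) Bred.
have /colon_basis -/(_ JP sub_fibre_base) := JN.
by rewrite -/(coordF N J) => ->; rewrite mxrank0 addn0.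
Qed.

Lemma corank_lift (W : 'M[F]_n) : (W :&: kermx Bred)%MS = 0 ->
  corank (sublat Bs W) = (n - \rank W)%N.
Proof.
move=> W0; rewrite /Lattices.corank; congr (_ - _)%N.
have LP := @lift_submod _ _ red _ Bs W; have LN := @lift_sub_base W.
rewrite (spanF_basis LP LN) (eqmxMr _ (coord_lift W)).
by have := mxrank_mul_ker W Bred; rewrite W0 mxrank0 addn0.
Qed.

Lemma count_fibre r : (r <= corank J)%N ->
  (count (fun M => corank M == r) (fibre N J) *
     \prod_(i < corank J - r) (q ^ (corank J - r) - q ^ i) =
   \prod_(i < corank J - r) (q ^ corank J - q ^ (corank N + i)))%N.
Proof.
move=> rJ; set d := (corank J - r)%N.
have /colon_basis -/(_ JP sub_fibre_base) := JN; rewrite -/(coordF N J) => J0.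
have := card_disjoint_subspaces d J0.
rewrite rank_Bred rank_coordF.
have Jn : (\rank (spanF J) <= n)%N := rank_leq_col _.
have nE : n = (\rank (spanF J) + corank J)%N by rewrite /Lattices.corank; lia.
have -> : #|disjoint_subspaces (coordF N J) (kermx Bred) d| =
    count (fun M => corank M == r) (fibre N J).
  rewrite /fibre count_map cardE -size_filter; apply: perm_size.
  apply: uniq_perm => [||W]; [exact: enum_uniq|by apply: filter_uniq; exact: enum_uniq|].
  rewrite mem_enum mem_filter mem_enum !inE /= [RHS]andbC -!andbA.
  do 2 (congr (_ && _)); case: eqP => W0 //=.
  rewrite (corank_lift W0) rank_coordF.
  by have := rank_leq_row W; move: nE rJ; rewrite /d; lia.
have E (a b m : nat) : (q ^ (m + a) - q ^ (m + b) = q ^ m * (q ^ a - q ^ b))%N.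
  by rewrite mulnBr !expnD.
set R := \rank (spanF J) in Jn nE *.
have -> : (\prod_(i < d) (q ^ n - q ^ (R + corank N + i)) =
    \prod_(i < d) (q ^ R * (q ^ corank J - q ^ (corank N + i))))%N.
  by apply: eq_bigr => i _; rewrite -addnA -E -nE.
under [X in (_ * X)%N = _]eq_bigr do rewrite E.
rewrite !big_split /= mulnCA => /eqP; rewrite eqn_pmul2l; first by move/eqP.
by rewrite prod_nat_const expn_gt0 expn_gt0; apply/orP; left; apply/orP; left; apply/card_gt0P; exists 0.
Qed.
End OneFibre.
End Fibres.

End Fibres.
Import Fibres.

Module Tensors.
Local Open Scope classical_set_scope.

Section Cross.
Variable R : comNzRingType.
Implicit Types (x y : 'rV[R]_3) (X Y : 'M[R]_3).

Definition axial X : 'rV[R]_3 := \row_i (X (i + 2%:R) (i + 1) - X (i + 1) (i + 2%:R)).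
Definition cross x y : 'rV[R]_3 := axial (y^T *m x).

Lemma crossE x y i : cross x y 0 i = x 0 (i + 1) * y 0 (i + 2%:R) - x 0 (i + 2%:R) * y 0 (i + 1).
Proof. by rewrite !mxE !big_ord1 !mxE; congr (_ - _); rewrite mulrC. Qed.

Lemma axialD X Y : axial (X + Y) = axial X + axial Y.
Proof. by apply/rowP => i; rewrite !mxE opprD addrACA. Qed.

Lemma axialZ a X : axial (a *: X) = a *: axial X.
Proof. by apply/rowP => i; rewrite !mxE mulrBr. Qed.

Lemma axial_sum X : axial X = \sum_j cross (row j X) (delta_mx 0 j).
Proof.
have -> : \sum_j cross (row j X) (delta_mx 0 j) = axial (\sum_j (delta_mx 0 j)^T *m row j X).
  rewrite (big_morph axial axialD (id1 := 0)) //.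
  by apply/rowP => i; rewrite !mxE subrr.
congr axial; apply/matrixP => i j; rewrite summxE (bigD1 i) //= big1 => [|k ki].
  by rewrite !mxE big_ord1 !mxE !eqxx mul1r addr0.
by rewrite !mxE big_ord1 !mxE (eq_sym i) (negbTE ki) andbF mul0r.
Qed.

Lemma axial_surj x : exists X, axial X = x.
Proof.
exists (\matrix_(i, j) (if j + 1 == i then x 0 (j + 2%:R) else 0)).
apply/rowP => i; rewrite !mxE.
have -> : (i + 1 + 1 == i + 2%:R) by rewrite -addrA.
have -> : (i + 2%:R + 1 == i + 1) = false by case: i => -[|[|[|]]].
rewrite subr0; congr (x 0 _); rewrite -addrA -[RHS]addr0; congr (_ + _); exact: val_inj.
Qed.
End Cross.

Lemma axial_map (R S : comNzRingType) (f : {rmorphism R -> S}) (X : 'M[R]_3) :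
  map_mx f (axial X) = axial (map_mx f X).
Proof. by apply/rowP => i; rewrite !mxE rmorphB. Qed.

Lemma cross_map (R S : comNzRingType) (f : {rmorphism R -> S}) (x y : 'rV[R]_3) :
  map_mx f (cross x y) = cross (map_mx f x) (map_mx f y).
Proof. by rewrite axial_map map_mxM -map_trmx. Qed.

Lemma cross_collinear (F : fieldType) (u v : 'rV[F]_3) : v != 0 -> cross u v = 0 ->
  exists a, u = a *: v.
Proof.
move=> v0 /rowP uv.
have sym i j : u 0 i * v 0 j = u 0 j * v 0 i.
  have step k : u 0 (k + 1) * v 0 (k + 2%:R) = u 0 (k + 2%:R) * v 0 (k + 1).
    by apply/eqP; rewrite -subr_eq0 -crossE uv mxE.
  have [->//|ij] := eqVneq i j.
  have [k [[-> ->]|[-> ->]]] : exists k : 'I_3,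
     (i = k + 1 /\ j = k + 2%:R) \/ (j = k + 1 /\ i = k + 2%:R); last 2 first.
  - exact: step.
  - exact/esym/step.
  exists (- (i + j)); move: ij; case: i => -[|[|[|]]] // ?; case: j => -[|[|[|]]] // ? _;
    try (by left; split; apply: val_inj); by right; split; apply: val_inj.
have [i vi] : exists i, v 0 i != 0.
  apply/existsP; rewrite -negb_forall; apply: contra v0 => /forallP v0.
  by apply/eqP/rowP => i; rewrite mxE; apply/eqP.
exists (u 0 i / v 0 i); apply/rowP => j; rewrite !mxE.
by rewrite mulrAC sym mulfK.
Qed.

Section Ranks.
Variable F : finFieldType.

(* Membership in S describes the image of V x F^3 under the bracket. *)
Lemma rank_axial (V S : 'M[F]_3) :
  (forall w : 'rV_3, (w <= S)%MS <-> exists X : 'M[F]_3, (X <= V)%MS /\ axial X = w) ->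
  \rank S = nth 0%N [:: 0; 2; 3; 3]%N (\rank V).
Proof.
move=> SP; have kerP (u : 'rV_3) : (u <= kermx S^T)%MS <->
    forall v : 'rV_3, (v <= V)%MS -> cross u v = 0.
  have dot (v y : 'rV_3) : cross v y *m u^T = y *m (cross u v)^T.
    apply/matrixP => i j; rewrite !ord1 !mxE !big_ord_recl !big_ord0 !mxE !big_ord1 !mxE /=.
    have -> : lift ord0 ord0 = 1 :> 'I_3 by exact: val_inj.
    have -> : lift ord0 (lift ord0 ord0) = 2%:R :> 'I_3 by exact: val_inj.
    have -> : ord0 = 0 :> 'I_3 by exact: val_inj.
    have -> : 1 + 1 = 2%:R :> 'I_3 by exact: val_inj.
    have -> : 1 + 2%:R = 0 :> 'I_3 by exact: val_inj.
    have -> : 2%:R + 1 = 0 :> 'I_3 by exact: val_inj.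
    have -> : 2%:R + 2%:R = 1 :> 'I_3 by exact: val_inj.
    have -> : ord0 = 0 :> 'I_1 by exact: val_inj.
    by rewrite !add0r; ring.
  split=> [/sub_kermxP uS v vV|uV].
    apply: trmx_inj; rewrite trmx0; apply/colP => i.
    have : (cross v (delta_mx 0 i) <= S)%MS.
      by apply/SP; exists ((delta_mx 0 i)^T *m v); rewrite (submx_trans (submxMl _ _)).
    case/submxP => D DE; have := dot v (delta_mx 0 i).
    rewrite DE -mulmxA -[S]trmxK -trmx_mul uS trmx0 mulmx0 -rowE.
    by move=> /esym /matrixP /(_ 0 0); rewrite !mxE.
  apply/sub_kermxP; apply: trmx_inj; rewrite trmx_mul trmxK trmx0.
  apply/row_matrixP => i; rewrite row_mul row0.
  have /SP [X [XV <-]] : (row i S <= S)%MS by exact: row_sub.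
  rewrite axial_sum mulmx_suml big1 // => j _.
  by rewrite dot uV ?trmx0 ?mulmx0 // (submx_trans _ XV) ?row_sub.
have rS : (\rank S = 3 - \rank (kermx S^T))%N.
  by rewrite mxrank_ker mxrank_tr; have := rank_leq_row S; lia.
rewrite rS; have [V0|V0] := eqVneq V 0.
  rewrite V0 mxrank0 /=; suff -> : \rank (kermx S^T) = 3%N by [].
  apply/eqP; rewrite -[_ == _]/(row_full _) -sub1mx; apply/row_subP => i.
  apply/kerP => v; rewrite V0 submx0 => /eqP ->.
  by apply/rowP => j; rewrite crossE !mxE !mulr0 subrr.
have [v vV v0] : exists2 v : 'rV[F]_3, (v <= V)%MS & v != 0.
  by exists (nz_row V); rewrite ?nz_row_sub ?nz_row_eq0.
have kv (u : 'rV_3) : (u <= kermx S^T)%MS -> (u <= v)%MS.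
  by move/kerP/(_ v vV)/(cross_collinear v0) => [a ->]; rewrite scalemx_sub.
have rv : \rank v = 1%N by rewrite rank_rV v0.
have kle : (kermx S^T <= v)%MS by apply/row_subP => i; apply: kv; exact: row_sub.
have [Vv|] := boolP (V <= v)%MS.
  have -> : \rank V = 1%N by have := mxrankS Vv; have := mxrankS vV; rewrite rv; lia.
  suff -> : \rank (kermx S^T) = 1%N by [].
  suff /mxrankS : (v <= kermx S^T)%MS by have := mxrankS kle; rewrite rv; lia.
  apply/kerP => w /submx_trans /(_ Vv).
  by case/sub_rVP => a ->; apply/rowP => j; rewrite crossE !mxE; ring.
case/row_subPn => i iv.
have -> : \rank (kermx S^T) = 0%N.
  apply/eqP; rewrite mxrank_eq0 -submx0; apply/row_subP => k.
  have ku := row_sub k (kermx S^T); have := kv _ ku; case/sub_rVP => a aE.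
  have /kerP/(_ _ (row_sub i V)) := ku; rewrite aE.
  have [->|a0] := eqVneq a 0; first by rewrite scale0r sub0mx.
  have -> : cross (a *: v) (row i V) = - a *: cross (row i V) v.
    by apply/rowP => j; rewrite crossE [RHS]mxE crossE !mxE; ring.
  move/eqP; rewrite scaler_eq0 oppr_eq0 (negbTE a0) /=.
  move/eqP/(cross_collinear v0) => [b bE].
  by move: iv; rewrite bE scalemx_sub.
have : (1 < \rank V)%N.
  suff : (\rank v < \rank V)%N by rewrite rv.
  apply: rank_ltmx; rewrite /ltmx vV; apply: contra iv => Vv.
  by rewrite (submx_trans (row_sub _ _)).
by have := rank_leq_row V; case: (\rank V) => [|[|[|[|]]]].
Qed.

(* Membership in S describes V (x) F^3 together with the scalar matrices. *)
Lemma rank_tensor (V : 'M[F]_3) (S : 'M[F]_(3 * 3)) :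
  (forall w : 'rV_(3 * 3), (w <= S)%MS <->
    exists X : 'M[F]_3, (X <= V)%MS /\ exists c, mxvec (X + c%:M) = w) ->
  \rank S = nth 0%N [:: 1; 4; 7; 9]%N (\rank V).
Proof.
move=> SP; have [d3|dn3] := eqVneq (\rank V) 3%N.
  rewrite d3; apply/eqP; rewrite -[_ == _]/(row_full _) -sub1mx; apply/row_subP => i.
  apply/SP; exists (vec_mx (row i 1%:M)); split; last by exists 0; rewrite raddf0 addr0 vec_mxK.
  by rewrite (submx_trans (submx1 _)) // sub1mx /row_full d3.
suff : (#|F| ^ \rank S = #|F| ^ (3 * \rank V + 1))%N.
  move/eqP; rewrite eqn_exp2l ?finNzRing_gt1 // => /eqP ->.
  by move: dn3; have := rank_leq_row V; case: (\rank V) => [|[|[|[|]]]].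
rewrite -card_row_space.
pose f (x : 'M[F]_(3, \rank V) * F) : 'rV[F]_(3 * 3) := mxvec (x.1 *m row_base V + x.2%:M).
have fsub (Y : 'M[F]_(3, \rank V)) : (Y *m row_base V <= V)%MS.
  by rewrite (submx_trans (submxMl _ _)) ?eq_row_base.
have f_inj : injective f.
  move=> [X c] [Y d] /(can_inj mxvecK) /= XY.
  have cd : c = d.
    apply/eqP; rewrite -subr_eq0; apply: contraR dn3 => cd.
    have E : (c - d)%:M = (Y - X) *m row_base V.
      rewrite mulmxBl raddfB /=; apply/eqP.
      by rewrite subr_eq eq_sym addrAC subr_eq -XY addrC.
    have : ((c - d)%:M <= V)%MS by rewrite E fsub.
    move/mxrankS; rewrite -scalemx1 mxrank_scale_nz // mxrank1.
    by have := rank_leq_row V; lia.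
  move: XY; rewrite cd => /addIr; move/(row_free_inj (row_base_free V)) => -> //.
have -> : [set v : 'rV[F]_(3 * 3) | (v <= S)%MS]%SET = (f @: [set: 'M[F]_(3, \rank V) * F])%SET.
  apply/setP => w; rewrite inE; apply/idP/imsetP => [/SP [X [XV [c <-]]]|[[Y c] _ ->]].
    move: XV; rewrite -(eq_row_base V) => /submxP [Y ->].
    by exists (Y, c); rewrite ?inE.
  by apply/SP; exists (Y *m row_base V); split=> //; exists c.
by rewrite card_imset // cardsT card_prod card_mx expnD mulnC.
Qed.
End Ranks.

End Tensors.
Import Tensors.

Module Brackets.
Local Open Scope classical_set_scope.

Section Brackets.
Variables (o : comNzRingType) (pi : o) (F : finFieldType) (red : {rmorphism o -> F}).
Hypothesis piP : uniformizer pi red.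

Local Notation colon := (colon pi).
Local Notation rowred := (rowred red).
Local Notation spanF := (spanF red).
Local Notation corank := (corank red).
Local Notation bounded := (bounded pi).

Lemma nakayama n (M : set 'rV[o]_n) : is_submod M -> bounded M ->
  \rank (spanF M) = n -> M = setT.
Proof.
move=> MP [K MK] Mn; apply/seteqP; split=> // x _.
suff [m Mm [y ->]] : exists2 m, M m & exists y, x = m + pi ^+ K *: y.
  exact: submod_add.
elim: {MK}K x => [|k IHk] x.
  by exists 0; [case: MP|exists x; rewrite add0r expr0 scale1r].
have [m Mm [y ->]] := IHk x.
have : (rowred y <= spanF M)%MS by rewrite submx_full // /row_full Mn.
case/(in_spanF piP) => // m' Mm' m'y.
have [z zE] : exists z, y - m' = pi *: z.
  by apply: (rowred_ker piP); rewrite /Lattices.rowred map_mxB -!/(rowred _) m'y subrr.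
exists (m + pi ^+ k *: m'); first by apply: submod_add => //; exact: submod_scale.
by exists z; rewrite -addrA -(subrK m' y) zE scalerDr scalerA -exprSr [_ + pi ^+ k *: m']addrC.
Qed.

Definition rowsin (M : set 'rV[o]_3) (X : 'M[o]_3) := forall i, M (row i X).

(* [M, L_1] for M in L_2 = o^3, the module of axial vectors of matrices with rows in M. *)
Definition br12 (M : set 'rV[o]_3) : set 'rV[o]_3 := @axial o @` rowsin M.

Definition br23 (M : set 'rV[o]_3) : set 'rV[o]_(3 * 3) :=
  [set mxvec (X.1 + X.2%:M) | X in [set X : 'M[o]_3 * o | rowsin M X.1]].

Lemma rowsinL M a X Y : is_submod M -> rowsin M X -> rowsin M Y -> rowsin M (a *: X + Y).
Proof.
move=> MP MX MY i; rewrite linearP.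
by case: MP => _; apply; [exact: MX|exact: MY].
Qed.

Lemma rowsin0 M : is_submod M -> rowsin M 0.
Proof. by case=> M0 _ i; rewrite row0. Qed.

Lemma br12_submod M : is_submod M -> is_submod (br12 M).
Proof.
move=> MP; split.
  by exists 0; [exact: rowsin0|apply/rowP => i; rewrite !mxE subrr].
move=> a _ _ [X XM <-] [Y YM <-]; exists (a *: X + Y); first exact: rowsinL.
by rewrite axialD axialZ.
Qed.

Lemma br23_submod M : is_submod M -> is_submod (br23 M).
Proof.
move=> MP; split.
  by exists (0, 0) => /=; [exact: rowsin0|rewrite raddf0 addr0 linear0].
move=> a _ _ [[X c] /= XM <-] [[Y d] /= YM <-].
exists (a *: X + Y, a * c + d) => /=; first exact: rowsinL.
rewrite -linearP /=; congr mxvec; rewrite raddfD /= scalerDr addrACA; congr (_ + _).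
by rewrite -scale_scalar_mx.
Qed.

Lemma cross_br12 (M : set 'rV[o]_3) x y : is_submod M -> M x -> br12 M (cross x y).
Proof.
move=> MP Mx; exists (y^T *m x) => // i.
suff -> : row i (y^T *m x) = y 0 i *: x by exact: submod_scale.
by apply/rowP => j; rewrite !mxE big_ord1 !mxE.
Qed.

Lemma br12_sub (M N : set 'rV[o]_3) : is_submod M -> is_submod N ->
  br12 M `<=` N <-> forall x y, M x -> N (cross x y).
Proof.
move=> MP NP; split=> [MN x y Mx|MN _ [X XM <-]]; first by apply: MN; exact: cross_br12.
by rewrite axial_sum; apply: submod_bigsum => // i; apply: MN.
Qed.

Lemma br23_sub (M : set 'rV[o]_3) (N : set 'rV[o]_(3 * 3)) : is_submod M -> is_submod N ->
  br23 M `<=` N <-> N (mxvec 1%:M) /\ forall x y, M x -> N (mxvec (y^T *m x)).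
Proof.
move=> MP NP; split=> [MN|[N1 MN] _ [[X c] /= XM <-]].
  split; first by apply: MN; exists (0, 1) => /=; [exact: rowsin0|rewrite add0r].
  move=> x y Mx; apply: MN; exists (y^T *m x, 0) => /=; last by rewrite raddf0 addr0.
  move=> i; suff -> : row i (y^T *m x) = y 0 i *: x by exact: submod_scale.
  by apply/rowP => j; rewrite !mxE big_ord1 !mxE.
rewrite linearD /=; apply: submod_add => //; last first.
  by rewrite -scalemx1 linearZ /=; exact: submod_scale.
have -> : X = \sum_i (delta_mx 0 i)^T *m row i X.
  apply/matrixP => i j; rewrite summxE (bigD1 i) //= big1 => [|k ki].
    by rewrite !mxE big_ord1 !mxE !eqxx mul1r addr0.
  by rewrite !mxE big_ord1 !mxE (eq_sym i) (negbTE ki) andbF mul0r.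
by rewrite linear_sum /=; apply: submod_bigsum => // i; apply: MN.
Qed.

Lemma rowsin_spanF M X : rowsin M X -> is_submod M -> (rowred X <= spanF M)%MS.
Proof.
move=> XM MP; apply/row_subP => i; apply/(in_spanF piP) => //.
by exists (row i X) => //; rewrite /Lattices.rowred map_row.
Qed.

Lemma rowsin_lift M (Y : 'M[F]_3) : is_submod M -> (Y <= spanF M)%MS ->
  exists2 X, rowsin M X & rowred X = Y.
Proof.
move=> MP YM; have : forall i, exists x, M x /\ rowred x = row i Y.
  move=> i; have : (row i Y <= spanF M)%MS by rewrite (submx_trans (row_sub _ _)).
  by case/(in_spanF piP) => // x; exists x.
move=> /choice [f fP]; exists (\matrix_i f i).
  by move=> i; rewrite rowK; case: (fP i).
by apply/row_matrixP => i; rewrite /Lattices.rowred -map_row rowK; case: (fP i).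
Qed.

Lemma spanF_br12 M (w : 'rV_3) : is_submod M ->
  (w <= spanF (br12 M))%MS <-> exists X : 'M[F]_3, (X <= spanF M)%MS /\ axial X = w.
Proof.
move=> MP; split.
  case/(in_spanF piP); first exact: br12_submod.
  move=> _ [X XM <-] <-; exists (rowred X); split; first exact: rowsin_spanF.
  by rewrite -axial_map.
case=> Y [YM <-]; have [X XM <-] := rowsin_lift MP YM.
apply/(in_spanF piP); first exact: br12_submod.
by exists (axial X); [exists X|rewrite -axial_map].
Qed.

Lemma spanF_br23 M (w : 'rV_(3 * 3)) : is_submod M ->
  (w <= spanF (br23 M))%MS <->
  exists X : 'M[F]_3, (X <= spanF M)%MS /\ exists c, mxvec (X + c%:M) = w.
Proof.
have redE (X : 'M[o]_3) c : rowred (mxvec (X + c%:M)) = mxvec (rowred X + (red c)%:M).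
  by rewrite /Lattices.rowred map_mxvec map_mxD map_scalar_mx.
move=> MP; split.
  case/(in_spanF piP); first exact: br23_submod.
  move=> _ [[X c] /= XM <-] <-; exists (rowred X); split; first exact: rowsin_spanF.
  by exists (red c); rewrite redE.
case=> Y [YM [c <-]]; have [X XM <-] := rowsin_lift MP YM.
have [a <-] := red_surj piP c.
apply/(in_spanF piP); first exact: br23_submod.
by exists (mxvec (X + a%:M)); [exists (X, a)|rewrite redE].
Qed.

Lemma corank_br12 M : is_submod M -> corank (br12 M) = nth 0%N [:: 0; 0; 1; 3]%N (corank M).
Proof.
move=> MP; rewrite /Lattices.corank (rank_axial (fun w => spanF_br12 w MP)).
by move: (rank_leq_row (spanF M)); case: (\rank (spanF M)) => [|[|[|[|r]]]].
Qed.

Lemma corank_br23 M : is_submod M -> corank (br23 M) = nth 0%N [:: 0; 2; 5; 8]%N (corank M).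
Proof.
move=> MP; rewrite /Lattices.corank (rank_tensor (fun w => spanF_br23 w MP)).
by move: (rank_leq_row (spanF M)); case: (\rank (spanF M)) => [|[|[|[|r]]]].
Qed.

Lemma rowsin_pi (M : set 'rV[o]_3) X : rowsin M (pi *: X) -> rowsin (colon M) X.
Proof. by move=> MX i; have := MX i; rewrite linearZ. Qed.

Lemma br12_mono (M N : set 'rV[o]_3) : M `<=` N -> br12 M `<=` br12 N.
Proof. by move=> MN _ [X XM <-]; exists X => // i; exact: MN. Qed.

Lemma br12_bounded M : bounded M -> bounded (br12 M).
Proof.
case=> K MK; exists K => x; have [X <-] := axial_surj x.
by exists (pi ^+ K *: X); [move=> i; rewrite linearZ; exact: MK|rewrite axialZ].
Qed.

Lemma br23_bounded M : bounded M -> bounded (br23 M).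
Proof.
case=> K MK; exists K => x; exists (pi ^+ K *: vec_mx x, 0) => /=.
  by move=> i; rewrite linearZ; exact: MK.
by rewrite raddf0 addr0 linearZ /= vec_mxK.
Qed.

Lemma bounded_sub n (M N : set 'rV[o]_n) : M `<=` N -> bounded M -> bounded N.
Proof. by move=> MN [K MK]; exists K => x; exact: MN. Qed.

Lemma colon_br12 M : is_submod M -> bounded M -> colon (br12 M) `<=` br12 (colon M).
Proof.
move=> MP MK z /= [X XM Xz].
have [V2|] := leqP 2 (\rank (spanF M)).
  apply: (br12_mono (sub_colon pi MP)).
  rewrite (nakayama (br12_submod MP) (br12_bounded MK)) //.
  rewrite (rank_axial (fun w => spanF_br12 w MP)).
  by move: V2; have := rank_leq_row (spanF M); case: (\rank _) => [|[|[|[|]]]].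
case rE : (\rank (spanF M)) => [|[|]] // _.
  have /eqP := rE; rewrite mxrank_eq0 => /eqP V0.
  have := rowsin_spanF XM MP; rewrite V0 submx0 => /eqP /(rowred_ker piP) [Y YE].
  exists Y; first by apply: rowsin_pi; rewrite -YE.
  by apply: (row_inj piP); rewrite -axialZ -YE.
have [v vV v0] : exists2 v : 'rV[F]_3, (v <= spanF M)%MS & v != 0.
  exists (nz_row (spanF M)); rewrite ?nz_row_sub // nz_row_eq0.
  by rewrite -mxrank_eq0 rE.
have [w Mw wv] := (in_spanF piP v MP).1 vV.
have Vv : (spanF M <= v)%MS.
  by rewrite -(mxrank_leqif_sup vV) rE rank_rV v0.
have := submx_trans (rowsin_spanF XM MP) Vv; case/submxP => D XD.
have [c cE] : exists c : 'cV[o]_3, rowred c = D.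
  by exists (rowlft piP D); rewrite rowlftK.
have [Y YE] : exists Y, X - c *m w = pi *: Y.
  apply: (rowred_ker piP); rewrite /Lattices.rowred map_mxB map_mxM -!/(rowred _) XD wv.
  by rewrite cE subrr.
have YM : rowsin (colon M) Y.
  apply: rowsin_pi; rewrite -YE addrC -scaleN1r => i; apply: rowsinL => // {}i.
  suff -> : row i (c *m w) = c i 0 *: w by exact: submod_scale.
  by apply/rowP => j; rewrite !mxE big_ord1.
have XE : axial X = cross w c^T + pi *: axial Y.
  by rewrite -axialZ -YE /cross trmxK -axialD addrCA subrr addr0.
have : cross v (rowred c^T) = 0.
  rewrite -wv -cross_map; have -> : cross w c^T = pi *: (z - axial Y).
    by rewrite scalerBr -Xz XE addrK.
  exact: rowredZ.
have cross_sym (x y : 'rV[F]_3) : cross x y = - cross y x.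
  by apply/rowP => i; rewrite [RHS]mxE !crossE; ring.
rewrite cross_sym => /eqP; rewrite oppr_eq0 => /eqP /(cross_collinear v0) [a aE].
have [b bE] := red_surj piP a.
have [d dE] : exists d, c^T - b *: w = pi *: d.
  apply: (rowred_ker piP); rewrite /Lattices.rowred map_mxB map_mxZ -!/(rowred _) aE wv.
  by rewrite /= bE subrr.
have zE : z = cross w d + axial Y.
  apply: (row_inj piP); rewrite -Xz XE scalerDr; congr (_ + _).
  rewrite -(subrK (b *: w) c^T) dE; apply/rowP => i; rewrite [RHS]mxE !crossE !mxE; ring.
rewrite zE; apply: submod_add.
- by apply: br12_submod; exact: colon_submod.
- by apply: cross_br12; [exact: colon_submod|exact: sub_colon].
- by exists Y.
Qed.

Lemma colon_br23 M : is_submod M -> bounded M -> colon (br23 M) `<=` br23 (colon M).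
Proof.
move=> MP MK z /= [[X c] /= XM Xz].
have {}Xz : X + c%:M = pi *: vec_mx z by rewrite -linearZ /= -Xz mxvecK.
have [/(red_ker piP) [d dE]|c0] := eqVneq (red c) 0.
  exists (vec_mx z - d%:M, d) => /=; last by rewrite subrK vec_mxK.
  apply: rowsin_pi; rewrite scalerBr -Xz dE.
  suff -> : pi *: (d%:M : 'M[o]_3) = (pi * d)%:M by rewrite addrK.
  by rewrite -scale_scalar_mx.
suff MT : M = setT.
  by exists (vec_mx z, 0) => /=; [move=> i; rewrite MT|rewrite raddf0 addr0 vec_mxK].
apply: nakayama => //; apply/eqP; rewrite -[_ == _]/(row_full _) -sub1mx.
have := rowsin_spanF XM MP.
have -> : rowred X = - red c *: 1%:M.
  apply/eqP; rewrite scaleNr -addr_eq0 scalemx1 -map_scalar_mx -map_mxD Xz.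
  by rewrite -/(rowred _) (rowredZ piP).
by rewrite (eqmx_scale _ _) // oppr_eq0.
Qed.
End Brackets.

End Brackets.
Import Brackets.

Module Index.
Local Open Scope classical_set_scope.

Section Index.
Variables (o : comNzRingType) (V : lmodType o).

Definition has_index (M : set V) k := exists (T : finType) (f : V -> T),
  [/\ #|T| = k, (forall a, exists x, f x = a) & forall x y, f x = f y <-> M (x - y)].

Lemma has_indexP (M : set V) k : is_submod M -> has_index M k ->
  finite_index M /\ mod_index M = k.
Proof.
move=> MP [T [f [<- fsurj fM]]].
have ME (x y : V) : mcoset M x = mcoset M y <-> f x = f y.
  by rewrite fM; exact: (cosetP (Submod MP)).
have [g gP] := choice fsurj.
have rE : range (mcoset M) = [set` [fset mcoset M (g a) | a : T]%fset].
  apply/seteqP; split=> A /=.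
    case=> x _ <-; apply/imfsetP; exists (f x) => //=.
    by apply/ME; rewrite gP.
  by case/imfsetP => a /= _ ->; exists (g a).
rewrite /finite_index /mod_index rE; split; first exact: finite_fset.
rewrite set_fsetK card_imfset /= -?cardE //.
by move=> a b /ME; rewrite !gP.
Qed.
End Index.

Lemma has_index_prod (o : comNzRingType) (V W : lmodType o) (M : set V) (N : set W) k l :
  has_index M k -> has_index N l -> has_index (V := (V * W)%type) (M `*` N) (k * l).
Proof.
move=> [T [f [<- fs fM]]] [S [g [<- gs gN]]].
exists (T * S)%type, (fun x => (f x.1, g x.2)); split.
- by rewrite card_prod.
- by move=> [a b]; have [x <-] := fs a; have [y <-] := gs b; exists (x, y).
move=> [x y] [x' y'] /=; split=> [[/fM Mx /gN Ny]|[/fM -> /gN -> //]]; by split.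
Qed.

Section LatticeIndex.
Variables (o : comNzRingType) (pi : o) (F : finFieldType) (red : {rmorphism o -> F}).
Hypothesis piP : uniformizer pi red.

Local Notation colon := (colon pi).
Local Notation rowred := (rowred red).
Local Notation spanF := (spanF red).
Local Notation corank := (corank red).
Local Notation bounded := (bounded pi).
Local Notation q := #|F|.

Lemma has_index_colon n (M : set 'rV[o]_n) k : is_submod M -> has_index (colon M) k ->
  has_index M (q ^ corank M * k).
Proof.
move=> MP [T [f [<- fs fM]]]; pose S := spanF M.
pose A := {w : 'rV[F]_n | (w <= cokermx S)%MS}.
have aP (x : 'rV[o]_n) : (rowred x *m cokermx S <= cokermx S)%MS by exact: submxMl.
pose a (x : 'rV[o]_n) : A := exist _ (rowred x *m cokermx S) (aP x).
have aM x y : a x = a y <-> exists m, M m /\ exists z, x - y = m + pi *: z.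
  split=> [|[m [Mm [z xy]]]].
    move/(congr1 val) => /= /eqP; rewrite -subr_eq0 -mulmxBl -map_mxB -submxE.
    case/(in_spanF piP) => // m Mm mxy; exists m; split=> //.
    have [z zE] : exists z, (x - y) - m = pi *: z.
      by apply: (rowred_ker piP); rewrite /Lattices.rowred map_mxB -!/(rowred _) mxy subrr.
    by exists z; rewrite -zE [RHS]addrC subrK.
  apply: val_inj; apply/eqP; rewrite /= -subr_eq0 -mulmxBl -map_mxB -submxE xy.
  apply/(in_spanF piP) => //; exists m => //.
  by rewrite map_mxD -!/(rowred _) (rowredZ piP) addr0.
have asurj (w : A) : exists x, a x = w.
  case: w => w wP; have /submxP [D wD] := wP.
  by exists (rowlft piP D); apply: val_inj; rewrite /= rowlftK.
have [g gP] := choice asurj.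
have dec x : exists z, M (x - g (a x) - pi *: z).
  have /aM [m [Mm [z zE]]] : a x = a (g (a x)) by rewrite gP.
  by exists z; rewrite zE addrK.
have [h hP] := choice dec.
exists (A * T)%type, (fun x => (a x, f (h x))); split.
- rewrite card_prod; congr (_ * _)%N.
  have -> : corank M = \rank (cokermx S) by rewrite mxrank_coker.
  by rewrite -card_row_space card_sig; apply: eq_card => w; rewrite inE.
- move=> [w t]; have [z zt] := fs t.
  exists (g w + pi *: z).
  have E : a (g w + pi *: z) = w.
    rewrite -[RHS]gP; apply/aM; exists 0; split; first by case: MP.
    by exists z; rewrite add0r addrC addKr.
  rewrite E -zt; congr pair; apply/esym/fM; rewrite /Lattices.colon /=.
  have := hP (g w + pi *: z); rewrite E.
  congr M; apply/rowP => i; rewrite !mxE; ring.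
move=> x y; split=> [e|Mxy].
  have axy : a x = a y := congr1 fst e; have /fM := congr1 snd e.
  rewrite /Lattices.colon /= scalerBr => hxy.
  have := submod_add MP (submod_sub MP (hP x) (hP y)) hxy.
  rewrite axy; congr M; apply/rowP => i; rewrite !mxE; ring.
have axy : a x = a y.
  by apply/aM; exists (x - y); split=> //; exists 0; rewrite scaler0 addr0.
rewrite axy; congr pair; apply/fM; rewrite /Lattices.colon /=.
have := submod_sub MP Mxy (submod_sub MP (hP x) (hP y)).
rewrite axy; congr M; apply/rowP => i; rewrite !mxE; ring.
Qed.

Lemma mod_index_colon n (M : set 'rV[o]_n) : is_submod M -> bounded M ->
  exists l, [/\ has_index M (q ^ (corank M + l)) & has_index (colon M) (q ^ l)].
Proof.
move=> MP [K]; elim: K M MP => [|K IHK] M MP MK.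
  have MT : M = setT.
    by apply/seteqP; split=> // x _; have := MK x; rewrite expr0 scale1r.
  have iT : has_index (colon M) (q ^ 0).
    by rewrite MT; exists unit, (fun=> tt); split; rewrite ?card_unit //; case; exists 0.
  by exists 0%N; split=> //; rewrite expnD; exact: has_index_colon.
have [|l [h1 h2]] := IHK (colon M) (colon_submod pi MP).
  by move=> x; rewrite /Lattices.colon /= scalerA -exprS.
exists (corank (colon M) + l)%N; split=> //.
by rewrite expnD; exact: has_index_colon.
Qed.

(* The length of the quotient by M. *)
Definition colength n (M : set 'rV[o]_n) : nat := trunc_log q (mod_index M).

Lemma colength_index n (M : set 'rV[o]_n) : is_submod M -> bounded M ->
  has_index M (q ^ colength M).
Proof.
move=> MP /(mod_index_colon MP) [l [h1 _]].
have [_ e] := has_indexP MP h1.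
by rewrite /colength e trunc_expnK ?finNzRing_gt1.
Qed.

Lemma colength_colon n (M : set 'rV[o]_n) : is_submod M -> bounded M ->
  colength M = (corank M + colength (colon M))%N.
Proof.
move=> MP /(mod_index_colon MP) [l [h1 h2]].
have [_ e1] := has_indexP MP h1; have [_ e2] := has_indexP (colon_submod pi MP) h2.
by rewrite /colength e1 e2 !trunc_expnK ?finNzRing_gt1.
Qed.
End LatticeIndex.

End Index.
Import Index.

Module Recursion.
Local Open Scope classical_set_scope.

Lemma uniq_flatten_map (T S : eqType) (f : T -> seq S) (g : S -> T) s : uniq s ->
  (forall x, x \in s -> uniq (f x)) -> (forall x y, x \in s -> y \in f x -> g y = x) ->
  uniq (flatten (map f s)).
Proof.
elim: s => //= x s IHs /andP[xs us] uf gf; rewrite cat_uniq uf ?mem_head //=.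
rewrite IHs // => [|y ys|y z ys zy]; last 2 first.
- by apply: uf; rewrite inE ys orbT.
- by apply: gf zy; rewrite inE ys orbT.
rewrite andbT; apply/hasPn => y /flatten_mapP [z zs yz].
apply: contra xs => yx; rewrite -(gf x y) ?mem_head //.
by rewrite (gf z y) // inE zs orbT.
Qed.

(* The number of subspaces W of dimension rho - r in a space of dimension rho over
   a field with q elements that meet a fixed subspace of dimension u trivially. *)
Definition subspace_count (q rho u r : nat) : nat :=
  if (r <= rho)%N then
    ((\prod_(i < rho - r) (q ^ rho - q ^ (u + i))) %/
      \prod_(i < rho - r) (q ^ (rho - r) - q ^ i))%N
  else 0%N.

Definition state := (nat * nat * nat)%type.
Definition rk12 r := nth 0%N [:: 0; 0; 1; 3]%N r.
Definition rk23 s := nth 0%N [:: 0; 2; 5; 8]%N s.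

Definition transition q (a b : state) : nat :=
  (subspace_count q 3 b.1.1 a.1.1 * subspace_count q (rk12 a.1.1) b.1.2 a.1.2 *
    subspace_count q (rk23 a.1.2) b.2 a.2)%N.

Definition size_state (a : state) : nat := (a.1.1 + a.1.2 + a.2)%N.

Definition states : seq state :=
  [seq (rs.1, rs.2, m) | rs <- [seq (r, s) | r <- iota 0 4, s <- iota 0 (rk12 r).+1],
                         m <- iota 0 (rk23 rs.2).+1].

Lemma mem_states (a : state) :
  (a \in states) = [&& a.1.1 <= 3, a.1.2 <= rk12 a.1.1 & a.2 <= rk23 a.1.2]%N.
Proof.
apply/idP/idP; first by move: a; apply/allP.
case: a => -[r s] m /= /and3P [].
case: r => [|[|[|[|r]]]] // _; case: s => [|[|[|[|s]]]] // _;
  by case: m => [|[|[|[|[|[|[|[|[|m]]]]]]]]].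
Qed.

Section Ideals.
Variables (o : comNzRingType) (pi : o) (F : finFieldType) (red : {rmorphism o -> F}).
Hypothesis piP : uniformizer pi red.

Local Notation colon := (colon pi).
Local Notation spanF := (spanF red).
Local Notation corank := (corank red).
Local Notation bounded := (bounded pi).
Local Notation fibre := (fibre red).
Local Notation q := #|F|.

Definition lat3 := (set 'rV[o]_3 * set 'rV[o]_3 * set 'rV[o]_(3 * 3))%type.

Definition lat_ideal (T : lat3) :=
  [/\ is_submod T.1.1, is_submod T.1.2, is_submod T.2,
      br12 T.1.1 `<=` T.1.2 & br23 T.1.2 `<=` T.2].

Definition colon3 (T : lat3) : lat3 := (colon T.1.1, colon T.1.2, colon T.2).

Definition coranks (T : lat3) : state := (corank T.1.1, corank T.1.2, corank T.2).

Definition colength3 (T : lat3) : nat :=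
  (colength F T.1.1 + colength F T.1.2 + colength F T.2)%N.

Definition above (N : lat3) : seq lat3 :=
  flatten [seq flatten [seq [seq (M1, M2, M3) | M3 <- fibre N.2 (br23 M2)] |
    M2 <- fibre N.1.2 (br12 M1)] | M1 <- fibre N.1.1 [set 0]].

Fixpoint ideals K : seq lat3 :=
  if K is K'.+1 then flatten [seq above N | N <- ideals K'] else [:: (setT, setT, setT)].

Lemma lat_ideal_colon T : lat_ideal T -> lat_ideal (colon3 T).
Proof.
move=> [T1 T2 T3 T12 T23]; split=> /=; try exact: colon_submod.
  apply/br12_sub; [exact: colon_submod|exact: colon_submod|].
  move=> x y /= Tx; rewrite /Lattices.colon /= -axialZ scalemxAr.
  by move/br12_sub: T12; apply.
apply/br23_sub; [exact: colon_submod|exact: colon_submod|].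
move/br23_sub: T23 => /(_ T2 T3) [T1M TM]; split.
  exact: submod_scale.
by move=> x y Tx; rewrite /Lattices.colon /= -linearZ /= scalemxAr; exact: TM.
Qed.

Lemma lat_ideal_bounded T : lat_ideal T -> bounded T.1.1 ->
  bounded T.1.2 /\ bounded T.2.
Proof.
move=> [T1 T2 T3 T12 T23] B1.
have B2 : bounded T.1.2 by apply: bounded_sub (br12_bounded B1).
by split=> //; apply: bounded_sub (br23_bounded B2).
Qed.

Section Above.
Variables (N : lat3).
Hypotheses (NI : lat_ideal N) (NK : bounded N.1.1).

Let set0P : is_submod [set 0 : 'rV[o]_3].
Proof. by split=> // a x y /= -> ->; rewrite scaler0 addr0. Qed.

Let colon0 : colon [set 0] `<=` N.1.1.
Proof. by move=> x /= /(row_reg piP) ->; case: NI => -[]. Qed.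

Let NS : [/\ is_submod N.1.1, is_submod N.1.2 & is_submod N.2].
Proof. by case: NI. Qed.

Let N1 : is_submod N.1.1. Proof. by case: NS. Qed.
Let N2 : is_submod N.1.2. Proof. by case: NS. Qed.
Let N3 : is_submod N.2. Proof. by case: NS. Qed.
Let K2 : bounded N.1.2. Proof. by case: (lat_ideal_bounded NI NK). Qed.
Let K3 : bounded N.2. Proof. by case: (lat_ideal_bounded NI NK). Qed.

Let bounded_colon n (M : set 'rV[o]_n) : bounded (colon M) -> bounded M.
Proof.
case=> K MK; exists K.+1 => x; rewrite exprS -scalerA; exact: MK.
Qed.

Let mem1 M1 : M1 \in fibre N.1.1 [set 0] ->
  [/\ is_submod M1, colon M1 = N.1.1, bounded M1, is_submod (br12 M1) & colon (br12 M1) `<=` N.1.2].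
Proof.
move/(mem_fibre piP N1 NK set0P colon0) => [M1P M1N _].
have B1 : bounded M1 by apply: bounded_colon; rewrite M1N.
split=> //; first exact: br12_submod.
by apply: subset_trans (colon_br12 piP M1P B1) _; rewrite M1N; case: NI.
Qed.

Let mem2 M1 M2 : M1 \in fibre N.1.1 [set 0] -> M2 \in fibre N.1.2 (br12 M1) ->
  [/\ is_submod M2, colon M2 = N.1.2, bounded M2, is_submod (br23 M2) & colon (br23 M2) `<=` N.2].
Proof.
move=> /mem1 [_ _ _ JP JN] /(mem_fibre piP N2 K2 JP JN) [M2P M2N _].
have B2 : bounded M2 by apply: bounded_colon; rewrite M2N.
split=> //; first exact: br23_submod.
by apply: subset_trans (colon_br23 piP M2P B2) _; rewrite M2N; case: NI.
Qed.

Lemma mem_above T : T \in above N <-> lat_ideal T /\ colon3 T = N.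
Proof.
split.
  move=> /flatten_mapP [M1 h1 /flatten_mapP [M2 h2 /mapP [M3 h3 ->]]].
  have [M1P M1N _ J1 J1N] := mem1 h1; have [M2P M2N _ J2 J2N] := mem2 h1 h2.
  have [_ _ JM2] := (mem_fibre piP N2 K2 J1 J1N M2).1 h2.
  have [M3P M3N JM3] := (mem_fibre piP N3 K3 J2 J2N M3).1 h3.
  by split=> //; rewrite /colon3 /= M1N M2N M3N; case: (N) => -[].
case: T => -[M1 M2] M3 /= [[/= M1P M2P M3P J12 J23] NE].
have e1 : colon M1 = N.1.1 by rewrite -NE.
have e2 : colon M2 = N.1.2 by rewrite -NE.
have e3 : colon M3 = N.2 by rewrite -NE.
have h1 : M1 \in fibre N.1.1 [set 0].
  by apply/(mem_fibre piP N1 NK set0P colon0); split=> // x ->; case: M1P.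
have [_ _ _ J1 J1N] := mem1 h1.
have h2 : M2 \in fibre N.1.2 (br12 M1) by apply/(mem_fibre piP N2 K2 J1 J1N).
have [_ _ _ J2 J2N] := mem2 h1 h2.
apply/flatten_mapP; exists M1 => //; apply/flatten_mapP; exists M2 => //.
by apply/mapP; exists M3 => //; apply/(mem_fibre piP N3 K3 J2 J2N).
Qed.

Lemma above_uniq : uniq (above N).
Proof.
apply: (uniq_flatten_map (g := fun T => T.1.1)).
- exact: (fibre_uniq piP _ N1 NK).
- move=> M1 h1; have [_ _ _ J1 J1N] := mem1 h1.
  apply: (uniq_flatten_map (g := fun T => T.1.2)).
  + exact: (fibre_uniq piP _ N2 K2).
  + move=> M2 h2; have [_ _ _ J2 J2N] := mem2 h1 h2.
    by rewrite map_inj_uniq ?(fibre_uniq piP _ N3 K3) // => x y [].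
  + by move=> M2 T _ /mapP [M3 _ ->].
by move=> M1 T _ /flatten_mapP [M2 _ /mapP [M3 _ ->]].
Qed.

Lemma count_fibre_subspace n (N' J : set 'rV[o]_n) r : is_submod N' -> bounded N' ->
    is_submod J -> colon J `<=` N' ->
  count (fun M => corank M == r) (fibre N' J) = subspace_count q (corank J) (corank N') r.
Proof.
move=> N'P N'K JP JN; rewrite /subspace_count; case: leqP => rJ.
  rewrite -(count_fibre piP N'P N'K JP JN rJ) mulnK // prodn_gt0 // => i.
  by rewrite subn_gt0 ltn_exp2l ?finNzRing_gt1.
apply/eqP; rewrite -leqn0 leqNgt -has_count -all_predC; apply/allP => M /=.
case/(mem_fibre piP N'P N'K JP JN) => MP _ JM.
apply: contraTneq rJ => <-; rewrite -leqNgt leq_sub2l // mxrankS //.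
apply/row_subP => i; have : (row i (spanF J) <= spanF J)%MS by exact: row_sub.
by case/(in_spanF piP) => // v /JM Mv <-; apply/(in_spanF piP) => //; exists v.
Qed.

Lemma count_above a : count (fun T => coranks T == a) (above N) = transition q a (coranks N).
Proof.
case: a => -[r s] m; rewrite /transition /above /=.
have c0 : corank [set (0 : 'rV[o]_3)] = 3%N.
  rewrite /Lattices.corank; suff -> : spanF [set (0 : 'rV[o]_3)] = 0 by rewrite mxrank0.
  apply/eqP; rewrite -submx0; apply/row_subP => i.
  have := row_sub i (spanF [set (0 : 'rV[o]_3)]).
  by case/(in_spanF piP) => // v -> <-; rewrite /rowred map_mx0 sub0mx.
have := count_fibre_subspace r N1 NK set0P colon0; rewrite c0 => <-.
rewrite count_flatten -map_comp sumnE big_map -sum1_count -mulnA big_distrl /=.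
rewrite [RHS]big_mkcond !big_seq; apply: eq_bigr => M1 h1 /=.
have [M1P M1N _ J1 J1N] := mem1 h1.
rewrite count_flatten -map_comp sumnE big_map.
case: eqP => [M1r|M1r]; last first.
  rewrite big1 // => M2 _ /=; rewrite count_map; apply/eqP; rewrite -leqn0 leqNgt -has_count.
  by apply/hasPn => M3 _ /=; apply/eqP; case.
have <- : corank (br12 M1) = rk12 r by rewrite (corank_br12 piP M1P) M1r.
rewrite mul1n -(count_fibre_subspace _ N2 K2 J1 J1N) -sum1_count big_distrl /=.
rewrite [RHS]big_mkcond !big_seq; apply: eq_bigr => M2 h2 /=.
have [M2P M2N _ J2 J2N] := mem2 h1 h2.
rewrite count_map; case: eqP => [M2s|M2s]; last first.
  apply/eqP; rewrite -leqn0 leqNgt -has_count.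
  by apply/hasPn => M3 _ /=; apply/eqP; case.
have <- : corank (br23 M2) = rk23 s by rewrite (corank_br23 piP M2P) M2s.
rewrite mul1n -(count_fibre_subspace _ N3 K3 J2 J2N); apply: eq_count => M3 /=.
by rewrite -M1r -M2s /coranks /= !xpair_eqE !eqxx.
Qed.

Lemma colength_above T : T \in above N ->
  colength3 T = (size_state (coranks T) + colength3 N)%N.
Proof.
move/mem_above => [TI TN]; have [T1P T2P T3P _ _] := TI.
have B1 : bounded T.1.1 by apply: bounded_colon; move: NK; rewrite -TN.
have [B2 B3] := lat_ideal_bounded TI B1.
rewrite /colength3 /size_state (colength_colon piP T1P B1) (colength_colon piP T2P B2).
rewrite (colength_colon piP T3P B3) -TN /=; lia.
Qed.
End Above.

Lemma mem_ideals K T : T \in ideals K <-> lat_ideal T /\ forall x, T.1.1 (pi ^+ K *: x).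
Proof.
elim: K T => [|K IHK] T /=.
  rewrite inE; split=> [/eqP -> //|[TI T1]].
  have [T1P T2P T3P T12 T23] := TI.
  have E1 : T.1.1 = setT.
    by apply/seteqP; split=> // x _; have := T1 x; rewrite expr0 scale1r.
  have E2 : T.1.2 = setT.
    apply/seteqP; split=> // x _; apply: T12; have [X <-] := axial_surj x.
    by exists X => // i; rewrite E1.
  have E3 : T.2 = setT.
    apply/seteqP; split=> // x _; apply: T23; exists (vec_mx x, 0) => /=.
      by move=> i; rewrite E2.
    by rewrite raddf0 addr0 vec_mxK.
  by apply/eqP; case: T E1 E2 E3 {T1 TI T1P T2P T3P T12 T23} => -[T1 T2] T3 /= -> -> ->.
split.
  move=> /flatten_mapP [N /IHK [NI NK]]; have NB : bounded N.1.1 by exists K.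
  case/(mem_above NI NB) => TI TN; split=> // x; rewrite exprS -scalerA.
  by have := NK x; rewrite -TN.
move=> [TI TK]; apply/flatten_mapP; exists (colon3 T).
  apply/IHK; split; first exact: lat_ideal_colon.
  by move=> x; rewrite /= /Lattices.colon /= scalerA -exprS.
apply/mem_above => //; first exact: lat_ideal_colon.
by exists K => x; rewrite /= /Lattices.colon /= scalerA -exprS.
Qed.

Lemma ideals_uniq K : uniq (ideals K).
Proof.
elim: K => //= K IHK; apply: (@uniq_flatten_map lat3 lat3 above colon3) => // N.
  move=> /mem_ideals [NI NK].
  by apply: above_uniq => //; exists K.
by move=> T /mem_ideals [NI NK] /(mem_above NI) []; first by exists K.
Qed.

Lemma ideals_mono K L : (K <= L)%N -> {subset ideals K <= ideals L}.
Proof.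
move=> KL T /mem_ideals [TI TK]; apply/mem_ideals; split=> // x.
by rewrite -(subnKC KL) exprD -scalerA.
Qed.

Lemma coranks_states T : lat_ideal T -> coranks T \in states.
Proof.
move=> [T1P T2P T3P T12 T23]; rewrite mem_states /=.
have mono n (M M' : set 'rV[o]_n) : is_submod M -> is_submod M' -> M `<=` M' ->
    (corank M' <= corank M)%N.
  move=> MP M'P MM; rewrite leq_sub2l // mxrankS //; apply/row_subP => i.
  have : (row i (spanF M) <= spanF M)%MS by exact: row_sub.
  by case/(in_spanF piP) => // v /MM Mv <-; apply/(in_spanF piP) => //; exists v.
rewrite /rk12 /rk23 -(corank_br12 piP T1P) -(corank_br23 piP T2P) leq_subr /=.
by apply/andP; split; apply: mono => //; [exact: br12_submod|exact: br23_submod].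
Qed.

Section Transfer.
Variables (R : comNzRingType) (t : R).

Definition partial_zeta K (a : state) : R :=
  \sum_(T <- ideals K | coranks T == a) t ^+ colength3 T.

Lemma partial_zeta0 a : partial_zeta 0 a = (a == (0, 0, 0)%N)%:R.
Proof.
rewrite /partial_zeta /= big_mkcond big_seq1.
have c n : corank (setT : set 'rV[o]_n) = 0%N.
  rewrite /Lattices.corank; suff -> : \rank (spanF (setT : set 'rV[o]_n)) = n by rewrite subnn.
  apply/eqP; rewrite -[_ == _]/(row_full _) -sub1mx; apply/row_subP => i.
  by apply/(in_spanF piP) => //; exists (rowlft piP (row i 1%:M)) => //; exact: rowlftK.
have l n : colength F (setT : set 'rV[o]_n) = 0%N.
  have iT : has_index (setT : set 'rV[o]_n) 1.
    by exists unit, (fun=> tt); split; rewrite ?card_unit //; case; exists 0.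
  by have [|_ e] := has_indexP _ iT; rewrite /colength ?e ?trunc_log1.
rewrite /coranks /= !c eq_sym; case: eqP => //= _.
by rewrite /colength3 /= !l expr0.
Qed.

Lemma partial_zetaS K a : partial_zeta K.+1 a =
  \sum_(b <- states) t ^+ size_state a * (transition q a b)%:R * partial_zeta K b.
Proof.
rewrite /partial_zeta /= big_flatten big_map /=.
transitivity (\sum_(N <- ideals K) t ^+ size_state a * (transition q a (coranks N))%:R * t ^+ colength3 N).
  rewrite !big_seq; apply: eq_bigr => N /mem_ideals [NI NK].
  have NB : bounded N.1.1 by exists K.
  rewrite -(count_above NI NB) -sum1_count natr_sum big_distrr big_distrl /=.
  rewrite big_seq_cond [RHS]big_seq_cond; apply: eq_bigr => T /andP[TN /eqP Ta].
  by rewrite (colength_above NI NB TN) Ta exprD mulr1.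
under [RHS]eq_bigr do rewrite big_distrr /= big_mkcond.
rewrite exchange_big /= !big_seq; apply: eq_bigr => N /mem_ideals [NI _].
rewrite (bigD1_seq (coranks N)) /=; [|exact: coranks_states|by []].
by rewrite eqxx big1 ?addr0 // => b; rewrite eq_sym => /negbTE ->.
Qed.

Lemma partial_zeta_total K :
  \sum_(T <- ideals K) t ^+ colength3 T = \sum_(a <- states) partial_zeta K a.
Proof.
under [RHS]eq_bigr do rewrite /partial_zeta big_mkcond.
rewrite exchange_big /= !big_seq; apply: eq_bigr => N /mem_ideals [NI _].
rewrite (bigD1_seq (coranks N)) /=; [|exact: coranks_states|by []].
by rewrite eqxx big1 ?addr0 // => b; rewrite eq_sym => /negbTE ->.
Qed.
End Transfer.
End Ideals.

End Recursion.
Import Recursion.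

Module ResidueField.
Local Open Scope classical_set_scope.

Section ResidueField.
Variables (R : comNzRingType) (pi : R).

Definition is_uniformizer :=
  [/\ forall x, (exists y, x * y = 1) \/ (exists y, x = pi * y),
      ~ exists y, pi * y = 1,
      forall x, pi * x = 0 -> x = 0 &
      finite_index (@maximal_ideal R : set R^o)].

Hypothesis piP : is_uniformizer.

Let m : set R^o := @maximal_ideal R.

Let mE x : m x <-> exists y, x = pi * y.
Proof.
have [dich npi _ _] := piP; split=> [mx|[y ->] [z pyz]].
  by case: (dich x) => // /mx.
by apply: npi; exists (y * z); rewrite mulrA.
Qed.

Let mP : is_submod m.
Proof.
split; first by apply/mE; exists 0; rewrite mulr0.
move=> a x y /mE [x' ->] /mE [y' ->]; apply/mE; exists (a * x' + y').
by rewrite mulrDr mulrCA.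
Qed.

Let cosets : {fset set R^o} := fset_set (range (mcoset m)).

Definition residue_field : Type := cosets.
HB.instance Definition _ := Finite.on residue_field.

Let coset_in (x : R) : mcoset m x \in cosets.
Proof. by rewrite in_fset_set; [apply/mem_set; exists x|case: piP]. Qed.

Definition to_residue (x : R) : residue_field := [` coset_in x]%fset.

Let toE x y : to_residue x = to_residue y <-> m (x - y).
Proof.
split=> [/(congr1 val) /= xy|xy]; first exact/(cosetP (Submod mP)).
by apply: val_inj; apply/(cosetP (Submod mP)).
Qed.

Let to_surj (a : residue_field) : exists x, to_residue x = a.
Proof.
have := fsvalP a; rewrite in_fset_set; last by case: piP.
by move=> /set_mem [x _ xa]; exists x; apply: val_inj.
Qed.

Definition of_residue (a : residue_field) : R := xget 0 [set x | to_residue x = a].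

Let ofK : cancel of_residue to_residue.
Proof.
by move=> a; rewrite /of_residue; case: xgetP => [x _ //|]; have [x] := to_surj a => /[swap] /(_ x).
Qed.

Definition residue_add a b := to_residue (of_residue a + of_residue b).
Definition residue_mul a b := to_residue (of_residue a * of_residue b).
Definition residue_opp a := to_residue (- of_residue a).
Definition residue_inv a :=
  if a == to_residue 0 then a else to_residue (xget 0 [set y | m (of_residue a * y - 1)]).

Let mD x y : m x -> m y -> m (x + y).
Proof. by move=> /mE [x' ->] /mE [y' ->]; apply/mE; exists (x' + y'); rewrite mulrDr. Qed.
Let mM a x : m x -> m (a * x).
Proof. by move=> /mE [x' ->]; apply/mE; exists (a * x'); rewrite mulrCA. Qed.

Let of_to x : m (of_residue (to_residue x) - x).
Proof. by apply/toE; rewrite ofK. Qed.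

Let toD x y : residue_add (to_residue x) (to_residue y) = to_residue (x + y).
Proof. by apply/toE; rewrite opprD addrACA; apply: mD; exact: of_to. Qed.
Let toM x y : residue_mul (to_residue x) (to_residue y) = to_residue (x * y).
Proof.
apply/toE; set a := of_residue _; set b := of_residue _.
have -> : a * b - x * y = b * (a - x) + x * (b - y) by ring.
by apply: mD; apply: mM; exact: of_to.
Qed.
Let toN x : residue_opp (to_residue x) = to_residue (- x).
Proof. by apply/toE; rewrite -opprD -mulN1r; apply: mM; exact: of_to. Qed.

Let to_ind (P : residue_field -> Prop) : (forall x, P (to_residue x)) -> forall a, P a.
Proof. by move=> Pt a; rewrite -[a]ofK. Qed.

Fact residue_addA : associative residue_add.
Proof. by elim/to_ind=> x; elim/to_ind=> y; elim/to_ind=> z; rewrite !toD addrA. Qed.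
Fact residue_addC : commutative residue_add.
Proof. by elim/to_ind=> x; elim/to_ind=> y; rewrite !toD addrC. Qed.
Fact residue_add0 : left_id (to_residue 0) residue_add.
Proof. by elim/to_ind=> x; rewrite !toD add0r. Qed.
Fact residue_addN : left_inverse (to_residue 0) residue_opp residue_add.
Proof. by elim/to_ind=> x; rewrite toN !toD addNr. Qed.
HB.instance Definition _ := GRing.isZmodule.Build residue_field
  residue_addA residue_addC residue_add0 residue_addN.

Fact residue_mulA : associative residue_mul.
Proof. by elim/to_ind=> x; elim/to_ind=> y; elim/to_ind=> z; rewrite !toM mulrA. Qed.
Fact residue_mulC : commutative residue_mul.
Proof. by elim/to_ind=> x; elim/to_ind=> y; rewrite !toM mulrC. Qed.
Fact residue_mul1 : left_id (to_residue 1) residue_mul.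
Proof. by elim/to_ind=> x; rewrite !toM mul1r. Qed.
Fact residue_mulD : left_distributive residue_mul residue_add.
Proof.
by elim/to_ind=> x; elim/to_ind=> y; elim/to_ind=> z; rewrite !(toM, toD) mulrDl.
Qed.
Fact residue_1neq0 : to_residue 1 != to_residue 0.
Proof. by apply/eqP => /toE; rewrite subr0; apply; exists 1; rewrite mulr1. Qed.
HB.instance Definition _ := GRing.Zmodule_isComNzRing.Build residue_field
  residue_mulA residue_mulC residue_mul1 residue_mulD residue_1neq0.

Fact residue_mulV : forall a : residue_field, a != 0 -> residue_mul (residue_inv a) a = 1.
Proof.
move=> a a0; rewrite /residue_inv ifN // residue_mulC -[a in LHS]ofK toM; apply/toE.
rewrite ofK; case: xgetP => [y _ //|/= ny].
case: piP => /(_ (of_residue a)) [[y ay]|/mE am] _ _ _.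
  by case: (ny y); rewrite ay subrr; apply/mE; exists 0; rewrite mulr0.
by case/eqP: a0; rewrite -[a]ofK; apply/toE; rewrite subr0.
Qed.
Fact residue_inv0 : residue_inv 0 = 0.
Proof. by rewrite /residue_inv eqxx. Qed.
HB.instance Definition _ := GRing.ComNzRing_isField.Build residue_field
  residue_mulV residue_inv0.

Fact to_residue_zmod_morphism : zmod_morphism to_residue.
Proof. by move=> x y; rewrite -toD -toN. Qed.
Fact to_residue_monoid_morphism : monoid_morphism to_residue.
Proof. by split=> // x y; rewrite -toM. Qed.
HB.instance Definition _ := GRing.isZmodMorphism.Build R residue_field to_residue
  to_residue_zmod_morphism.
HB.instance Definition _ := GRing.isMonoidMorphism.Build R residue_field to_residue
  to_residue_monoid_morphism.

Lemma residue_field_ex : exists (F : finFieldType) (red : {rmorphism R -> F}),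
  uniformizer pi red /\ #|F| = residue_card R.
Proof.
exists residue_field, to_residue; split; last first.
  by rewrite /residue_card /mod_index cardfE.
split; first exact: to_surj.
- by move=> x; rewrite -mE -[x in m x]subr0; exact: toE.
- by case: piP.
move=> x /eqP x0; case: piP => /(_ x) [//|/mE mx] _ _ _.
by case: x0; apply/toE; rewrite subr0.
Qed.
End ResidueField.

End ResidueField.
Import ResidueField.

Module PadicIntegers.
Local Open Scope classical_set_scope.

Section PadicIntegers.
Variables (p : nat) (p_pr : prime p).
Local Notation Zp := (padic_int p_pr).
Local Notation pz n := (Posz (expn p n)).
Implicit Types x y : Zp.

Lemma padic_int_ofE (m : int) : padic_int_of p_pr m = m%:~R.
Proof.
have D a b : padic_int_of p_pr (a + b) = padic_int_of p_pr a + padic_int_of p_pr b.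
  by apply: padic_eqP => n /=; rewrite !modz_mod modzDm.
have nat_case (n : nat) : padic_int_of p_pr n = n%:R.
  by elim: n => [|n IHn] //; rewrite -[in RHS]addn1 natrD -IHn -[Posz n.+1]/(Posz (1 + n)) addnC PoszD D.
case: m => n; first exact: nat_case.
rewrite NegzE mulrNz; apply/eqP; rewrite -subr_eq0 opprK; apply/eqP.
by rewrite -[_%:~R]nat_case -D addNr.
Qed.

Lemma residue_intr (m : int) n : (m%:~R : Zp) n = (m %% pz n)%Z.
Proof. by rewrite -padic_int_ofE. Qed.

Lemma residueD x y n : (x + y) n = ((x n + y n) %% pz n)%Z.
Proof. by []. Qed.

Lemma residueM x y n : (x * y) n = ((x n * y n) %% pz n)%Z.
Proof. by []. Qed.

Lemma residueN x n : (- x) n = ((- x n) %% pz n)%Z.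
Proof. by []. Qed.

Lemma residue0 n : (0 : Zp) n = 0.
Proof. by rewrite -[0]/(0%:~R) residue_intr mod0z. Qed.

Lemma residue1 n : (1 : Zp) n = (1 %% pz n)%Z.
Proof. exact: (residue_intr 1 n). Qed.

Lemma residue_chain x m j : x m = (x (m + j)%N %% pz m)%Z.
Proof.
elim: j => [|j IHj]; first by rewrite addn0 residue_modz.
rewrite IHj addnS (residueP x (m + j)%N) {1}expnD PoszM.
set a := x _; set M := (_ * _ : int).
have e : a = ((a %/ M)%Z * pz j) * pz m + (a %% M)%Z.
  by rewrite -mulrA [(pz j * _)%R]mulrC -divz_eq.
by rewrite [in RHS]e modzMDl.
Qed.

Lemma padic_eq x y : (forall n, x n = y n) -> x = y.
Proof. by move=> xy; apply: padic_eqP => n; rewrite xy. Qed.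

Lemma p_gt0 n : 0 < pz n.
Proof. by rewrite ltz_nat expn_gt0 prime_gt0. Qed.

Lemma natr_expE n k : ((p%:R : Zp) ^+ n) k = (pz n %% pz k)%Z.
Proof. by rewrite -natrX -[_%:R]/((Posz _)%:~R) residue_intr. Qed.

Lemma padic_dvdP x n : x n = 0 <-> exists y, x = p%:R ^+ n * y.
Proof.
split=> [xn|[y ->]]; last by rewrite residueM natr_expE modzz mul0r mod0z.
have dv j : x (n + j)%N = ((x (n + j)%N %/ pz n)%Z * pz n)%R.
  rewrite [LHS](divz_eq (x (n + j)%N) (pz n)) -residue_chain xn addr0 //.
pose f k := (x (n + k)%N %/ pz n)%Z.
have fc : coherent p f.
  move=> k; apply/eqP; rewrite eqz_mod_dvd -(@dvdz_mul2r (pz n)) ?gt_eqF ?p_gt0 //.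
  rewrite mulrBl -!dv -PoszM -expnD [(k + n)%N]addnC -eqz_mod_dvd addnS.
  exact/eqP/padic_coherent.
exists (padic_mk p_pr fc); apply: padic_eq => k.
rewrite residueM natr_expE modzMml /= modzMmr mulrC -dv addnC.
exact: residue_chain.
Qed.

Lemma padic_unit1 x : x 1%N != 0 -> exists y, x * y = 1.
Proof.
move=> x1; have cop n : coprimez (x n) (pz n).
  case: n => [|n]; first by rewrite coprimezE expn0 coprimen1.
  rewrite coprimezE /= coprimeXr // coprime_sym prime_coprime //.
  by have := residue_eq0_le (ltn0Sn n) x1; rewrite expn1 dvdzE.
have inv n : exists b : int, (x n * b = 1 %[mod pz n])%Z.
  have /coprimezP [uv uvE] := cop n; exists uv.1.
  by rewrite -uvE addrC modzMDl mulrC.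
have [f fP] := choice inv.
have fc : coherent p f.
  move=> n; apply/eqP; rewrite eqz_mod_dvd.
  have cn := cop n; rewrite coprimez_sym in cn.
  rewrite -(Gauss_dvdzr _ cn) mulrBr -eqz_mod_dvd; apply/eqP.
  rewrite fP; have : (x n.+1 * f n.+1 = 1 %[mod pz n])%Z.
    have /eqP := fP n.+1; rewrite eqz_mod_dvd => h; apply/eqP; rewrite eqz_mod_dvd.
    by apply: dvdz_trans h; rewrite dvdzE /= dvdn_exp2l.
  by move=> <-; rewrite -modzMml -[in RHS]modzMml padic_coherent.
exists (padic_mk p_pr fc); apply: padic_eqP => n; rewrite residue_modz residueM /=.
by rewrite modzMmr fP modz_mod.
Qed.

Lemma p_nonunit : ~ exists y, (p%:R : Zp) * y = 1.
Proof.
case=> y /(congr1 (fun z : Zp => z 1%N)); rewrite residueM -{1}(expr1 p%:R) natr_expE.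
rewrite modzz mul0r mod0z residue1 expn1 modz_small //.
by rewrite ltz_nat prime_gt1.
Qed.

Lemma padic_dich x : (exists y, x * y = 1) \/ (exists y, x = p%:R * y).
Proof.
have [x1|/padic_unit1] := eqVneq (x 1%N) 0; last by left.
by right; have /padic_dvdP [y ->] := x1; exists y; rewrite expr1.
Qed.

Lemma padic_factor x : x != 0 -> exists k u, [/\ x = p%:R ^+ k * u & u 1%N != 0].
Proof.
move=> x0; have ex : exists n, x n != 0.
  apply: contrapT => /forallNP xn; case/eqP: x0; apply: padic_eq => n.
  by rewrite residue0; apply/eqP; move: (xn n) => /negP; rewrite negbK.
case: (ex_minnP ex) => -[|n] xn nmin.
  by case/negP: xn; rewrite -(residue_modz x 0) expn0 modz1.
have /padic_dvdP [u xu] : x n = 0.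
  by apply/eqP; apply: contraT => /nmin; rewrite ltnn.
exists n, u; split=> //; apply: contra xn => /eqP/padic_dvdP [v uv].
by apply/eqP/padic_dvdP; exists v; rewrite xu uv mulrA -exprD addn1.
Qed.

Lemma p_neq0 : (p%:R : Zp) != 0.
Proof.
apply/eqP => /(congr1 (fun z : Zp => z 2%N)); rewrite residue0 -{1}(expr1 p%:R) natr_expE expn1 modz_small.
  by case=> p0; move: (prime_gt0 p_pr); rewrite p0.
by rewrite ltz_nat /=; have := prime_gt1 p_pr; nia.
Qed.

Lemma padic_residue_bound x n : (0 <= x n < pz n)%R.
Proof.
rewrite -(residue_modz x n) modz_ge0 ?ltz_pmod ?p_gt0 //.
by rewrite gt_eqF ?p_gt0.
Qed.
End PadicIntegers.

End PadicIntegers.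
Import PadicIntegers.

Module PadicValuation.
Local Open Scope classical_set_scope.

Lemma fracE (R : idomainType) (x : {fraction R}) :
  exists2 ab : R * R, ab.2 != 0 & x = tofrac ab.1 / tofrac ab.2.
Proof.
elim/quotW: x => r; exists (val r); first exact: denom_ratioP.
have d0 : tofrac (val r).2 != 0 by rewrite tofrac_eq0 denom_ratioP.
apply: (mulIf d0); rewrite divfK //; unlock tofrac.
rewrite -[LHS]FracField.pi_mul; apply/eqmodP; rewrite /= FracField.equivfE /FracField.mulf.
by rewrite !numden_Ratio ?mulr1 ?mulf_neq0 ?denom_ratioP ?oner_eq0 // mulrC.
Qed.

Section PadicNumbers.
Variables (p : nat) (p_pr : prime p).
Local Notation Zp := (padic_int p_pr).
Local Notation Qp := (padic p_pr).
Local Notation emb := (@tofrac Zp).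
Local Notation P := (emb p%:R).
Implicit Types x y : Qp.

Lemma embP0 : P != 0.
Proof. by rewrite tofrac_eq0 p_neq0. Qed.

Lemma emb_inj : injective emb.
Proof. by move=> a b /eqP; rewrite tofrac_eq => /eqP. Qed.

Definition Zin x := exists a, x = emb a.

Definition is_valuation x k := exists2 u : Zp, (exists v, u * v = 1) & x = emb u * P ^ k.

Lemma valuation_ex x : x != 0 -> exists k, is_valuation x k.
Proof.
have pw a : a != 0 -> exists (k : nat) (u : Zp), (exists v, u * v = 1) /\ a = p%:R ^+ k * u.
  by move=> /padic_factor [k [u [-> /padic_unit1 uU]]]; exists k, u.
have [[a b] /= b0 ->] := fracE x => x0.
have a0 : a != 0 by apply: contra x0 => /eqP ->; rewrite tofrac0 mul0r.
have [k [u [[u' uu'] ->]]] := pw _ a0; have [l [v [[v' vv'] ->]]] := pw _ b0.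
exists (k%:Z - l%:Z); exists (u * v'); first by exists (u' * v); rewrite mulrACA uu' mul1r mulrC.
have v0 : emb v != 0 by apply/eqP => v0; move/(congr1 emb): vv'; rewrite tofracM v0 mul0r tofrac1 => /eqP; rewrite eq_sym oner_eq0.
have vE : emb v' = (emb v)^-1.
  by apply: (mulfI v0); rewrite -tofracM vv' tofrac1 divff.
rewrite !tofracM vE !tofracXn expfzDr ?embP0 // -exprnN -!exprnP.
by rewrite invfM mulrACA [RHS]mulrC.
Qed.

Lemma unit_emb0 u : (exists v : Zp, u * v = 1) -> emb u != 0.
Proof.
case=> v uv; apply/eqP => u0; move/(congr1 emb): uv.
by rewrite tofracM u0 mul0r tofrac1 => /eqP; rewrite eq_sym oner_eq0.
Qed.

Lemma valuation_unique x k l : is_valuation x k -> is_valuation x l -> k = l.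
Proof.
have lt (u v : Zp) (k' l' : int) : (exists w, u * w = 1) -> k' < l' -> emb u * P ^ k' = emb v * P ^ l' -> False.
  move=> [w uw] kl; have -> : l' = k' + (absz (l' - k'))%:Z by lia.
  rewrite expfzDr ?embP0 // mulrCA mulrC.
  move/(mulfI (expfz_neq0 _ embP0)); rewrite -exprnP -tofracXn -tofracM => /emb_inj uE.
  apply: (@p_nonunit _ p_pr).
  have [d dE] : exists d, absz (l' - k') = d.+1 by exists (absz (l' - k')).-1; lia.
  by exists (v * p%:R ^+ d * w); move: uE uw; rewrite dE exprS => ->; rewrite mulrCA !mulrA.
case=> u uU -> [v vU uv]; case: (ltgtP k l) => // kl.
  by case: (lt _ _ _ _ uU kl uv).
by case: (lt _ _ _ _ vU kl (esym uv)).
Qed.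

Definition vQ x : int := xget 0 [set k | is_valuation x k].

Lemma vQP x : x != 0 -> is_valuation x (vQ x).
Proof. by move=> /valuation_ex [k xk]; rewrite /vQ; case: xgetP => [l _ //|/(_ k)]. Qed.

Lemma vQ_eq x k : is_valuation x k -> vQ x = k.
Proof.
move=> xk; apply: valuation_unique (xk); apply: vQP.
by case: xk => u /unit_emb0 u0 ->; rewrite mulf_neq0 ?expfz_neq0 ?embP0.
Qed.

Lemma is_valuationM x y k l : is_valuation x k -> is_valuation y l -> is_valuation (x * y) (k + l).
Proof.
case=> u [u' uu'] -> [v [v' vv'] ->]; exists (u * v).
  by exists (u' * v'); rewrite mulrACA uu' vv' mul1r.
by rewrite tofracM expfzDr ?embP0 // mulrACA.
Qed.

Lemma vQM x y : x != 0 -> y != 0 -> vQ (x * y) = vQ x + vQ y.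
Proof. by move=> /vQP x0 /vQP y0; apply: vQ_eq; exact: is_valuationM. Qed.

Lemma vQ_expP k : vQ (P ^ k) = k.
Proof. by apply: vQ_eq; exists 1; [exists 1; rewrite mulr1|rewrite tofrac1 mul1r]. Qed.

Lemma vQ1 : vQ 1 = 0.
Proof. by rewrite -(expr0z P) vQ_expP. Qed.

Lemma vQV x : x != 0 -> vQ x^-1 = - vQ x.
Proof.
move=> x0; apply/eqP; rewrite -subr_eq0 opprK addrC -vQM ?invr_eq0 //.
by rewrite divff //; apply/eqP; exact: vQ1.
Qed.

Lemma vQX x n : x != 0 -> vQ (x ^+ n) = vQ x * n%:Z.
Proof.
move=> x0; elim: n => [|n IHn]; first by rewrite expr0 mulr0; exact: vQ1.
by rewrite exprS vQM ?expf_neq0 // IHn -addn1 PoszD; ring.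
Qed.

Lemma Zin_vQ x : x != 0 -> Zin x <-> 0 <= vQ x.
Proof.
move=> x0; split=> [[a xa]|].
  have : a != 0 by apply: contra x0 => /eqP a0; rewrite xa a0 tofrac0.
  move=> /padic_factor [k [u [aE /padic_unit1 uU]]]; suff -> : vQ x = k by [].
  apply: vQ_eq; exists u => //.
  by rewrite xa aE tofracM tofracXn mulrC exprnP.
have [u _] := vQP x0; case: (vQ x) => // k xE _.
by exists (u * p%:R ^+ k); rewrite tofracM tofracXn.
Qed.

Lemma ZinM x y : Zin x -> Zin y -> Zin (x * y).
Proof. by move=> [a ->] [b ->]; exists (a * b); rewrite tofracM. Qed.

Lemma ZinPX n : Zin (P ^+ n).
Proof. by exists (p%:R ^+ n); rewrite tofracXn. Qed.

Lemma common_denominator (I : finType) (f : I -> Qp) : exists D, forall i, Zin (P ^+ D * f i).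
Proof.
have den x : exists D, Zin (P ^+ D * x).
  have [->|x0] := eqVneq x 0; first by exists 0%N; exists 0; rewrite tofrac0 mulr0.
  exists (absz (vQ x)); apply/Zin_vQ; first by rewrite mulf_neq0 ?expf_neq0 ?embP0.
  by rewrite vQM ?expf_neq0 ?embP0 // exprnP vQ_expP; lia.
have [g gP] := choice (fun i => den (f i)).
exists (\sum_i g i)%N => i; rewrite (bigD1 i) //= addnC exprD -mulrA.
by apply: ZinM => //; exact: ZinPX.
Qed.
End PadicNumbers.

(* Koenig's lemma: a sequence of vectors over the p-adic integers has a cluster point. *)
Section Compactness.
Variables (p : nat) (p_pr : prime p) (n : nat).
Local Notation Zp := (padic_int p_pr).
Implicit Types c : 'rV[Zp]_n.

Definition residues k c : 'rV[int]_n := map_mx (fun z : Zp => residue z k) c.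

Lemma padic_cluster (f : nat -> 'rV[Zp]_n) :
  exists c, forall k, exists2 j, (k <= j)%N & residues k (f j) = residues k c.
Proof.
pose inf k a := forall m, exists2 j, (m <= j)%N & residues k (f j) = a.
have inf0 : inf 0%N 0.
  move=> m; exists m => //; apply/rowP => i; rewrite !mxE.
  by rewrite -(residue_modz _ 0) expn0 modz1.
have step k a : inf k a -> exists b, inf k.+1 b /\
    forall i, a 0 i = (b 0%R i %% Posz (p ^ k))%Z.
  move=> ka.
  pose code c : {ffun 'I_n -> 'I_(p ^ k.+1).+1} := [ffun i => inord (absz (c 0 i k.+1))].
  have codeE c d : code c = code d -> residues k.+1 c = residues k.+1 d.
    move=> /ffunP cd; apply/rowP => i; have := congr1 val (cd i); rewrite !ffunE /= !mxE.
    have /andP[c0 c1] := padic_residue_bound (c 0 i) k.+1.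
    have /andP[d0 d1] := padic_residue_bound (d 0 i) k.+1.
    by rewrite !inordK; lia.
  have [s sP] : exists s, forall m, exists2 j, (m <= j)%N & residues k (f j) = a /\ code (f j) = s.
    apply: contrapT => /forallNP ns.
    have /choice [g gP] : forall s : {ffun 'I_n -> 'I_(p ^ k.+1).+1}, exists m,
        forall j, (m <= j)%N -> residues k (f j) = a -> code (f j) = s -> False.
      move=> s; have /existsNP [m mP] := ns s.
      by exists m => j mj ja js; apply: mP; exists j.
    have [j jm ja] := ka (\sum_s g s)%N.
    apply: (gP (code (f j)) j) => //; apply: leq_trans jm.
    by rewrite (bigD1 (code (f j))) //= leq_addr.
  have [j0 _ [ja0 js0]] := sP 0%N.
  exists (residues k.+1 (f j0)); split=> [m|i].
    have [j mj [ja js]] := sP m; exists j => //.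
    by apply: codeE; rewrite js.
  by rewrite -ja0 !mxE -residueP.
pose T k := {a | inf k a}.
have [g gP] : exists g : forall k, T k -> T k.+1,
    forall k (a : T k) i, (sval a) 0 i = (sval (g k a) 0%R i %% Posz (p ^ k))%Z.
  have h k (a : T k) : {b : T k.+1 | forall i, (sval a) 0 i = (sval b 0%R i %% Posz (p ^ k))%Z}.
    case: a => a ka; have [b [kb ab]] := cid (step k a ka).
    by exists (exist _ b kb).
  by exists (fun k a => sval (h k a)) => k a; case: (h k a).
pose s := fix s k : T k := if k is k'.+1 then g k' (s k') else exist _ 0 inf0.
have sP i k : sval (s k) 0 i = (sval (s k.+1) 0%R i %% Posz (p ^ k))%Z by exact: gP.
exists (\row_i PadicInt p_pr (sP i)) => k.
have [j kj jE] := svalP (s k) k; exists j => //.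
by rewrite jE; apply/rowP => i; rewrite !mxE.
Qed.
End Compactness.

End PadicValuation.
Import PadicValuation.

Module ExtensionValuation.
Local Open Scope classical_set_scope.
Import VectorInternalTheory.

Section PadicField.
Variables (p : nat) (p_pr : prime p).
Local Notation Zp := (padic_int p_pr).
Local Notation Qp := (padic p_pr).
Local Notation emb := (@tofrac Zp).
Local Notation P := (emb p%:R).
Variable K : fieldExtType Qp.
Implicit Types x y z : K.

Local Notation n := (dim K).

Definition mulmx_of x : 'M[Qp]_n := lin1_mx (v2r \o (x \o* @r2v Qp K)).

Lemma mulmx_ofE x y : v2r y *m mulmx_of x = v2r (y * x).
Proof. by rewrite mul_rV_lin1 /= v2rK. Qed.

Lemma mulmx_of_eq (A : 'M[Qp]_n) x : (forall y, v2r y *m A = v2r (y * x)) -> mulmx_of x = A.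
Proof.
move=> Ax; apply/row_matrixP => i; rewrite !rowE -[delta_mx 0 i](@r2vK _ K).
by rewrite mulmx_ofE Ax.
Qed.

Lemma mulmx_ofM x y : mulmx_of (x * y) = mulmx_of x *m mulmx_of y.
Proof. by apply: mulmx_of_eq => z; rewrite mulmxA !mulmx_ofE mulrA. Qed.

Lemma mulmx_of1 : mulmx_of 1 = 1%:M.
Proof. by apply: mulmx_of_eq => z; rewrite mulmx1 mulr1. Qed.

Lemma mulmx_of_lin a x y : mulmx_of (a *: x + y) = a *: mulmx_of x + mulmx_of y.
Proof.
apply: mulmx_of_eq => z; rewrite mulmxDr -scalemxAr !mulmx_ofE -linearP.
by rewrite mulrDr scalerAr.
Qed.

Lemma mulmx_ofZ a x : mulmx_of (a *: x) = a *: mulmx_of x.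
Proof. by apply: mulmx_of_eq => z; rewrite -scalemxAr mulmx_ofE -linearZ scalerAr. Qed.

(* The norm from K to the p-adic numbers. *)
Definition knorm x : Qp := \det (mulmx_of x).

Lemma knormM x y : knorm (x * y) = knorm x * knorm y.
Proof. by rewrite /knorm mulmx_ofM det_mulmx. Qed.

Lemma knorm1 : knorm 1 = 1.
Proof. by rewrite /knorm mulmx_of1 det1. Qed.

Lemma knormZ a x : knorm (a *: x) = a ^+ n * knorm x.
Proof. by rewrite /knorm mulmx_ofZ detZ. Qed.

Lemma knorm_neq0 x : x != 0 -> knorm x != 0.
Proof.
move=> x0; apply/eqP => Nx; have := knormM x x^-1.
by rewrite divff // knorm1 Nx mul0r => /eqP; rewrite oner_eq0.
Qed.

Definition vK x : int := vQ (knorm x).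

Lemma vKM x y : x != 0 -> y != 0 -> vK (x * y) = vK x + vK y.
Proof. by move=> x0 y0; rewrite /vK knormM vQM ?knorm_neq0. Qed.

Lemma vK1 : vK 1 = 0.
Proof. by rewrite /vK knorm1 vQ1. Qed.

Lemma vKV x : x != 0 -> vK x^-1 = - vK x.
Proof.
move=> x0; apply/eqP; rewrite -subr_eq0 opprK addrC -vKM ?invr_eq0 //.
by rewrite divff //; apply/eqP; exact: vK1.
Qed.

Lemma vKX x k : x != 0 -> vK (x ^+ k) = vK x * k%:Z.
Proof.
move=> x0; elim: k => [|k IHk]; first by rewrite expr0 mulr0; exact: vK1.
by rewrite exprS vKM ?expf_neq0 // IHk -addn1 PoszD; ring.
Qed.

Lemma vKZ e x : x != 0 -> vK (P ^ e *: x) = e * n%:Z + vK x.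
Proof.
move=> x0; rewrite /vK knormZ vQM ?expf_neq0 ?expfz_neq0 ?embP0 ?knorm_neq0 //.
by rewrite vQX ?expfz_neq0 ?embP0 // vQ_expP.
Qed.

(* The element with integral coordinates c. *)
Definition latelt (c : 'rV[Zp]_n) : K := r2v (map_mx emb c).

Definition primitive (c : 'rV[Zp]_n) := exists i, (c 0 i) 1%N != 0.

Lemma latelt_inj : injective latelt.
Proof.
move=> c d /r2v_inj /rowP cd; apply/rowP => i; have := cd i; rewrite !mxE.
exact: emb_inj.
Qed.

Lemma latelt_lin a c d : latelt (a *: c + d) = emb a *: latelt c + latelt d.
Proof. by rewrite /latelt -linearP map_mxD map_mxZ. Qed.

Lemma dim_gt0 : (0 < n)%N.
Proof.
rewrite lt0n; apply/eqP => n0; have /eqP := oner_neq0 K; apply.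
apply: (can_inj v2rK); apply/rowP => i; exfalso.
by move: i; rewrite n0 => -[].
Qed.

Lemma latelt_scale x : exists D c, P ^+ D *: x = latelt c.
Proof.
have [D DP] := common_denominator (fun i => v2r x 0 i).
have [c cP] := choice DP; exists D, (\row_i c i).
apply: (can_inj v2rK); rewrite r2vK linearZ /=; apply/rowP => i.
by rewrite !mxE cP.
Qed.

Lemma primitive_scale x : x != 0 -> exists e c, primitive c /\ x = P ^ e *: latelt c.
Proof.
move=> x0; have [D [c cE]] := latelt_scale x.
have c0 : c != 0.
  apply/eqP => c0; move: cE; rewrite c0 /latelt map_mx0 linear0 => /eqP.
  by rewrite scaler_eq0 (negbTE x0) orbF expf_eq0 (negbTE (embP0 p_pr)) andbF.
have ex : exists k, [exists i, (c 0 i) k != 0].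
  apply: contrapT => /forallNP nk; case/eqP: c0; apply/rowP => i; rewrite mxE.
  apply: padic_eq => k; rewrite residue0; apply/eqP.
  by have /negP := nk k; rewrite negb_exists => /forallP /(_ i); rewrite negbK.
case: (ex_minnP ex) => -[|k] /existsP [i0 i0P] kmin.
  by case/negP: i0P; rewrite -(residue_modz _ 0) expn0 modz1.
have dvd i : exists d, c 0 i = p%:R ^+ k * d.
  apply/padic_dvdP/eqP; apply: contraT => ik; suff : (k.+1 <= k)%N by rewrite ltnn.
  by apply: kmin; apply/existsP; exists i.
have [d dP] := choice dvd; exists (k%:Z - D%:Z), (\row_i d i); split.
  exists i0; rewrite mxE; apply: contra i0P => /eqP/padic_dvdP [u uE].
  by apply/eqP/padic_dvdP; exists u; rewrite dP uE mulrA -exprD addn1.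
have -> : latelt (\row_i d i) = P ^- k *: latelt c.
  rewrite /latelt -linearZ; congr r2v; apply/rowP => i; rewrite !mxE dP tofracM tofracXn.
  by rewrite mulKf // expf_neq0 ?embP0.
rewrite -cE !scalerA expfzDr ?embP0 // -exprnP -exprnN.
by rewrite (mulrAC (P ^+ k)) divff ?expf_neq0 ?embP0 // mul1r mulVf ?expf_neq0 ?embP0 // scale1r.
Qed.

(* By compactness the norm is bounded away from 0 on primitive vectors. *)
Lemma knorm_primitive_bound : exists E : nat, forall c, primitive c -> vK (latelt c) <= E%:Z.
Proof.
pose M i := mulmx_of (r2v (delta_mx 0 i)).
have [A AP] := common_denominator (fun ijk : 'I_n * 'I_n * 'I_n => M ijk.1.1 ijk.1.2 ijk.2).
have [b bP] := choice AP.
pose B i : 'M[Zp]_n := \matrix_(j, k) b (i, j, k).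
pose D (c : 'rV[Zp]_n) := \det (\sum_i c 0 i *: B i).
have DE c : emb (D c) = P ^+ A ^+ n * knorm (latelt c).
  rewrite /D -det_map_mx -knormZ /knorm; congr (\det _).
  rewrite mulmx_ofZ /latelt; have -> : mulmx_of (r2v (map_mx emb c)) = \sum_i emb (c 0 i) *: M i.
    apply: mulmx_of_eq => y; rewrite -mulmx_ofE mulmx_sumr.
    rewrite [map_mx emb c]row_sum_delta linear_sum /=.
    rewrite (_ : mulmx_of _ = \sum_i emb (c 0 i) *: M i) ?mulmx_sumr //.
    elim/big_ind2: _ => [|_ x _ y' <- <-|i _].
    - by apply: mulmx_of_eq => z; rewrite mulmx0 mulr0 linear0.
    - by rewrite -[x + _]scale1r; rewrite scalerDr !scale1r -{1}[x]scale1r mulmx_of_lin scale1r.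
    - by rewrite linearZ /= mulmx_ofZ mxE.
  apply/matrixP => j k; rewrite mxE summxE rmorph_sum [RHS]mxE summxE mulr_sumr.
  apply: eq_bigr => i _; have /= bE := bP (i, j, k).
  by rewrite mxE [(_ *: M i) j k]mxE mulrCA bE mxE -tofracM.
have Dcong c d k : residues k c = residues k d -> residue (D c) k = residue (D d) k.
  move=> cd; rewrite /D /determinant.
  have RM (a a' e e' : Zp) : a k = a' k -> e k = e' k -> (a * e) k = (a' * e') k.
    by move=> aa ee; rewrite !residueM aa ee.
  have RD (a a' e e' : Zp) : a k = a' k -> e k = e' k -> (a + e) k = (a' + e') k.
    by move=> aa ee; rewrite !residueD aa ee.
  pose same (a b : Zp) := a k = b k.
  apply: (big_ind2 same) => [//|x1 x2 y1 y2|s _]; first exact: RD.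
  apply: (RM) => //; apply: (big_ind2 same) => [//|x1 x2 y1 y2|i _]; first exact: RM.
  rewrite !summxE; apply: (big_ind2 same) => [//|x1 x2 y1 y2|j _]; first exact: RD.
  by rewrite !mxE; apply: (RM) => //; have /rowP /(_ j) := cd; rewrite !mxE.
apply: contrapT => /forallNP nE.
have /choice [f fP] : forall E : nat, exists c, primitive c /\ E%:Z < vK (latelt c).
  move=> E; have /existsNP [c /not_implyP [cp /negP cE]] := nE E.
  by exists c; rewrite ltNge.
have [c cP] := padic_cluster f.
have cprim : primitive c.
  have [j _ /rowP jc] := cP 1%N; have [[i ij] _] := fP j.
  by exists i; have := jc i; rewrite !mxE => <-.
have prim0 d : primitive d -> latelt d != 0.
  move=> [i di]; apply: contra di => /eqP; rewrite -(_ : latelt 0 = 0) => [/latelt_inj ->|].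
    by rewrite mxE residue0.
  by rewrite /latelt map_mx0 linear0.
have D0 : D c = 0.
  apply: padic_eq => k; rewrite residue0; have [j kj jc] := cP k.
  rewrite -(Dcong _ _ _ jc); apply/padic_dvdP.
  have [fpr fE] := fP j; have f0 := prim0 _ fpr.
  have DN0 : emb (D (f j)) != 0 by rewrite DE mulf_neq0 ?expf_neq0 ?embP0 ?knorm_neq0.
  have vD : k%:Z <= vQ (emb (D (f j))).
    rewrite DE vQM ?expf_neq0 ?embP0 ?knorm_neq0 // -/(vK _) vQX ?expf_neq0 ?embP0 //.
    by rewrite exprnP vQ_expP; move: fE kj; nia.
  have : Zin (P ^- k * emb (D (f j))).
    apply/Zin_vQ; first by rewrite mulf_neq0 ?invr_neq0 ?expf_neq0 ?embP0.
    by rewrite vQM ?invr_neq0 ?expf_neq0 ?embP0 // vQV ?expf_neq0 ?embP0 // exprnP vQ_expP; lia.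
  case=> y yE; exists y; apply: (@emb_inj p p_pr).
  by rewrite tofracM tofracXn -yE mulVKf // expf_neq0 ?embP0.
have := DE c; rewrite D0 tofrac0 => /esym/eqP.
by apply/negP; rewrite mulf_neq0 ?expf_neq0 ?embP0 ?knorm_neq0 ?prim0.
Qed.

Lemma knorm_integral_bound : exists E : nat, forall x, x != 0 -> 0 <= vK x ->
  exists c, P ^+ E *: x = latelt c.
Proof.
have [E EP] := knorm_primitive_bound; exists E => x x0 vx.
have [e [c [cp xE]]] := primitive_scale x0.
have c0 : latelt c != 0 by apply: contra x0; rewrite xE => /eqP ->; rewrite scaler0.
have eE : 0 <= E%:Z + e.
  have := EP _ cp; have := dim_gt0; move: vx; rewrite xE vKZ //; nia.
exists (p%:R ^+ absz (E%:Z + e) *: c).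
rewrite -[_ *: c]addr0 latelt_lin /(latelt 0) map_mx0 linear0 addr0 tofracXn.
rewrite xE scalerA; congr (_ *: _); rewrite exprnP -expfzDr ?embP0 // exprnP.
by congr (_ ^ _); lia.
Qed.
End PadicField.

End ExtensionValuation.
Import ExtensionValuation.

Module IntegerRings.
Local Open Scope classical_set_scope.
Import VectorInternalTheory.

Lemma finite_range_code (T U : Type) (S : finType) (f : T -> U) (g : T -> S) (x0 : T) :
  (forall x y, g x = g y -> f x = f y) -> finite_set (range f).
Proof.
move=> fg.
have /choice [r rP] : forall s : S, exists x, forall y, g y = s -> g x = s.
  move=> s; have [[x xs]|ns] := pselect (exists x, g x = s); first by exists x.
  by exists x0 => y ys; case: ns; exists y.
apply: (sub_finite_set (B := (f \o r) @` [set: S])); last by apply: finite_image; exact: finite_finset.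
move=> _ [x _ <-]; exists (g x) => //=; apply: fg; exact: rP.
Qed.

Lemma mcoset_maximal (R : comNzRingType) (pi x y d : R) :
  (forall z : R, (exists w, z * w = 1) \/ (exists w, z = pi * w)) ->
  ~ (exists w, pi * w = 1) -> x - y = pi * d ->
  mcoset (@maximal_ideal R : set R^o) x = mcoset (@maximal_ideal R : set R^o) y.
Proof.
move=> dich npi xy.
have absorb (e v : R) : maximal_ideal v -> maximal_ideal (v + pi * e).
  move=> vm [w vw]; have [[v' vv']|[v' vE]] := dich v; first by apply: vm; exists v'.
  by apply: npi; exists ((v' + e) * w); rewrite mulrA mulrDr -vE.
apply/seteqP; split=> z; rewrite /mcoset /=.
  have -> : z - y = z - x + pi * d by rewrite -xy addrA subrK.
  exact: absorb.
have -> : z - x = z - y + pi * - d by rewrite mulrN -xy opprB addrA subrK.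
exact: absorb.
Qed.

Section Integrality.
Variables (p : nat) (p_pr : prime p).
Local Notation Zp := (padic_int p_pr).
Local Notation Qp := (padic p_pr).
Local Notation emb := (@tofrac Zp).
Local Notation P := (emb p%:R).

Lemma padic_is_uniformizer : is_uniformizer (p%:R : Zp).
Proof.
split; [exact: padic_dich|exact: p_nonunit| |].
  by move=> x /eqP; rewrite mulf_eq0 (negbTE (p_neq0 _)) => /eqP.
apply: (@finite_range_code _ _ 'I_p.+1 _ (fun x : Zp => inord (absz (x 1%N))) 0) => x y xy.
have xy1 : x 1%N = y 1%N.
  have := congr1 val xy; have /andP[x0 x1] := padic_residue_bound x 1.
  have /andP[y0 y1] := padic_residue_bound y 1.
  by rewrite expn1 in x1 y1; rewrite /= !inordK; lia.
have [d dE] : exists d, x - y = p%:R * d.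
  have [|d] := (padic_dvdP (x - y) 1).1; last by rewrite expr1; exists d.
  by rewrite residueD residueN modzDmr xy1 subrr mod0z.
exact: mcoset_maximal (@padic_dich _ _) (@p_nonunit _ _) dE.
Qed.

Variable K : fieldExtType Qp.
Implicit Types x y z : K.
Local Notation n := (dim K).
Local Notation integral := (integralOver (padic_int_embed K)).
Local Notation lat := (@latelt p p_pr K).

(* If x has nonnegative valuation, its powers have bounded denominators, and so the
   lattice of all vectors that stay integral under them is stable under x. *)
Lemma integral_of_vK x : x != 0 -> 0 <= vK x -> integral x.
Proof.
move=> x0 vx; have [E EP] := knorm_integral_bound K.
have [F [red [pP _]]] := residue_field_ex padic_is_uniformizer.
pose N : set 'rV[Zp]_n := [set c | forall j, exists d, lat c * x ^+ j = lat d].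
have lat0 : lat 0 = 0 by rewrite /latelt map_mx0 linear0.
have NP : is_submod N.
  split=> [j|a c d Nc Nd j]; first by exists 0; rewrite lat0 mul0r.
  have [c' cE] := Nc j; have [d' dE] := Nd j; exists (a *: c' + d').
  by rewrite !latelt_lin mulrDl -scalerAl cE dE.
have [A AP] : exists A, forall c d, exists e, P ^+ A *: (lat c * lat d) = lat e.
  have := common_denominator (fun ijk : 'I_n * 'I_n * 'I_n =>
    v2r (r2v (delta_mx 0 ijk.1.1) * r2v (delta_mx 0 ijk.1.2) : K) 0 ijk.2).
  case=> A /choice [b bP]; exists A => c d.
  exists (\sum_i \sum_j (c 0 i * d 0 j) *: \row_k b (i, j, k)).
  have latE (c' : 'rV[Zp]_n) : lat c' = \sum_i emb (c' 0 i) *: r2v (delta_mx 0 i).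
    rewrite /latelt [map_mx emb c']row_sum_delta linear_sum.
    by apply: eq_bigr => i _; rewrite linearZ mxE.
  have lat_sum (I : finType) (f : I -> 'rV[Zp]_n) : lat (\sum_i f i) = \sum_i lat (f i).
    apply: (big_morph (lat)) => // u v.
    by rewrite -[u]scale1r latelt_lin tofrac1 !scale1r.
  have lat_scale a (u : 'rV[Zp]_n) : lat (a *: u) = emb a *: lat u.
    by rewrite -[a *: u]addr0 latelt_lin lat0 addr0.
  rewrite lat_sum (latE c) mulr_suml scaler_sumr; apply: eq_bigr => i _.
  rewrite lat_sum (latE d) mulr_sumr scaler_sumr; apply: eq_bigr => j _.
  have -> : lat ((c 0 i * d 0 j) *: \row_k b (i, j, k)) =
      emb (c 0 i * d 0 j) *: (P ^+ A *: (r2v (delta_mx 0 i) * r2v (delta_mx 0 j))).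
    rewrite lat_scale; congr (_ *: _); apply: (can_inj v2rK); rewrite r2vK linearZ /=.
    by apply/rowP => k; rewrite !mxE -(bP (i, j, k)).
  rewrite -scalerAl -scalerAr !scalerA; congr (_ *: _).
  by rewrite tofracM [RHS]mulrC !mulrA.
have NK : forall c, N (p%:R ^+ (E + A) *: c).
  move=> c j; have [d dE] : exists d, P ^+ E *: x ^+ j = lat d.
    apply: EP; first exact: expf_neq0.
    by rewrite (vKX _ x0); apply: mulr_ge0.
  have [e eE] := AP c d; exists e; rewrite -eE -dE.
  rewrite -[_ *: c]addr0 latelt_lin lat0 addr0 tofracXn exprD.
  by rewrite -scalerAl -scalerAr !scalerA [P ^+ A * _]mulrC.
have [B [Binj BN]] := basis_ex pP NP NK.
have rowN i : N (row i B) by rewrite BN; exists (delta_mx 0 i) => //; rewrite rowE.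
have /choice [a aP] : forall i, exists w : 'rV[Zp]_n, lat (row i B) * x = lat (w *m B).
  move=> i; have [d dE] := rowN i 1%N; rewrite expr1 in dE.
  have : N d.
    move=> j; rewrite -dE -mulrA -exprS; exact: rowN.
  by rewrite BN => -[w _ wd]; exists w; rewrite dE wd.
pose C : 'M[Zp]_n := \matrix_i a i.
exists (char_poly C^T); first exact: char_poly_monic.
rewrite (map_char_poly (padic_int_embed K)) -eigenvalue_root_char.
apply/eigenvalueP; exists (\row_i lat (row i B)).
  apply/rowP => i; rewrite !mxE mulrC aP.
  have -> : a i *m B = \sum_j C i j *: row j B.
    by rewrite mulmx_sum_row; apply: eq_bigr => j _; rewrite mxE.
  rewrite (big_morph (lat) (id1 := 0) (op1 := +%R)) ?lat0 // => [|u v]; last first.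
    by rewrite -[u]scale1r latelt_lin tofrac1 !scale1r.
  apply: eq_bigr => j _; rewrite !mxE -[_ *: row j B]addr0 latelt_lin lat0 addr0.
  by rewrite /padic_int_embed /= mulr_algr.
apply/eqP => /rowP L0.
have : delta_mx 0 (Ordinal (dim_gt0 K)) = 0 :> 'rV[Zp]_n.
  apply: Binj; rewrite -rowE; apply: (@latelt_inj _ _ K); rewrite lat0.
  by have := L0 (Ordinal (dim_gt0 K)); rewrite !mxE.
move/rowP/(_ (Ordinal (dim_gt0 K))); rewrite !mxE !eqxx => /eqP.
by rewrite oner_eq0.
Qed.

Lemma p_inv_nonintegral : ~ integral ((P ^-1)%:A : K).
Proof.
case=> f fm; pose phi : {rmorphism Zp -> K} := padic_int_embed K; pose c := phi p%:R.
have phi_inj : injective phi.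
  by move=> u v /(fmorph_inj (in_alg K)) /(@emb_inj p p_pr).
have c0 : c != 0 by rewrite /c -(rmorph0 phi) (inj_eq phi_inj) p_neq0.
have -> : (P^-1)%:A = c^-1 :> K.
  by apply: (mulIf c0); rewrite mulVf // -scalerAl mul1r scalerA mulVf ?embP0 // scale1r.
move/rootP; set d := (size f).-1.
have sf : size f = d.+1 by rewrite /d prednK // lt0n size_poly_eq0 monic_neq0.
rewrite (@horner_coef_wide _ d.+1); last by rewrite -sf size_poly.
move=> /(congr1 ( *%R^~ (c ^+ d))); rewrite mul0r mulr_suml.
have -> : \sum_(i < d.+1) (map_poly phi f)`_i * c^-1 ^+ i * c ^+ d =
    phi (\sum_(i < d.+1) f`_i * p%:R ^+ (d - i)).
  rewrite rmorph_sum; apply: eq_bigr => i _.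
  rewrite coef_map rmorphM rmorphXn -mulrA -/c; congr (_ * _).
  have id : (i <= d)%N by rewrite -ltnS.
  apply: (mulfI (expf_neq0 i c0)); rewrite exprVn mulrA divff ?expf_neq0 // mul1r.
  by rewrite -exprD subnKC.
move/eqP; rewrite -(rmorph0 phi) (inj_eq phi_inj) big_ord_recr /= subnn expr0 mulr1.
have -> : f`_d = 1 by move/monicP: fm; rewrite lead_coefE.
have [w ->] : exists w, \sum_(i < d) f`_i * p%:R ^+ (d - i) = p%:R * w.
  exists (\sum_(i < d) f`_i * p%:R ^+ (d - i).-1); rewrite mulr_sumr.
  by apply: eq_bigr => i _; rewrite mulrCA -exprS prednK // subn_gt0.
rewrite addr_eq0 => /eqP e; apply: (@p_nonunit _ p_pr); exists (- w).
by rewrite mulrN e opprK.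
Qed.

Lemma vK_of_integral x : x != 0 -> integral x -> 0 <= vK x.
Proof.
move=> x0 xi; rewrite leNgt; apply/negP => vx; apply: p_inv_nonintegral.
pose y := x^-1; have y0 : y != 0 by rewrite invr_eq0.
have zi : integral (P ^ (-1) *: y ^+ n).
  apply: integral_of_vK; first by rewrite scaler_eq0 negb_or expfz_neq0 ?embP0 ?expf_neq0.
  by rewrite vKZ ?expf_neq0 // vKX // vKV //; nia.
have : integral (P ^ (-1) *: y ^+ n * x ^+ n).
  apply: integral_mul => //; elim: (n) => [|k IHk]; first exact: integral1.
  by rewrite exprS; exact: integral_mul.
by rewrite -scalerAl -exprMn mulVf // expr1n exprN1.
Qed.

Local Notation o := (integer_ring K).

Lemma integer_ring_lift x : integral x -> exists a : o, integer_val a = x.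
Proof.
move=> xi; have xP : x \in @integral_pred p p_pr K by apply/asboolP.
by exists (IntegerRing xP).
Qed.

Lemma integer_ring_integral (a : o) : integral (integer_val a).
Proof. by case: a => a /= /asboolP. Qed.

Lemma integer_val_inj (a b : o) : integer_val a = integer_val b -> a = b.
Proof. exact: val_inj. Qed.

Let val0 : integer_val (0 : o) = 0.
Proof. exact: (rmorph0 (val : o -> K)). Qed.
Let val1 : integer_val (1 : o) = 1.
Proof. exact: (rmorph1 (val : o -> K)). Qed.
Let valM (a b : o) : integer_val (a * b) = integer_val a * integer_val b.
Proof. exact: (rmorphM (val : o -> K)). Qed.
Let valB (a b : o) : integer_val (a - b) = integer_val a - integer_val b.
Proof. exact: (rmorphB (val : o -> K)). Qed.

Lemma integer_ring_is_uniformizer : exists pi : o, is_uniformizer pi.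
Proof.
have iv x : x != 0 -> 0 <= vK x -> exists a : o, integer_val a = x.
  by move=> x0 vx; apply: integer_ring_lift; exact: integral_of_vK.
have vi (a : o) : integer_val a != 0 -> 0 <= vK (integer_val a).
  by move=> a0; apply: vK_of_integral => //; exact: integer_ring_integral.
have PA0 : P ^ 1 *: 1 != 0 :> K by rewrite scaler_eq0 negb_or expfz_neq0 ?embP0 ?oner_neq0.
have vP : vK (P ^ 1 *: 1 : K) = n%:Z by rewrite vKZ ?oner_neq0 // vK1 addr0 mul1r.
have ex : exists k : nat, `[< (0 < k)%N /\ exists a : o, integer_val a != 0 /\ vK (integer_val a) = k%:Z >].
  exists n; apply/asboolP; split; first exact: dim_gt0.
  by have [|a aE] := iv _ PA0; [rewrite vP|exists a; rewrite aE].
case: (ex_minnP ex) => k /asboolP [k0 [pi [pi0 vpi]]] kmin; exists pi.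
have dvd (a : o) : integer_val a = 0 \/ k%:Z <= vK (integer_val a) -> exists b, a = pi * b.
  have [a0 _|a0] := eqVneq (integer_val a) 0.
    by exists 0; apply: integer_val_inj; rewrite valM val0 mulr0.
  case=> [/eqP|ka]; first by rewrite (negbTE a0).
  have [||b bE] := iv (integer_val a / integer_val pi).
  - by rewrite mulf_neq0 ?invr_neq0.
  - by rewrite vKM ?invr_neq0 // vKV // vpi; lia.
  by exists b; apply: integer_val_inj; rewrite valM bE mulrC divfK.
have dich (a : o) : (exists b, a * b = 1) \/ (exists b, a = pi * b).
  have [a0|a0] := eqVneq (integer_val a) 0; first by right; apply: dvd; left.
  have [va|va] := eqVneq (vK (integer_val a)) 0; last first.
    right; apply: dvd; right; have := vi _ a0; case vE : (vK (integer_val a)) => [m|//] _.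
    rewrite lez_nat; apply: kmin; apply/asboolP; split; last by exists a.
    by rewrite lt0n; apply: contra va => /eqP m0; rewrite vE m0.
  left; have [||b bE] := iv (integer_val a)^-1.
  - by rewrite invr_neq0.
  - by rewrite vKV // va oppr0.
  by exists b; apply: integer_val_inj; rewrite valM bE val1 divff.
have npi : ~ exists b, pi * b = 1.
  case=> b /(congr1 (@integer_val _ _ _)); rewrite valM val1 => e.
  have b0 : integer_val b != 0.
    by apply: contra_eq_neq e => ->; rewrite mulr0 eq_sym oner_neq0.
  have := congr1 (@vK p p_pr K) e; rewrite vKM // vpi vK1; have := vi _ b0; lia.
split=> //.
  move=> a /(congr1 (@integer_val _ _ _)); rewrite valM val0 => /eqP.
  by rewrite mulf_eq0 (negbTE pi0) => /eqP a0; apply: integer_val_inj; rewrite a0 val0.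
have [E EP] := knorm_integral_bound K.
have lat0 : lat 0 = 0 by rewrite /latelt map_mx0 linear0.
have [A AP] : exists A : nat, forall c, exists a : o, integer_val a = P ^+ A *: lat c.
  have [A vA] : exists A : nat, forall i : 'I_n, 0 <= A%:Z * n%:Z + vK (lat (delta_mx 0 i)).
    exists (\sum_(i < n) absz (vK (lat (delta_mx 0%R i))))%N => i.
    rewrite (bigD1 i) //=; have := dim_gt0 K; nia.
  exists A => c; have -> : P ^+ A *: lat c = \sum_(i < n) (emb (c 0 i))%:A * (P ^ A%:Z *: lat (delta_mx 0 i)).
    rewrite {1}[c]row_sum_delta (big_morph lat (id1 := 0) (op1 := +%R)) ?lat0 // => [|u v]; last first.
      by rewrite -[u]scale1r latelt_lin tofrac1 !scale1r.
    rewrite scaler_sumr; apply: eq_bigr => i _.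
    rewrite -[_ *: delta_mx _ _]addr0 latelt_lin lat0 addr0 mulr_algl !scalerA.
    by rewrite mulrC exprnP.
  apply: integer_ring_lift; elim/big_ind: _ => [|u v ui vi'|i _].
  - exact: mxpoly.integral0.
  - by have := integral_sub ui (integral_sub (mxpoly.integral0 _) vi'); rewrite sub0r opprK.
  apply: integral_mul; first exact: (integral_id (padic_int_embed K)).
  have d0 : lat (delta_mx 0 i) != 0.
    rewrite -lat0; apply/eqP => /(@latelt_inj p p_pr K)/rowP/(_ i); rewrite !mxE !eqxx => /eqP.
    by rewrite oner_eq0.
  apply: integral_of_vK; first by rewrite scaler_eq0 negb_or expfz_neq0 ?embP0.
  by rewrite vKZ.
have latP (a : o) : exists c, P ^+ E *: integer_val a = lat c.
  have [->|a0] := eqVneq (integer_val a) 0; first by exists 0; rewrite lat0 scaler0.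
  by apply: EP => //; exact: vi.
have /choice [c cP] := latP.
pose N := (E + A + 1)%N.
pose code (a : o) : {ffun 'I_n -> 'I_(p ^ N).+1} := [ffun i => inord (absz (c a 0 i N))].
apply: (@finite_range_code _ _ _ _ code 0) => a b /ffunP ab.
have [e eE] : exists e, c a - c b = p%:R ^+ N *: e.
  have : forall i, exists e, (c a - c b) 0 i = p%:R ^+ N * e.
    move=> i; apply/padic_dvdP; have := congr1 val (ab i); rewrite !ffunE /= !mxE.
    have /andP[x0 x1] := padic_residue_bound (c a 0 i) N.
    have /andP[y0 y1] := padic_residue_bound (c b 0 i) N.
    rewrite !inordK; [|lia|lia] => abE.
    have -> : c a 0 i = c a 0 i - c b 0 i + c b 0 i by rewrite subrK.
    rewrite addrK residueD residueN modzDmr.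
    have -> : residue (c a 0 i) N = residue (c b 0 i) N by lia.
    by rewrite subrr mod0z.
  by case/choice => e eP; exists (\row_i e i); apply/rowP => i; rewrite eP !mxE.
have [d dE] := AP e.
have [|pP pPE] := iv _ PA0; first by rewrite vP.
have [|g gE] := dvd pP.
  right; rewrite pPE vP lez_nat; apply: kmin; apply/asboolP; split; first exact: dim_gt0.
  by exists pP; rewrite pPE.
apply: (mcoset_maximal (d := g * d) dich npi); rewrite mulrA -gE.
apply: integer_val_inj; rewrite valB valM pPE dE.
apply: (scalerI (expf_neq0 E (embP0 p_pr))).
have -> : P ^+ E *: (integer_val a - integer_val b) = lat (c a - c b).
  have -> : c a - c b = -1 *: c b + c a by rewrite scaleN1r addrC.
  by rewrite latelt_lin tofracN tofrac1 scaleN1r scalerBr !cP addrC.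
rewrite eE -[_ *: e]addr0 latelt_lin lat0 addr0 tofracXn -scalerAl mul1r !scalerA.
by congr (_ *: _); rewrite exprD exprD expr1z expr1 [RHS]mulrAC.
Qed.
End Integrality.

End IntegerRings.
Import IntegerRings.

Module FreeNilpotent.
Local Open Scope classical_set_scope.
Local Open Scope quotient_scope.

Section FreeLieTheory.
Variables (R : comNzRingType) (X : Type).
Local Notation pi := (\pi_({eq_quot (lie_equiv R X)}) : lie_term R X -> free_lie R X).

Let repr_pi t : lie_eqv (repr (pi t)) t.
Proof. by apply/free_lieP; rewrite reprK. Qed.

Lemma pi_add t u : pi (LieAdd t u) = pi t + pi u.
Proof. by apply/esym/free_lieP; apply: lie_eqv_add; exact: repr_pi. Qed.
Lemma pi_opp t : pi (LieOpp t) = - pi t.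
Proof. by apply/esym/free_lieP; apply: lie_eqv_opp; exact: repr_pi. Qed.
Lemma pi_scale a t : pi (LieScale a t) = a *: pi t.
Proof. by apply/esym/free_lieP; apply: lie_eqv_scale; exact: repr_pi. Qed.
Lemma pi_lie t u : pi (LieBracket t u) = lie (pi t) (pi u).
Proof. by apply/esym/free_lieP; apply: lie_eqv_bracket; exact: repr_pi. Qed.

Lemma free_lie_gen_ind (P : free_lie R X -> Prop) :
  (forall i, P (free_lie_gen R i)) -> P 0 -> (forall x y, P x -> P y -> P (x + y)) ->
  (forall a x, P x -> P (a *: x)) -> (forall x y, P x -> P y -> P (lie x y)) ->
  forall x, P x.
Proof.
move=> Pg P0 PD PZ PL; elim/free_lie_ind; elim=> [i||t Pt u Pu|t Pt|a t Pt|t Pt u Pu].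
- exact: Pg.
- exact: P0.
- by rewrite pi_add; exact: PD.
- by rewrite pi_opp -scaleN1r; exact: PZ.
- by rewrite pi_scale; exact: PZ.
- by rewrite pi_lie; exact: PL.
Qed.
End FreeLieTheory.

Section Lift.
Variables (c d : nat) (R : comNzRingType) (M : lieAlgType R) (g : 'I_d -> M).

Fixpoint term_eval (t : lie_term int 'I_d) : M :=
  match t with
  | LieGen i => g i
  | LieZero => 0
  | LieAdd t u => term_eval t + term_eval u
  | LieOpp t => - term_eval t
  | LieScale a t => a%:~R *: term_eval t
  | LieBracket t u => lie (term_eval t) (term_eval u)
  end.

Lemma term_eval_eqv t u : lie_eqv t u -> term_eval t = term_eval u.
Proof.
elim=> //= {t u}.
- by move=> t u v _ -> _ ->.
- by move=> t t' u u' _ -> _ ->.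
- by move=> t t' _ ->.
- by move=> a t t' _ ->.
- by move=> t t' u u' _ -> _ ->.
- by move=> t u v; rewrite addrA.
- by move=> t u; rewrite addrC.
- by move=> t; rewrite add0r.
- by move=> t; rewrite addNr.
- by move=> a b t; rewrite scalerA intrM.
- by move=> t; rewrite scale1r.
- by move=> a t u; rewrite scalerDr.
- by move=> a b t; rewrite intrD scalerDl.
- by move=> a t u v; rewrite lie_linearl.
- by move=> a t u v; rewrite lie_linearr.
- by move=> t; rewrite liexx.
- by move=> t u v; rewrite lie_jacobi.
Qed.

Let phi0 (x : free_lie int 'I_d) : M := term_eval (repr x).

Let phi0_pi t : phi0 (\pi_({eq_quot (lie_equiv int 'I_d)}) t : free_lie int 'I_d) = term_eval t.
Proof. by apply: term_eval_eqv; apply/free_lieP; rewrite reprK. Qed.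

Let phi00 : phi0 0 = 0.
Proof. exact: phi0_pi. Qed.
Let phi0D x y : phi0 (x + y) = phi0 x + phi0 y.
Proof. exact: phi0_pi. Qed.
Let phi0Z a x : phi0 (a *: x) = a%:~R *: phi0 x.
Proof. exact: phi0_pi. Qed.
Let phi0L x y : phi0 (lie x y) = lie (phi0 x) (phi0 y).
Proof. exact: phi0_pi. Qed.

Let phi0_lcs n x : lcs_set n x -> lcs_set n (phi0 x).
Proof.
elim: n x => // n IHn x; pose P := [set x | lcs_set n.+1 (phi0 x)].
suff : lcs_set n.+1 `<=` P by apply.
apply: lspan_min => [|_ [y ny [z _ <-]]].
  split=> [|a y z Py Pz]; rewrite /P /=.
    by rewrite phi00; case: (lcs_submod M n.+1).
  by rewrite phi0D phi0Z; case: (lcs_submod M n.+1) => _; apply.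
by rewrite /P /= phi0L; apply: lie_lcs; exact: IHn.
Qed.

Hypothesis Mc : forall x : M, lcs_set c x -> x = 0.

Let phi1 (A : free_nilpotent_lie c d) : M := phi0 (coset_rep A).

Let cls (x : free_lie int 'I_d) : free_nilpotent_lie c d :=
  coset_class (full_submod (free_lie int 'I_d)) (lcs (free_lie int 'I_d) c) x.

Let phi1_cls x : phi1 (cls x) = phi0 x.
Proof.
have /phi0_lcs/Mc : lcs_set c (coset_rep (cls x) - x) by exact: (rep_class (lcs (free_lie int 'I_d) c)).
rewrite phi0D -scaleN1r phi0Z rmorphN1 scaleN1r => /eqP.
by rewrite subr_eq0 => /eqP.
Qed.

Let phi1D x y : phi1 (x + y) = phi1 x + phi1 y.
Proof. by rewrite [LHS]phi1_cls phi0D. Qed.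
Let phi1Z (a : int) x : phi1 (a *: x) = a%:~R *: phi1 x.
Proof. by rewrite [LHS]phi1_cls phi0Z. Qed.
Let phi1L x y : phi1 (lie x y) = lie (phi1 x) (phi1 y).
Proof. by rewrite [LHS]phi1_cls phi0L. Qed.

Local Notation L := (base_change (free_nilpotent_lie c d) R).

Definition nilpotent_gen i : L := pure_tensor (cls (free_lie_gen int i)) 1.

Let phi (x : L) : M := tensor_lift (fun x r => r *: phi1 x) x.

Let bilin : (forall x y r, r *: phi1 (x + y) = r *: phi1 x + r *: phi1 y) /\
  ((forall x (r s : R), (r + s) *: phi1 x = r *: phi1 x + s *: phi1 x) /\
  forall (n : int) x (r : R), r *: phi1 (n *: x) = (n%:~R * r) *: phi1 x).
Proof.
split=> [x y r|]; first by rewrite phi1D scalerDr.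
by split=> [x r s|n x r]; [rewrite scalerDl|rewrite phi1Z scalerA mulrC].
Qed.

Let phiP x r : phi (pure_tensor x r) = r *: phi1 x.
Proof. by case: bilin => h1 [h2 h3]; rewrite /phi tensor_lift_pure. Qed.
Let phiD x y : phi (x + y) = phi x + phi y.
Proof. by case: bilin => h1 [h2 h3]; rewrite /phi tensor_liftD. Qed.

Lemma nilpotent_lift : exists f : L -> M,
  [/\ forall a x y, f (a *: x + y) = a *: f x + f y,
      forall x y, f (lie x y) = lie (f x) (f y) & forall i, f (nilpotent_gen i) = g i].
Proof.
exists phi; split.
- move=> a x y; rewrite phiD; congr (_ + _).
  elim/base_change_ind: x => [x r|x x' IHx IHx']; last by rewrite scalerDr !phiD IHx IHx' scalerDr.
  by rewrite [a *: _]scale_pure !phiP scalerA.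
- move=> x y; elim/base_change_ind: x => [x r|x x' IHx IHx']; last by rewrite lieDl !phiD IHx IHx' lieDl.
  elim/base_change_ind: y => [y s|y y' IHy IHy']; last by rewrite lieDr !phiD IHy IHy' lieDr.
  by rewrite [lie (pure_tensor _ _) _]lie_pure !phiP phi1L lieZl lieZr scalerA.
by move=> i; rewrite phiP scale1r phi1_cls; exact: phi0_pi.
Qed.
End Lift.

End FreeNilpotent.
Import FreeNilpotent.

Module Triangular.
Local Open Scope classical_set_scope.

(* The Lie algebra of strictly upper triangular 4 x 4 matrices. A row lists the
   entries 12, 23, 34, then 13, 24, then 14. *)
Section Unitriangular.
Variable R : comNzRingType.

Definition triangular := 'rV[R]_6.
HB.instance Definition _ := GRing.Lmodule.on triangular.

Implicit Types x y z : triangular.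

Definition entry x k : R := x 0 (inord k).

Definition triangular_lie x y : triangular :=
  \row_i nth 0 [:: 0; 0; 0; entry x 0 * entry y 1 - entry y 0 * entry x 1;
    entry x 1 * entry y 2 - entry y 1 * entry x 2;
    entry x 0 * entry y 4 - entry y 0 * entry x 4 + (entry x 3 * entry y 2 - entry y 3 * entry x 2)] i.

Lemma entry_lin k x y i : entry (k *: x + y) i = k * entry x i + entry y i.
Proof. by rewrite /entry !mxE. Qed.
Lemma entryD x y i : entry (x + y) i = entry x i + entry y i.
Proof. by rewrite /entry !mxE. Qed.
Lemma entry0 i : entry 0 i = 0.
Proof. by rewrite /entry mxE. Qed.

Lemma entryP x y : (forall i, (i < 6)%N -> entry x i = entry y i) -> x = y.
Proof.
by move=> xy; apply/rowP => i; have := xy i (ltn_ord i); rewrite /entry inord_val.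
Qed.

Lemma entry_lie x y i : (i < 6)%N -> entry (triangular_lie x y) i =
  nth 0 [:: 0; 0; 0; entry x 0 * entry y 1 - entry y 0 * entry x 1;
    entry x 1 * entry y 2 - entry y 1 * entry x 2;
    entry x 0 * entry y 4 - entry y 0 * entry x 4 + (entry x 3 * entry y 2 - entry y 3 * entry x 2)] i.
Proof. by move=> i6; rewrite {1}/entry mxE inordK. Qed.

Fact triangular_linearl k x y z :
  triangular_lie (k *: x + y) z = k *: triangular_lie x z + triangular_lie y z.
Proof.
apply: entryP => i i6; rewrite entry_lin !entry_lie // !entry_lin.
by do 6![case: i i6 => [|i] i6 /=; first by ring].
Qed.

Fact triangular_linearr k x y z :
  triangular_lie z (k *: x + y) = k *: triangular_lie z x + triangular_lie z y.
Proof.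
apply: entryP => i i6; rewrite entry_lin !entry_lie // !entry_lin.
by do 6![case: i i6 => [|i] i6 /=; first by ring].
Qed.

Fact triangular_xx x : triangular_lie x x = 0.
Proof.
apply: entryP => i i6; rewrite entry_lie // entry0.
by do 6![case: i i6 => [|i] i6 /=; first by ring].
Qed.

Fact triangular_jacobi x y z :
  triangular_lie x (triangular_lie y z) + triangular_lie y (triangular_lie z x) +
  triangular_lie z (triangular_lie x y) = 0.
Proof.
apply: entryP => i i6; rewrite !entryD !entry_lie // entry0 /=.
by do 6![case: i i6 => [|i] i6 /=; first by ring].
Qed.

HB.instance Definition _ := Lmodule_isLie.Build R triangular
  triangular_linearl triangular_linearr triangular_xx triangular_jacobi.

Lemma entry_bracket x y i : (i < 6)%N -> entry (lie x y) i =
  nth 0 [:: 0; 0; 0; entry x 0 * entry y 1 - entry y 0 * entry x 1;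
    entry x 1 * entry y 2 - entry y 1 * entry x 2;
    entry x 0 * entry y 4 - entry y 0 * entry x 4 + (entry x 3 * entry y 2 - entry y 3 * entry x 2)] i.
Proof. exact: entry_lie. Qed.

Lemma triangular_lcs n m x : (n, m) \in [:: (1, 3); (2, 5); (3, 6)]%N ->
  lcs_set n x -> forall i, (i < m)%N -> entry x i = 0.
Proof.
have sub k : is_submod [set x : triangular | forall i, (i < k)%N -> entry x i = 0].
  split=> [i _|a u v u0 v0 i ik]; first exact: entry0.
  by rewrite entry_lin u0 // v0 // mulr0 addr0.
have step n' m' k : (forall x, lcs_set n' x -> forall i, (i < m')%N -> entry x i = 0) ->
    (forall u v : triangular, (forall i, (i < m')%N -> entry u i = 0) ->
       forall i, (i < k)%N -> entry (lie u v) i = 0) ->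
    forall x, lcs_set n'.+1 x -> forall i, (i < k)%N -> entry x i = 0.
  move=> IH uv y; move: y; rewrite -/(lcs_set n'.+1 `<=` _); apply: lspan_min (sub k) _.
  by move=> _ [u /IH u0 [v _ <-]]; exact: uv.
have H1 : forall x, lcs_set 1 x -> forall i, (i < 3)%N -> entry x i = 0.
  apply: (step 0%N 0%N) => // u v _ i i3; rewrite entry_bracket ?(ltn_trans i3) //.
  by case: i i3 => [|[|[|]]].
have H2 : forall x, lcs_set 2 x -> forall i, (i < 5)%N -> entry x i = 0.
  apply: (step 1%N 3%N) => // u v u0 i i5; rewrite entry_bracket ?(ltn_trans i5) //.
  by rewrite (u0 0%N) // (u0 1%N) // (u0 2%N) //; case: i i5 => [|[|[|[|[|]]]]] //= _; ring.
have H3 : forall x, lcs_set 3 x -> forall i, (i < 6)%N -> entry x i = 0.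
  apply: (step 2%N 5%N) => // u v u0 i i6; rewrite entry_bracket //.
  rewrite (u0 0%N) // (u0 1%N) // (u0 2%N) // (u0 3%N) // (u0 4%N) //.
  by case: i i6 => [|[|[|[|[|[|]]]]]] //= _; ring.
by rewrite !inE => /or3P [] /eqP [-> ->]; auto.
Qed.

Lemma triangular_nilpotent x : lcs_set 3 x -> x = 0.
Proof.
move=> x3; apply: entryP => i i6; rewrite entry0.
exact: (@triangular_lcs 3 6).
Qed.
End Unitriangular.

End Triangular.
Import Triangular.

Module LowerCentralSeries.
Local Open Scope classical_set_scope.

Lemma big_ord3 (V : nmodType) (f : 'I_3 -> V) : \sum_i f i = f 0 + f 1 + f 2%:R.
Proof.
rewrite !big_ord_recl big_ord0 addr0 addrA.
by congr (f _ + f _ + f _); exact: val_inj.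
Qed.

Lemma ord3D : [/\ (0 + 1 = 1 :> 'I_3), (0 + 2%:R = 2%:R :> 'I_3), (1 + 1 = 2%:R :> 'I_3),
  (1 + 2%:R = 0 :> 'I_3) & (2%:R + 1 = 0 :> 'I_3) /\ (2%:R + 2%:R = 1 :> 'I_3)].
Proof. by split; rewrite ?add0r //; try split; exact: val_inj. Qed.

Lemma class_lie (R : comNzRingType) (L : lieAlgType R) (I : lie_ideal L) (x y : L) :
  coset_class (full_submod L) I (lie x y) =
  lie (coset_class (full_submod L) I x : lie_quotient I) (coset_class (full_submod L) I y : lie_quotient I).
Proof.
apply/esym/classP => //; set z := coset_rep _; set w := coset_rep _.
rewrite -(subrKA (lie x w)) -lieNl -lieDl -lieNr -lieDr; apply: submodD.
  by apply: idealP; exact: rep_class.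
by rewrite lieC; apply: submodN; apply: idealP; exact: rep_class.
Qed.

Section LowerCentralSeries.
Variable R : comNzRingType.
Local Notation L := (base_change (free_nilpotent_lie 3 3) R).
Local Notation e := (@nilpotent_gen 3 3 R).

Definition comm2 (i : 'I_3) : L := lie (e (i + 1)) (e (i + 2%:R)).

Definition lin1 (x : 'rV[R]_3) : L := \sum_i x 0 i *: e i.
Definition lin2 (u : 'rV[R]_3) : L := \sum_i u 0 i *: comm2 i.
Definition lin3 (w : 'rV[R]_(3 * 3)) : L := \sum_i \sum_j vec_mx w i j *: lie (comm2 j) (e i).

Lemma lin1P a x y : lin1 (a *: x + y) = a *: lin1 x + lin1 y.
Proof.
rewrite /lin1 scaler_sumr -big_split; apply: eq_bigr => i _.
by rewrite !mxE scalerDl scalerA.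
Qed.

Lemma lin2P a x y : lin2 (a *: x + y) = a *: lin2 x + lin2 y.
Proof.
rewrite /lin2 scaler_sumr -big_split; apply: eq_bigr => i _.
by rewrite !mxE scalerDl scalerA.
Qed.

Lemma lin3P a x y : lin3 (a *: x + y) = a *: lin3 x + lin3 y.
Proof.
rewrite /lin3 scaler_sumr -big_split; apply: eq_bigr => i _.
rewrite scaler_sumr -big_split; apply: eq_bigr => j _.
by rewrite linearP !mxE scalerDl scalerA.
Qed.

Lemma lin1_0 : lin1 0 = 0.
Proof. by rewrite /lin1 big1 // => i _; rewrite mxE scale0r. Qed.
Lemma lin2_0 : lin2 0 = 0.
Proof. by rewrite /lin2 big1 // => i _; rewrite mxE scale0r. Qed.
Lemma lin3_0 : lin3 0 = 0.
Proof. by have := lin3P (-1) 0 0; rewrite scaler0 addr0 scaleN1r addNr. Qed.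

Lemma lie_lin1 x y : lie (lin1 x) (lin1 y) = lin2 (cross x y).
Proof.
rewrite lie_suml /lin2 !big_ord3 !crossE; have [-> -> -> -> [-> ->]] := ord3D.
rewrite !lie_sumr !big_ord3 /comm2; have [-> -> -> -> [-> ->]] := ord3D.
rewrite !(lieZl, lieZr) !liexx (lieC (e 1) (e 0)) (lieC (e 0) (e 2%:R)) (lieC (e 2%:R) (e 1)).
rewrite !(scaler0, add0r, addr0, scalerN) !scalerBl !scalerA.
by rewrite [LHS](AC (2*2*2) ((4*6)*(5*2)*(1*3))).
Qed.

Lemma lie_lin2 u x : lie (lin2 u) (lin1 x) = lin3 (mxvec (x^T *m u)).
Proof.
rewrite /lin3 mxvecK lie_sumr; apply: eq_bigr => i _.
rewrite lie_suml; apply: eq_bigr => j _.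
by rewrite lieZl lieZr scalerA mxE big_ord1 mxE mulrC.
Qed.

Lemma lin3_scalar c : lin3 (mxvec c%:M) = 0.
Proof.
rewrite /lin3 mxvecK; transitivity (c *: \sum_i lie (comm2 i) (e i)).
  rewrite scaler_sumr; apply: eq_bigr => i _; rewrite (bigD1 i) //= mxE eqxx big1 ?addr0 //.
  by move=> j; rewrite eq_sym => /negbTE ji; rewrite mxE ji scale0r.
rewrite big_ord3 /comm2; have [-> -> -> -> [-> ->]] := ord3D.
rewrite !(lieC (lie _ _)) -!opprD.
by rewrite lie_jacobi oppr0 scaler0.
Qed.

Lemma span1 (x : L) : exists a, lcs L 1 (x - lin1 a).
Proof.
elim/base_change_ind: x => [x r|x y [a Ha] [b Hb]]; last first.
  exists (a + b); rewrite -[a]scale1r lin1P scale1r opprD addrACA; exact: (submodD (N := lcs L _)).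
elim/subquotient_ind: x => x _.
pose cls x : free_nilpotent_lie 3 3 := coset_class (full_submod (free_lie int 'I_3)) (lcs (free_lie int 'I_3) 3) x.
pose P x := exists a, lcs L 1 (pure_tensor (cls x) 1 - lin1 a).
rewrite -/(cls x); have rE s y : pure_tensor y s = s *: pure_tensor y 1 :> L.
  by rewrite [RHS]scale_pure mulr1.
suff [a Ha] : P x.
  exists (r *: a); rewrite rE -[r *: a]addr0 lin1P lin1_0 addr0 -scalerBr; exact: submodZ.
elim/free_lie_gen_ind: x {r}.
- move=> i; exists (\row_j (j == i)%:R); rewrite /lin1 (bigD1 i) //= mxE eqxx scale1r.
  rewrite big1 ?addr0 ?subrr => [|j /negbTE ji]; first exact: (submod0 (lcs L 1)).
  by rewrite mxE ji scale0r.
- by exists 0; rewrite lin1_0 subr0 /cls class0 pure_tensor0l; exact: (submod0 (lcs L _)).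
- move=> x y [a Ha] [b Hb]; exists (1 *: a + b); rewrite lin1P scale1r /cls classD // pure_tensorDl.
  by rewrite opprD addrACA; exact: (submodD (N := lcs L _)).
- move=> n x [a Ha]; exists (n%:~R *: a + 0); rewrite lin1P lin1_0 addr0 /cls classZ // pure_tensorZ mulr1.
  by rewrite rE -scalerBr; exact: submodZ.
move=> x y _ _; exists 0; rewrite lin1_0 subr0.
have -> : pure_tensor (cls (lie x y)) 1 = lie (pure_tensor (cls x) 1) (pure_tensor (cls y) 1) :> L.
  by rewrite [RHS]lie_pure mulr1 /cls class_lie.
exact: lie_lcs.
Qed.

Lemma span2 (x : L) : lcs L 1 x -> exists u, lcs L 2 (x - lin2 u).
Proof.
pose P := [set x : L | exists u, lcs L 2 (x - lin2 u)].
suff : lcs L 1 `<=` P by apply.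
apply: lspan_min => [|_ [y _ [z _ <-]]].
  split=> [|a y z [u Hu] [v Hv]].
    by exists 0; rewrite lin2_0 subr0; exact: (submod0 (lcs L _)).
  exists (a *: u + v); rewrite lin2P opprD addrACA -scalerBr.
  by apply: submodD => //; exact: submodZ.
have [a Ha] := span1 y; have [b Hb] := span1 z.
exists (cross a b); rewrite -lie_lin1 -(subrKA (lie (lin1 a) z)) -lieNl -lieDl -lieNr -lieDr.
apply: submodD; first exact: lie_lcs.
by rewrite lieC; apply: submodN; exact: lie_lcs.
Qed.

Lemma span3 (x : L) : lcs L 2 x -> exists w, lcs L 3 (x - lin3 w).
Proof.
pose P := [set x : L | exists w, lcs L 3 (x - lin3 w)].
suff : lcs L 2 `<=` P by apply.
apply: lspan_min => [|_ [y y1 [z _ <-]]].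
  split=> [|a y z [u Hu] [v Hv]].
    by exists 0; rewrite lin3_0 subr0; exact: (submod0 (lcs L _)).
  exists (a *: u + v); rewrite lin3P opprD addrACA -scalerBr.
  by apply: submodD => //; exact: submodZ.
have [u Hu] := span2 y1; have [b Hb] := span1 z.
exists (mxvec (b^T *m u)); rewrite -lie_lin2.
rewrite -(subrKA (lie y (lin1 b))) -lieNr -lieDr -lieNl -lieDl.
apply: submodD; last exact: lie_lcs.
exact: (@lie_lcs2 _ _ 1 1).
Qed.

Lemma hom_sum (V : lmodType R) (f : L -> V) : (forall r x y, f (r *: x + y) = r *: f x + f y) ->
  forall (z : 'I_3 -> R) (g : 'I_3 -> L), f (\sum_i z i *: g i) = \sum_i z i *: f (g i).
Proof.
move=> fP z g; have f0 : f 0 = 0.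
  by have := fP (-1) 0 0; rewrite scaler0 addr0 scaleN1r addNr.
have fZ r x : f (r *: x) = r *: f x by rewrite -[r *: x]addr0 fP f0 addr0.
have fD x y : f (x + y) = f x + f y by have := fP 1 x y; rewrite !scale1r.
by rewrite !big_ord3 !fD !fZ.
Qed.

Lemma hom_sum1 (V : lmodType R) (f : L -> V) : (forall r x y, f (r *: x + y) = r *: f x + f y) ->
  forall (g : 'I_3 -> L), f (\sum_i g i) = \sum_i f (g i).
Proof.
move=> fP g; have := hom_sum fP (fun=> 1) g.
by rewrite !big_ord3 !scale1r.
Qed.

Lemma entry_sum (f : 'I_3 -> triangular R) k : entry (\sum_i f i) k = \sum_i entry (f i) k.
Proof. by rewrite /entry summxE. Qed.

Lemma entryZ r (x : triangular R) k : entry (r *: x) k = r * entry x k.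
Proof. by rewrite /entry mxE. Qed.

Section Detection.
Variables a b c : 'I_3 -> R.

Definition detect_gen i : triangular R := \row_k nth 0 [:: a i; b i; c i] k.

Lemma entry_gen i k : (k < 6)%N -> entry (detect_gen i) k = nth 0 [:: a i; b i; c i] k.
Proof. by move=> k6; rewrite /entry mxE inordK. Qed.

Lemma detect_ex : exists f : L -> triangular R,
  [/\ forall n x, lcs L n x -> lcs_set n (f x),
     forall r x y, f (r *: x + y) = r *: f x + f y,
     forall x y, f (lie x y) = lie (f x) (f y) & forall i, f (e i) = detect_gen i].
Proof.
have [f [fP fL fe]] := nilpotent_lift detect_gen (@triangular_nilpotent R).
exists f; split=> //; elim=> // n IHn x.
pose P := [set x | lcs_set n.+1 (f x)].
suff : lcs L n.+1 `<=` P by apply.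
have [M0 MD] := lcs_submod (triangular R) n.+1.
apply: lspan_min => [|_ [y ny [z _ <-]]].
  split=> [|r y z Py Pz]; rewrite /P /=; last by rewrite fP; exact: MD.
  have := fP (-1) 0 0; rewrite scaler0 addr0 scaleN1r addNr => ->; exact: M0.
by rewrite /P /= fL; apply: lie_lcs; exact: IHn.
Qed.

End Detection.

Lemma lin1_lcs x : lcs L 1 (lin1 x) <-> x = 0.
Proof.
split=> [x1|->]; last by rewrite lin1_0; exact: (submod0 (lcs L _)).
apply/rowP => i; rewrite mxE.
have [f [flcs fP _ fe]] := detect_ex (fun j => (j == i)%:R) (fun=> 0) (fun=> 0).
have := @triangular_lcs _ 1 3 _ isT (flcs _ _ x1) 0 isT.
rewrite /lin1 hom_sum // entry_sum (bigD1 i) //= fe !entryZ entry_gen //= eqxx mulr1 big1 ?addr0 //.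
by move=> j /negbTE ji; rewrite fe entryZ entry_gen //= ji mulr0.
Qed.

Lemma lin2_lcs u : lcs L 2 (lin2 u) <-> u = 0.
Proof.
split=> [u2|->]; last by rewrite lin2_0; exact: (submod0 (lcs L _)).
apply/rowP => i; rewrite mxE.
have [f [flcs fP fL fe]] := detect_ex (fun j => (j == i + 1)%:R) (fun j => (j == i + 2%:R)%:R) (fun=> 0).
have := @triangular_lcs _ 2 5 _ isT (flcs _ _ u2) 3 isT.
rewrite /lin2 hom_sum // entry_sum (bigD1 i) //= entryZ fL entry_bracket //= !fe !entry_gen //=.
rewrite !eqxx !(inj_eq (addrI i)) /= mulr1 mul0r subr0 mulr1 big1 ?addr0 // => j ji.
rewrite entryZ fL entry_bracket //= !fe !entry_gen //= !(inj_eq (addIr _)) (negbTE ji) mul0r.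
suff /negbTE nE : ~~ ((j + 2%:R == i + 1) && (j + 1 == i + 2%:R)) by rewrite -natrM mulnb nE subrr mulr0.
by case: i j ji {fe} => -[|[|[|i]]] // i3 [] [|[|[|j]]] // j3.
Qed.

Lemma lin3_form w (a b c : 'I_3 -> R) : lcs L 3 (lin3 w) ->
  \sum_i \sum_j vec_mx w i j * ((a (j + 1) * b (j + 2%:R) - a (j + 2%:R) * b (j + 1)) * c i -
     a i * (b (j + 1) * c (j + 2%:R) - b (j + 2%:R) * c (j + 1))) = 0.
Proof.
move=> w3; have [f [flcs fP fL fe]] := detect_ex a b c.
have := @triangular_lcs _ 3 6 _ isT (flcs _ _ w3) 5 isT.
rewrite /lin3 hom_sum1 // entry_sum => E; rewrite -[RHS]E; apply: eq_bigr => i _.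
rewrite hom_sum // entry_sum; apply: eq_bigr => j _.
rewrite entryZ !fL !entry_bracket //= !fe !entry_gen //=; ring.
Qed.

Lemma lin3_lcs w : lcs L 3 (lin3 w) <-> exists c, w = mxvec c%:M.
Proof.
split=> [w3|[c ->]]; last by rewrite lin3_scalar; exact: (submod0 (lcs L _)).
have := fun a0 a1 a2 b0 b1 b2 c0 c1 c2 => @lin3_form w
  (fun i => if i == 0 then a0 else if i == 1 then a1 else a2)
  (fun i => if i == 0 then b0 else if i == 1 then b1 else b2)
  (fun i => if i == 0 then c0 else if i == 1 then c1 else c2) w3.
have [n1 n2] : ((1 : 'I_3) == 0) = false /\ ((2%:R : 'I_3) == 0) = false by [].
have n3 : ((2%:R : 'I_3) == 1) = false by [].
rewrite /= => H.
pose W i j := vec_mx w i j.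
have {}H a0 a1 a2 b0 b1 b2 c0 c1 c2 : 
  W 0 0 * ((a1 * b2 - a2 * b1) * c0 - a0 * (b1 * c2 - b2 * c1)) +
  W 0 1 * ((a2 * b0 - a0 * b2) * c0 - a0 * (b2 * c0 - b0 * c2)) +
  W 0 2%:R * ((a0 * b1 - a1 * b0) * c0 - a0 * (b0 * c1 - b1 * c0)) +
  (W 1 0 * ((a1 * b2 - a2 * b1) * c1 - a1 * (b1 * c2 - b2 * c1)) +
  W 1 1 * ((a2 * b0 - a0 * b2) * c1 - a1 * (b2 * c0 - b0 * c2)) +
  W 1 2%:R * ((a0 * b1 - a1 * b0) * c1 - a1 * (b0 * c1 - b1 * c0))) +
  (W 2%:R 0 * ((a1 * b2 - a2 * b1) * c2 - a2 * (b1 * c2 - b2 * c1)) +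
  W 2%:R 1 * ((a2 * b0 - a0 * b2) * c2 - a2 * (b2 * c0 - b0 * c2)) +
  W 2%:R 2%:R * ((a0 * b1 - a1 * b0) * c2 - a2 * (b0 * c1 - b1 * c0))) = 0.
  have := H a0 a1 a2 b0 b1 b2 c0 c1 c2; rewrite !big_ord3; have [-> -> -> -> [-> ->]] := ord3D.
  by rewrite !eqxx n1 n2 n3.
have W01 : W 0 1 = 0 by rewrite -[RHS](H 0 0 1 1 0 0 1 0 0); ring.
have W02 : W 0 2%:R = 0.
  by apply/eqP; rewrite -oppr_eq0; apply/eqP; rewrite -[RHS](H 0 1 0 1 0 0 1 0 0); ring.
have W10 : W 1 0 = 0.
  by apply/eqP; rewrite -oppr_eq0; apply/eqP; rewrite -[RHS](H 0 0 1 0 1 0 0 1 0); ring.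
have W12 : W 1 2%:R = 0 by rewrite -[RHS](H 1 0 0 0 1 0 0 1 0); ring.
have W20 : W 2%:R 0 = 0 by rewrite -[RHS](H 0 1 0 0 0 1 0 0 1); ring.
have W21 : W 2%:R 1 = 0.
  by apply/eqP; rewrite -oppr_eq0; apply/eqP; rewrite -[RHS](H 1 0 0 0 0 1 0 0 1); ring.
have W22 : W 2%:R 2%:R = W 0 0.
  by apply/eqP; rewrite -subr_eq0; apply/eqP; rewrite -[RHS](H 1 0 0 0 1 0 0 0 1); ring.
have W11 : W 1 1 = W 0 0.
  by apply/eqP; rewrite eq_sym -subr_eq0; apply/eqP; rewrite -[RHS](H 0 1 0 0 0 1 1 0 0); ring.
exists (W 0 0); rewrite -[LHS]vec_mxK; congr mxvec; apply/matrixP => i j.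
have ord3P (k : 'I_3) : [\/ k = 0, k = 1 | k = 2%:R].
  case: k => -[|[|[|k]]] // k3; [constructor 1|constructor 2|constructor 3]; exact: val_inj.
rewrite -[LHS]/(W i j) [RHS]mxE; case: (ord3P i) => ->; case: (ord3P j) => ->.
all: by rewrite ?W11 ?W22 ?(W01, W02, W10, W12, W20, W21) //= ?eqxx ?n1 ?n2 ?n3 1?eq_sym ?n1 ?n2 ?n3.
Qed.
End LowerCentralSeries.

End LowerCentralSeries.
Import LowerCentralSeries.

Module GradedAlgebra.
Local Open Scope classical_set_scope.

Section Graded.
Variable R : comNzRingType.
Local Notation L := (base_change (free_nilpotent_lie 3 3) R).
Local Notation G := (gr L 3).
Local Notation triple := ('rV[R]_3 * 'rV[R]_3 * 'rV[R]_(3 * 3))%type.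

Definition layer (T : triple) (i : nat) : L := nth 0 [:: lin1 T.1.1; lin2 T.1.2; lin3 T.2] i.

Definition gr_coord (T : triple) : G := fun i => coset_class (lcs L i) (lcs L i.+1) (layer T i).

Lemma layer_lcs T i : (i < 3)%N -> lcs L i (layer T i).
Proof.
case: i => [|[|[|i]]] //= _; rewrite /layer /=.
  apply: (submod_sum (N := lcs L 1)) => i _; apply: (submodZ (N := lcs L 1)).
  exact: (@lie_lcs2 _ _ 0 0).
apply: (submod_sum (N := lcs L 2)) => i _; apply: (submod_sum (N := lcs L 2)) => j _.
apply: (submodZ (N := lcs L 2)); apply: (@lie_lcs2 _ _ 1 0) => //.
exact: (@lie_lcs2 _ _ 0 0).
Qed.

Lemma layerP a (T T' : triple) i : layer (a *: T + T') i = a *: layer T i + layer T' i.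
Proof.
case: i => [|[|[|i]]]; rewrite /layer /= ?lin1P ?lin2P ?lin3P //.
by rewrite !nth_nil scaler0 addr0.
Qed.

Lemma gr_coordP a (T T' : triple) : gr_coord (a *: T + T') = a *: gr_coord T + gr_coord T'.
Proof.
apply: grP => i; rewrite grDE grZE /gr_coord layerP classD ?classZ //; try exact: layer_lcs.
by apply: (submodZ (N := lcs L i)); exact: layer_lcs.
Qed.

Lemma gr_coord0 : gr_coord 0 = 0.
Proof. by have := gr_coordP (-1) 0 0; rewrite scaler0 addr0 scaleN1r addNr. Qed.
Lemma gr_coordB (T T' : triple) : gr_coord (T - T') = gr_coord T - gr_coord T'.
Proof. by rewrite addrC -scaleN1r gr_coordP scaleN1r addrC. Qed.
Lemma gr_coordD (T T' : triple) : gr_coord (T + T') = gr_coord T + gr_coord T'.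
Proof. by have := gr_coordP 1 T T'; rewrite !scale1r. Qed.

Lemma gr_coord_surj a : exists T, gr_coord T = a.
Proof.
have in_lcs (i : 'I_3) : lcs L i (coset_rep (a i)) by exact: rep_in.
have [x Hx] := span1 (coset_rep (a ord0)).
have [u Hu] := span2 (in_lcs (Ordinal (isT : 1 < 3)%N)).
have [w Hw] := span3 (in_lcs (Ordinal (isT : 2 < 3)%N)).
exists (x, u, w); apply: grP => i; rewrite -[RHS]repK /gr_coord; apply/classP.
- exact: layer_lcs.
- exact: in_lcs.
rewrite -opprB; apply: (submodN (N := lcs L i.+1)).
case: i => -[|[|[|i]]] // i3.
- by rewrite (_ : Ordinal i3 = ord0) //; exact: val_inj.
- by rewrite (_ : Ordinal i3 = Ordinal (isT : 1 < 3)%N) //; exact: val_inj.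
- by rewrite (_ : Ordinal i3 = Ordinal (isT : 2 < 3)%N) //; exact: val_inj.
Qed.

Lemma gr_coord_eq0 T : gr_coord T = 0 <->
  [/\ T.1.1 = 0, T.1.2 = 0 & exists c, T.2 = mxvec c%:M].
Proof.
have zero (i : 'I_3) : gr_coord T i = 0 <-> lcs L i.+1 (layer T i).
  rewrite -class0 classP ?subr0 //; [exact: layer_lcs|exact: submod0].
split=> [T0|[T1 T2 [c T3]]].
  have {zero}T0 (i : 'I_3) : lcs L i.+1 (layer T i) by apply/zero; rewrite T0.
  split; [apply/lin1_lcs|apply/lin2_lcs|apply/lin3_lcs].
  - exact: (T0 ord0).
  - exact: (T0 (Ordinal (isT : 1 < 3)%N)).
  - exact: (T0 (Ordinal (isT : 2 < 3)%N)).
apply: grP => i; apply/zero; case: i => -[|[|[|i]]] // i3; rewrite /layer /=.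
- by apply/lin1_lcs.
- by apply/lin2_lcs.
- by apply/lin3_lcs; exists c.
Qed.

Lemma gr_coord_part i T : gr_part i (gr_coord T) =
  gr_coord (if val i is 0%N then (T.1.1, 0, 0) else if val i is 1%N then (0, T.1.2, 0) else (0, 0, T.2)).
Proof.
apply: grP => j; rewrite /gr_part /gr_coord.
have c0 x : x = 0 -> 0 = coset_class (lcs L j) (lcs L j.+1) x by move=> ->.
case: i j c0 => -[|[|[|i]]] // i3 [] [|[|[|j]]] // j3 c0; rewrite /layer //=;
  by apply: c0; rewrite ?lin1_0 ?lin2_0 ?lin3_0.
Qed.

Lemma gr_coord_lie T T' : lie (gr_coord T) (gr_coord T') =
  gr_coord (0, cross T.1.1 T'.1.1, mxvec (T'.1.1^T *m T.1.2) - mxvec (T.1.1^T *m T'.1.2)).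
Proof.
apply: grP => k; rewrite [LHS]/(gr_lie _ _ _) /gr_lie.
pose t i j := coset_class (lcs L k) (lcs L k.+1) (lie (layer T i) (layer T' j)).
have tE (i j : 'I_3) : (i + j).+1 = k :> nat ->
    coset_class (lcs L k) (lcs L k.+1) (lie (coset_rep (gr_coord T i)) (coset_rep (gr_coord T' j))) = t i j.
  move=> ijk; have lcsk m n x : m = n -> lcs L m x -> lcs L n x by move=> ->.
  have Ti := layer_lcs T (ltn_ord i); have Tj := layer_lcs T' (ltn_ord j).
  apply/classP; try by apply: (lcsk _ _ _ ijk); apply: lie_lcs2 => //; exact: rep_in.
  set a := coset_rep _; set b := coset_rep _.
  rewrite -(subrKA (lie (layer T i) b)) -lieNl -lieDl -lieNr -lieDr.
  apply: (submodD (N := lcs L k.+1)).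
    apply: (lcsk (i.+1 + j).+1); first by rewrite addSn ijk.
    by apply: lie_lcs2; [exact: rep_class|exact: rep_in].
  apply: (lcsk (i + j.+1).+1); first by rewrite addnS ijk.
  by apply: lie_lcs2 => //; exact: rep_class.
transitivity (\sum_(i < 3) \sum_(j < 3 | (i + j).+1 == k) t i j).
  by apply: eq_bigr => i _; apply: eq_bigr => j /eqP; exact: tE.
have lcs2 x y : lcs L 2 (lie (lin2 x) (lin1 y)) by rewrite lie_lin2; exact: (@layer_lcs (0, 0, _) 2).
under eq_bigr do rewrite big_mkcond.
rewrite !big_ord_recl !big_ord0 {tE}/gr_coord /t {t}.
case: k => -[|[|[|k]]] // k3 /=; rewrite ?(add0r, addr0) /layer /=.
- by rewrite lin1_0.
- by rewrite lie_lin1.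
have -> : lin3 (mxvec (T'.1.1^T *m T.1.2) - mxvec (T.1.1^T *m T'.1.2)) =
    lie (lin1 T.1.1) (lin2 T'.1.2) + lie (lin2 T.1.2) (lin1 T'.1.1).
  by rewrite (addrC (mxvec _)) -scaleN1r lin3P -!lie_lin2 scaleN1r -lieC.
by rewrite classD // lieC; apply: (submodN (N := lcs L 2)).
Qed.

End Graded.

End GradedAlgebra.
Import GradedAlgebra.

Module GradedIdeals.
Local Open Scope classical_set_scope.

Section Correspondence.
Variable R : comNzRingType.
Local Notation L := (base_change (free_nilpotent_lie 3 3) R).
Local Notation G := (gr L 3).
Local Notation triple := ('rV[R]_3 * 'rV[R]_3 * 'rV[R]_(3 * 3))%type.
Implicit Types (T : lat3 R) (I : set G).

Definition lat_set T : set triple := [set t | [/\ T.1.1 t.1.1, T.1.2 t.1.2 & T.2 t.2]].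
Definition lat_gr T : set G := @gr_coord R @` lat_set T.
Definition gr_lat I : lat3 R :=
  ([set x | I (gr_coord (x, 0, 0))], [set u | I (gr_coord (0, u, 0))],
   [set w | I (gr_coord (0, 0, w))]).

Lemma lat_set_submod T : lat_ideal T -> is_submod (lat_set T).
Proof.
move=> [[a0 aD] [b0 bD] [c0 cD] _ _]; split=> // a x y [x1 x2 x3] [y1 y2 y3].
by split; [exact: aD|exact: bD|exact: cD].
Qed.

Lemma lat_ideal_scalar T c : lat_ideal T -> T.2 (mxvec c%:M).
Proof.
move=> [_ T2 T3 _ /br23_sub [] // T1M _].
by rewrite -scalemx1 linearZ; exact: submod_scale.
Qed.

Lemma lat_grE T t : lat_ideal T -> lat_gr T (gr_coord t) <-> lat_set T t.
Proof.
move=> TI; split=> [[t' Tt' /eqP]|Tt]; last by exists t.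
rewrite -subr_eq0 -gr_coordB => /eqP/gr_coord_eq0 [E1 E2 [c E3]].
have -> : t = t' + (-1) *: (t' - t) by rewrite scaleN1r opprB addrC subrK.
rewrite addrC; have [_] := lat_set_submod TI; apply=> //.
by split; rewrite ?E1 ?E2 ?E3; [case: TI => -[]|case: TI => _ []|exact: lat_ideal_scalar].
Qed.

Lemma cross_delta (i : 'I_3) :
  cross (delta_mx 0 (i + 1)) (delta_mx 0 (i + 2%:R)) = delta_mx 0 i :> 'rV[R]_3.
Proof.
apply/rowP => j; rewrite crossE !mxE /= !(inj_eq (addIr _)) -!natrM !mulnb andbb.
suff /negbTE -> : ~~ ((j + 2%:R == i + 1) && (j + 1 == i + 2%:R)) by rewrite subr0.
by case: i j => -[|[|[|i]]] // i3 [] [|[|[|j]]] // j3.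
Qed.

(* The bracket of the first layer of the ideal with the whole second layer lands in the
   third, by the Jacobi identity. *)
Lemma lat_ideal_bracket13 T x v : lat_ideal T -> T.1.1 x -> T.2 (mxvec (x^T *m v)).
Proof.
move=> TI Tx; have [T1 T2 T3 T12 T23] := TI.
have {}T12 := (br12_sub T1 T2).1 T12; have [_ {}T23] := (br23_sub T2 T3).1 T23.
have T2C a b : T.1.1 b -> T.1.2 (cross a b).
  move=> Tb; have -> : cross a b = (-1) *: cross b a.
    by apply/rowP => i; rewrite !mxE !big_ord1 !mxE; ring.
  by apply: submod_scale => //; exact: T12.
suff H y z : T.2 (mxvec (x^T *m cross y z)).
  rewrite [v]row_sum_delta mulmx_sumr linear_sum; apply: submod_bigsum => // i.
  by rewrite /= -scalemxAr linearZ /= -cross_delta; exact: submod_scale.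
have J : lin3 (mxvec (x^T *m cross y z) + mxvec (y^T *m cross z x) + mxvec (z^T *m cross x y)) = 0.
  have lin3D a b : lin3 (a + b) = lin3 a + lin3 b :> L by have := lin3P 1 a b; rewrite !scale1r.
  rewrite !lin3D -!lie_lin2 -!lie_lin1 !(lieC (lie _ _)) -!opprD lie_jacobi oppr0 //.
have [c cE] : exists c, mxvec (x^T *m cross y z) + mxvec (y^T *m cross z x) + mxvec (z^T *m cross x y) = mxvec c%:M.
  by apply/lin3_lcs; rewrite J; exact: (submod0 (lcs L 3)).
have -> : mxvec (x^T *m cross y z) = mxvec c%:M - (mxvec (y^T *m cross z x) + mxvec (z^T *m cross x y)).
  by rewrite -cE -(addrA (mxvec (x^T *m _))) addrK.
apply: submod_sub => //; first exact: lat_ideal_scalar.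
by apply: submod_add => //; apply: T23; [exact: T2C|exact: T12].
Qed.

Lemma lat_gr_ideal T : lat_ideal T -> is_lie_ideal (lat_gr T) /\ is_graded (lat_gr T).
Proof.
move=> TI; have [T1 T2 T3 T12 T23] := TI; split; first split.
- have [S0 SD] := lat_set_submod TI; split; first by exists 0 => //; exact: gr_coord0.
  by move=> a _ _ [x Tx <-] [y Ty <-]; exists (a *: x + y); [exact: SD|rewrite gr_coordP].
- move=> _ y [x [x1 x2 x3] <-]; have [z <-] := gr_coord_surj y; rewrite gr_coord_lie; apply/lat_grE => //.
  split=> /=; first by case: T1.
    exact: ((br12_sub T1 T2).1 T12).
  apply: submod_sub => //; last exact: lat_ideal_bracket13.
  by have [_] := (br23_sub T2 T3).1 T23; apply.
apply/seteqP; split=> a /=.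
  move=> [x [x1 x2 x3] <-] i; rewrite gr_coord_part; apply/lat_grE => //.
  by case: (val i) => [|[|k]]; split=> //=; [case: T2|case: T3|case: T1|case: T3|case: T1|case: T2].
have [x <-] := gr_coord_surj a => H; apply/lat_grE => //; split.
- by have := H ord0; rewrite gr_coord_part => /(lat_grE _ TI) [].
- by have := H (Ordinal (isT : 1 < 3)%N); rewrite gr_coord_part => /(lat_grE _ TI) [].
- by have := H (Ordinal (isT : 2 < 3)%N); rewrite gr_coord_part => /(lat_grE _ TI) [].
Qed.

Lemma gr_latK T : lat_ideal T -> gr_lat (lat_gr T) = T.
Proof.
move=> TI; have [T1 T2 T3 _ _] := TI; case: T TI T1 T2 T3 => -[M1 M2] M3 TI /= [T1 _] [T2 _] [T3 _].
congr (_, _, _); apply/seteqP; split=> x.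
- by move/(lat_grE _ TI) => [].
- by move=> Mx; apply/lat_grE.
- by move/(lat_grE _ TI) => [].
- by move=> Mx; apply/lat_grE.
- by move/(lat_grE _ TI) => [].
- by move=> Mx; apply/lat_grE.
Qed.

Lemma gr_lat_ideal I : is_lie_ideal I -> is_graded I -> lat_ideal (gr_lat I) /\ lat_gr (gr_lat I) = I.
Proof.
move=> [[I0 ID] IL] Igr.
have S1 : is_submod (gr_lat I).1.1.
  split=> [|a x y Ix Iy] /=; first by rewrite gr_coord0.
  by have := ID a _ _ Ix Iy; rewrite -gr_coordP; congr (I (gr_coord (_, _, _))); rewrite /= ?scaler0 ?addr0.
have S2 : is_submod (gr_lat I).1.2.
  split=> [|a x y Ix Iy] /=; first by rewrite gr_coord0.
  by have := ID a _ _ Ix Iy; rewrite -gr_coordP; congr (I (gr_coord (_, _, _))); rewrite /= ?scaler0 ?addr0.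
have S3 : is_submod (gr_lat I).2.
  split=> [|a x y Ix Iy] /=; first by rewrite gr_coord0.
  by have := ID a _ _ Ix Iy; rewrite -gr_coordP; congr (I (gr_coord (_, _, _))); rewrite /= ?scaler0 ?addr0.
have TI : lat_ideal (gr_lat I).
  split=> //.
    apply/br12_sub => // x y Ix; have := IL _ (gr_coord (y, 0, 0)) Ix.
    by rewrite gr_coord_lie /= !mulmx0 raddf0 subr0.
  apply/br23_sub => //; split.
    rewrite /= (_ : gr_coord _ = 0) //; apply/gr_coord_eq0; split=> //; by exists 1.
  move=> x y Ix; have := IL _ (gr_coord (y, 0, 0)) Ix.
  rewrite gr_coord_lie /= mulmx0 raddf0 subr0 (_ : cross 0 y = 0) //.
  by rewrite /cross mulmx0; apply/rowP => i; rewrite !mxE subrr.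
split=> //; rewrite [RHS]Igr; apply/seteqP; split=> a /=.
  move=> [x [x1 x2 x3] <-] i; rewrite gr_coord_part; by case: (val i) => [|[|k]].
have [x <-] := gr_coord_surj a => H; apply/lat_grE => //; split=> /=.
- by have := H ord0; rewrite gr_coord_part.
- by have := H (Ordinal (isT : 1 < 3)%N); rewrite gr_coord_part.
- by have := H (Ordinal (isT : 2 < 3)%N); rewrite gr_coord_part.
Qed.
End Correspondence.

Section Index.
Variables (o : comNzRingType) (pi : o) (F : finFieldType) (red : {rmorphism o -> F}).
Hypothesis piP : uniformizer pi red.
Local Notation L := (base_change (free_nilpotent_lie 3 3) o).

Lemma lat_gr_index (T : lat3 o) : lat_ideal T -> bounded pi T.1.1 ->
  finite_index (lat_gr T) /\ mod_index (lat_gr T) = (#|F| ^ colength3 F T)%N.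
Proof.
move=> TI B1; have [B2 B3] := lat_ideal_bounded TI B1; have [T1 T2 T3 _ _] := TI.
have [[Tsub _] _] := lat_gr_ideal TI.
apply: has_indexP => //.
have := has_index_prod (has_index_prod (colength_index piP T1 B1) (colength_index piP T2 B2))
  (colength_index piP T3 B3); rewrite -!expnD.
case=> S [f [fc fs fT]]; have [g gP] := choice (@gr_coord_surj o).
exists S, (f \o g); split=> //.
  move=> s; have [x xs] := fs s; exists (gr_coord x); rewrite /= -xs; apply/fT.
  have : lat_gr T (gr_coord (g (gr_coord x) - x)).
    rewrite gr_coordB gP subrr; case: Tsub => //.
  by move/(lat_grE _ TI) => [].
move=> x y; rewrite /= fT -[in lat_gr T _](gP x) -[in lat_gr T _](gP y) -gr_coordB lat_grE //.
by split=> [[[]]|[]].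
Qed.

Lemma finite_index_bounded (I : set (gr L 3)) : is_lie_ideal I -> is_graded I ->
  finite_index I -> bounded pi (gr_lat I).1.1.
Proof.
move=> IL Igr Ifin; have [TI IE] := gr_lat_ideal IL Igr.
have [T1 _ _ _ _] := TI; set M := (gr_lat I).1.1 in T1 *.
have each (j : 'I_3) : exists K, M (pi ^+ K *: delta_mx 0 j).
  pose h k := mcoset I (gr_coord (pi ^+ k *: delta_mx 0 j, 0, 0)).
  have [k [l [kl hkl]]] : exists k l, (k < l)%N /\ h k = h l.
    apply: contrapT => nex; apply: infinite_nat.
    have hinj : injective h.
      move=> k l hkl; apply/eqP; case: (ltngtP k l) => // kl; case: nex.
        by exists k, l.
      by exists l, k.
    have -> : [set: nat] = h @^-1` range (mcoset I).
      by apply/seteqP; split=> // k _; exists (gr_coord (pi ^+ k *: delta_mx 0 j, 0, 0)).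
    by apply: finite_preimage Ifin => k l _ _; exact: hinj.
  exists k; move: hkl => /(cosetP (Submod IL.1)) /=; rewrite -gr_coordB.
  have -> : (pi ^+ k *: delta_mx 0 j, 0, 0) - (pi ^+ l *: delta_mx 0 j, 0, 0) =
     ((1 - pi ^+ (l - k)) *: (pi ^+ k *: delta_mx 0 j), 0, 0) :> 'rV[o]_3 * 'rV[o]_3 * 'rV[o]_(3 * 3).
    congr (_, _, _); rewrite /= ?subr0 // scalerA mulrBl mul1r -exprD subnK ?scalerBl //; exact: ltnW.
  rewrite -/(M _) => Mu; have [v vE] : exists v, v * (1 - pi ^+ (l - k)) = 1.
    have [|v vE] := red_unit piP (x := 1 - pi ^+ (l - k)); last by exists v; rewrite mulrC.
    rewrite rmorphB rmorph1 rmorphXn (_ : red pi = 0) ?expr0n.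
      by rewrite subn_eq0 leqNgt kl subr0 oner_eq0.
    by apply/(red_ker piP); exists 1; rewrite mulr1.
  by have := submod_scale v T1 (Mu : M _); rewrite scalerA vE scale1r.
have [f fP] := choice each; exists (\sum_j f j)%N => x.
rewrite [x]row_sum_delta scaler_sumr; apply: submod_bigsum => // j.
rewrite (bigD1 j) //=; set r := (\sum_(i < 3 | _) _)%N.
have -> : pi ^+ (f j + r) *: (x 0 j *: delta_mx 0 j) =
    (pi ^+ r * x 0 j) *: (pi ^+ f j *: delta_mx 0 j) :> 'rV[o]_3.
  by rewrite !scalerA exprD; congr (_ *: _); ring.
exact: submod_scale.
Qed.
End Index.

End GradedIdeals.
Import GradedIdeals.

Module Expressions.
(* Polynomials in t: the coefficients, by increasing degree. *)
Definition tpoly := seq Z.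
(* Polynomials in q and t: the coefficients in q, by increasing degree. *)
Definition qtpoly := seq tpoly.

Fixpoint zip_with (T : Type) (f : T -> T -> T) (r s : seq T) : seq T :=
  match r, s with
  | [::], _ => s
  | _, [::] => r
  | a :: r', b :: s' => f a b :: zip_with f r' s'
  end.

Definition tadd : tpoly -> tpoly -> tpoly := zip_with Z.add.
Definition tscale (c : Z) : tpoly -> tpoly := map (Z.mul c).
Definition tshift b (r : tpoly) : tpoly := if r is [::] then [::] else nseq b Z0 ++ r.
Fixpoint tmul (r s : tpoly) : tpoly :=
  if r is a :: r' then tadd (tscale a s) (tshift 1 (tmul r' s)) else [::].

Definition qtadd : qtpoly -> qtpoly -> qtpoly := zip_with tadd.
Definition qtscale (c : Z) : qtpoly -> qtpoly := map (tscale c).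
Definition qtshift a b (l : qtpoly) : qtpoly := nseq a [::] ++ map (tshift b) l.
Fixpoint qtmul (l m : qtpoly) : qtpoly :=
  if l is r :: l' then qtadd (map (tmul r) m) (qtshift 1 0 (qtmul l' m)) else [::].

(* Multiplication by 1 - q^a t^b. *)
Definition qtmul1B (l : qtpoly) (e : nat * nat) : qtpoly :=
  qtadd l (qtscale (Zneg xH) (qtshift e.1 e.2 l)).
Definition qtmul1Bs := foldl qtmul1B.

Definition qtzero (l : qtpoly) : bool := all (all (Z.eqb Z0)) l.
Definition qteq (l m : qtpoly) : bool := qtzero (qtadd l (qtscale (Zneg xH) m)).

Definition qtconst (c : Z) : qtpoly := [:: [:: c]].
(* A polynomial in q alone. *)
Definition qpoly (s : seq Z) : qtpoly := [seq [:: c] | c <- s].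

(* The Gaussian binomial coefficient, by the q-Pascal rule. *)
Fixpoint zbinomial (n k : nat) : seq Z :=
  match n, k with
  | _, 0 => [:: Zpos xH]
  | 0, _.+1 => [::]
  | n'.+1, k'.+1 => tadd (zbinomial n' k') (tshift k (zbinomial n' k))
  end.

Definition zcount (rho u r : nat) : seq Z :=
  if r == rho then [:: Zpos xH]
  else if (u <= r < rho)%N then tshift (u * (rho - r)) (zbinomial (rho - u) (rho - r)) else [::].

(* Exact division by 1 - q^a t^b, as truncated power series. *)
Fixpoint tdiv1B b (prev : seq Z) (r : tpoly) : tpoly :=
  if r is c :: r' then
    let d := Z.add c (nth Z0 prev b.-1) in d :: tdiv1B b (d :: prev) r'
  else [::].
Fixpoint qtdiv1B_rec a b (prev l : qtpoly) : qtpoly :=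
  if l is r :: l' then
    let d := if a is a'.+1 then tadd r (tshift b (nth [::] prev a')) else tdiv1B b [::] r in
    d :: qtdiv1B_rec a b (d :: prev) l'
  else [::].
Definition qtdiv1B l (e : nat * nat) := qtdiv1B_rec e.1 e.2 [::] l.

Definition dens33 : seq (nat * nat) := [:: (0,1); (1,1); (2,1); (3,4); (1,5); (2,5); (0,6);
  (7,7); (8,7); (8,8); (12,8); (6,9); (15,9); (16,10); (15,11); (12,12); (7,13); (0,14)]%N.

Definition ztransition (a b : state) : seq Z :=
  tmul (tmul (zcount 3 b.1.1 a.1.1) (zcount (rk12 a.1.1) b.1.2 a.1.2)) (zcount (rk23 a.1.2) b.2 a.2).

Definition diag (a : state) : nat * nat := ((size (ztransition a a)).-1, size_state a).

Definition qmul (s : seq Z) (m : qtpoly) : qtpoly :=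
  foldr (fun c acc => qtadd (qtscale c m) (qtshift 1 0 acc)) [::] s.

Definition solve_step (acc : seq (state * qtpoly)) (a : state) :=
  let new := qtshift 0 (size_state a)
     (foldl (fun s x => qtadd s (qmul (ztransition a x.1) x.2)) [::] acc) in
  (a, new) :: [seq (x.1, qtmul1B x.2 (diag a)) | x <- acc].

Definition solution : seq (state * qtpoly) :=
  foldl solve_step [:: ((0, 0, 0)%N, qtconst (Zpos xH))] (behead states).
Definition total : qtpoly := foldl (fun s x => qtadd s x.2) [::] solution.
Definition total_dens := map diag (behead states).

Fixpoint trim (T : Type) (p : pred T) (s : seq T) : seq T :=
  if s is x :: s' then
    (let s'' := trim p s' in if s'' is [::] then if p x then [::] else [:: x] else x :: s'')
  else [::].
Definition pad k (r : tpoly) := r ++ nseq (k - size r) Z0.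

Definition rem_dens (d e : seq (nat * nat)) := foldl (fun d x => rem x d) d e.

Definition num33 : qtpoly :=
  let x := qtmul1Bs total (rem_dens dens33 total_dens) in
  let y := foldl qtdiv1B x (rem_dens total_dens dens33) in
  map (pad 109 \o trim (Z.eqb Z0)) (trim (all (Z.eqb Z0)) y).

(* (e, l, d) stands for the fraction l / (q^e times the product of the 1 - q^a t^b). *)
Definition qtfrac := (nat * qtpoly * seq (nat * nat))%type.
Definition fmul (f g : qtfrac) : qtfrac :=
  ((f.1.1 + g.1.1)%N, qtmul f.1.2 g.1.2, f.2 ++ g.2).
Definition fbinomial a b : qtfrac := ((b * (a - b))%N, qpoly (zbinomial a b), [::]).

Fixpoint igusa_num (fuel : nat) (L : seq (nat * nat)) : qtpoly :=
  let n := size L in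
  if fuel is fuel'.+1 then
    foldr (fun k acc =>
        let e := nth (0, 0)%N L k.-1 in
        qtadd (qtmul1Bs (qtshift (e.1 - k * (n - k)) e.2
            (qmul (zbinomial n k) (igusa_num fuel' (take k L)))) (drop k (take n.-1 L))) acc)
      (qtmul1Bs (qtconst (Zpos xH)) (take n.-1 L)) (iota 1 n.-1)
  else [::].

(* The exponents of q have to absorb the powers of q^-1 in the Gaussian binomials. *)
Definition igusa_ok (L : seq (nat * nat)) : bool :=
  all (fun k => k * (size L - k) <= (nth (0, 0) L k.-1).1)%N (iota 1 (size L).-1).

Definition figusa (L : seq (nat * nat)) : qtfrac := (0%N, igusa_num (size L) L, L).
Definition figusa_circ (L : seq (nat * nat)) : qtfrac :=
  let e := nth (0, 0)%N L (size L).-1 in (0%N, qtshift e.1 e.2 (igusa_num (size L) L), L).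

Definition xmon i : nat * nat := (i * (8 - i), 6 + i)%N.
Definition ymon i : nat * nat := (2 + i * (5 - i), 5 + i)%N.
Definition xmons a b := [seq xmon i | i <- index_iota a b.+1].
Definition ymons a b := [seq ymon i | i <- index_iota a b.+1].

Inductive qtexpr := QBin of nat & nat | QIgusa of seq (nat * nat) | QCirc of seq (nat * nat).
Definition qtexpr_frac (x : qtexpr) : qtfrac :=
  match x with
  | QBin a b => fbinomial a b | QIgusa L => figusa L | QCirc L => figusa_circ L
  end.

Definition W_A := [:: QIgusa [:: (2, 3); (2, 5); (0, 6)]%N; QIgusa (xmons 1 8)].
Definition W_B j := [:: QBin 5 j; QBin 3 1; QIgusa [:: (2, 3); (2, 5)]%N;
  QCirc (ymons 1 j); QIgusa [:: xmon j]; QIgusa (xmons j.+1 8)].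
Definition W_C1 := [:: QBin 3 1; QBin 2 1; QIgusa [:: (2, 3)]%N; QCirc [:: (3, 4)]%N;
  QIgusa [:: (6, 6); (7, 7)]%N; QIgusa (xmons 2 8)].
Definition W_C j := [:: QBin 4 j.-1; QBin 3 1; QBin 2 1; QBin 2 1; QIgusa [:: (2, 3)]%N;
  QCirc [:: (3, 4)]%N; QIgusa [:: (6, 6)]%N; QCirc (ymons 2 j); QIgusa [:: xmon j];
  QIgusa (xmons j.+1 8)].
Definition W_E1 := [:: QBin 3 1; QIgusa [:: (2, 3)]%N; QCirc [:: (3, 4); (2, 5)]%N;
  QIgusa [:: (8, 7); (12, 8)]%N; QIgusa (xmons 3 8)].
Definition W_E j := [:: QBin 3 j.-1; QBin 3 1; QBin 2 1; QIgusa [:: (2, 3)]%N;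
  QCirc [:: (3, 4); (2, 5)]%N; QIgusa [:: (8, 7)]%N; QCirc (ymons 3 j.+1);
  QIgusa [:: xmon j.+1]; QIgusa (xmons j.+2 8)].

Definition W_terms : seq (seq qtexpr) :=
  W_A :: map W_B (index_iota 1 6) ++ W_C1 :: map W_C (index_iota 2 6) ++
  W_E1 :: map W_E (index_iota 2 5).

Definition term_frac (x : seq qtexpr) : qtfrac :=
  foldr (fun y f => fmul (qtexpr_frac y) f) (0%N, qtconst (Zpos xH), [::]) x.

Definition W_dens : seq (nat * nat) :=
  [:: (2, 3); (3, 4); (2, 5); (0, 6)]%N ++ xmons 1 8 ++ ymons 1 5.

(* The numerator of the sum of the terms over q^8 times the product of W_dens. *)
Definition W_num : qtpoly :=
  foldr (fun x acc => let f := term_frac x in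
    qtadd (qtmul1Bs (qtshift (8 - f.1.1) 0 f.1.2) (rem_dens W_dens f.2)) acc) [::] W_terms.
Definition W_ok : bool := all (fun x => let f := term_frac x in
  (f.1.1 <= 8)%N && perm_eq W_dens (f.2 ++ rem_dens W_dens f.2)) W_terms.
Definition expr_ok (x : qtexpr) : bool :=
  match x with
  | QBin a b => (b <= a <= 8)%N
  | QIgusa L => igusa_ok L && (0 < size L)%N | QCirc L => igusa_ok L && (0 < size L)%N
  end.

End Expressions.
Import Expressions.

Module Evaluation.
Section Evaluation.
Variables (R : comNzRingType) (q t : R).

Definition zr (z : Z) : R := (int_of_Z z)%:~R.
Definition evz (x : R) (s : seq Z) : R := foldr (fun c v => zr c + x * v) 0 s.
Definition ev (l : qtpoly) : R := foldr (fun r v => evz t r + q * v) 0 l.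
Definition mon (e : nat * nat) : R := q ^+ e.1 * t ^+ e.2.
Definition den (d : seq (nat * nat)) : R := \prod_(e <- d) (1 - mon e).

Lemma zrD a b : zr (Z.add a b) = zr a + zr b.
Proof. by rewrite /zr -intrD -[Z.add a b]/(a + b) rmorphD. Qed.
Lemma zrM a b : zr (Z.mul a b) = zr a * zr b.
Proof. by rewrite /zr -intrM -[Z.mul a b]/(a * b) rmorphM. Qed.

Lemma evz_add x r s : evz x (tadd r s) = evz x r + evz x s.
Proof.
elim: r s => [|a r IHr] [|b s] /=; rewrite ?add0r ?addr0 //.
by rewrite -/(tadd r s) IHr zrD mulrDr addrACA.
Qed.

Lemma evz_scale x c s : evz x (tscale c s) = zr c * evz x s.
Proof. by elim: s => [|a s IHs] /=; rewrite ?mulr0 // IHs zrM mulrDr mulrCA. Qed.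

Lemma evz_shift x b s : evz x (tshift b s) = x ^+ b * evz x s.
Proof.
case: s => [|a s]; first by rewrite /= mulr0.
rewrite /tshift; elim: b => [|b IHb]; first by rewrite mul1r.
by rewrite /= IHb exprS -mulrA /zr /= add0r.
Qed.

Lemma evz_mul x r s : evz x (tmul r s) = evz x r * evz x s.
Proof.
elim: r => [|a r IHr] /=; first by rewrite mul0r.
by rewrite evz_add evz_scale evz_shift expr1 IHr mulrDl mulrA.
Qed.

Lemma ev_add l m : ev (qtadd l m) = ev l + ev m.
Proof.
elim: l m => [|a l IHl] [|b m] /=; rewrite ?add0r ?addr0 //.
by rewrite -/(qtadd l m) IHl evz_add mulrDr addrACA.
Qed.

Lemma ev_scale c l : ev (qtscale c l) = zr c * ev l.
Proof. by elim: l => [|a l IHl] /=; rewrite ?mulr0 // IHl evz_scale mulrDr mulrCA. Qed.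

Lemma ev_shift a b l : ev (qtshift a b l) = q ^+ a * t ^+ b * ev l.
Proof.
rewrite /qtshift; elim: a => [|a IHa] /=; last by rewrite IHa add0r exprS !mulrA.
by rewrite mul1r; elim: l => [|r l IHl] /=; rewrite ?mulr0 // IHl evz_shift mulrDr mulrCA.
Qed.

Lemma ev_tmul r l : ev (map (tmul r) l) = evz t r * ev l.
Proof. by elim: l => [|s l IHl] /=; rewrite ?mulr0 // IHl evz_mul mulrDr mulrCA. Qed.

Lemma ev_mul l m : ev (qtmul l m) = ev l * ev m.
Proof.
elim: l => [|r l IHl]; first by rewrite /= mul0r.
by rewrite [qtmul _ _]/= ev_add ev_tmul ev_shift IHl expr1 expr0 mulr1 mulrDl mulrA.
Qed.

Lemma ev_qmul s m : ev (qmul s m) = evz q s * ev m.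
Proof.
elim: s => [|c s IHs] /=; first by rewrite mul0r.
by rewrite ev_add ev_scale ev_shift IHs expr1 expr0 mulr1 mulrDl mulrA.
Qed.

Lemma ev_const c : ev (qtconst c) = zr c.
Proof. by rewrite /= !mulr0 !addr0. Qed.

Lemma ev_qpoly s : ev (qpoly s) = evz q s.
Proof. by elim: s => //= c s ->; rewrite mulr0 addr0. Qed.

Lemma ev_mul1B l e : ev (qtmul1B l e) = ev l * (1 - mon e).
Proof.
rewrite ev_add ev_scale ev_shift (_ : zr _ = -1) // mulrBr mulr1.
by rewrite mulN1r [ev l * _]mulrC.
Qed.

Lemma ev_mul1Bs l d : ev (qtmul1Bs l d) = ev l * den d.
Proof.
elim: d l => [|e d IHd] l /=; first by rewrite /den big_nil mulr1.
by rewrite IHd ev_mul1B /den big_cons mulrA.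
Qed.

Lemma den_cat d e : den (d ++ e) = den d * den e.
Proof. by rewrite /den big_cat. Qed.

Lemma den_perm d e : perm_eq d e -> den d = den e.
Proof. exact: perm_big. Qed.

Lemma qteq_ev l m : qteq l m -> ev l = ev m.
Proof.
have z0 k : qtzero k -> ev k = 0.
  elim: k => //= r k IHk /andP[r0 /IHk ->]; rewrite mulr0 addr0.
  elim: r r0 => //= -[|c|c] r IHr //= /IHr ->.
  by rewrite mulr0 addr0.
move/z0; rewrite ev_add ev_scale (_ : zr _ = -1) // mulN1r => /eqP.
by rewrite subr_eq0 => /eqP.
Qed.

Lemma zbinomialE n k : (k <= n)%N ->
  evz q (zbinomial n k) * \prod_(i < k) (q ^+ k - q ^+ i) = \prod_(i < k) (q ^+ n - q ^+ i).
Proof.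
pose f n k : R := \prod_(i < k) (q ^+ n - q ^+ i).
have fS m j : f m.+1 j.+1 = (q ^+ m.+1 - 1) * q ^+ j * f m j.
  rewrite /f big_ord_recl expr0 -mulrA; congr (_ * _).
  have -> : q ^+ j = \prod_(i < j) q by rewrite prodr_const card_ord.
  by rewrite -big_split; apply: eq_bigr => i _; rewrite /= !exprS mulrBr.
rewrite -!/(f _ _); elim: n k => [|n IHn] [|k] //=.
- by rewrite /f !big_ord0 mulr1 mulr0 addr0.
- by rewrite /f !big_ord0 mulr1 mulr0 addr0.
rewrite ltnS leq_eqVlt => /orP[/eqP ->|kn].
  rewrite evz_add evz_shift.
  have z0 m j : (m < j)%N -> zbinomial m j = [::].
    by elim: m j => [|m IHm] [|j] // mj; rewrite /= (IHm j) // (IHm j.+1) //; exact: leqW.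
  rewrite (z0 n n.+1) // mulr0 addr0 fS mulrCA IHn ?leqnn //.
have f1 : f n k.+1 = f n k * (q ^+ n - q ^+ k) by rewrite /f big_ord_recr.
rewrite evz_add evz_shift mulrDl -mulrA IHn // [in X in X + _]fS.
rewrite (mulrCA (evz q _)) IHn 1?ltnW // f1 fS !exprS; ring.
Qed.
End Evaluation.

Lemma evz_rmorph (R S : comNzRingType) (f : {rmorphism R -> S}) x s :
  f (evz x s) = evz (f x) s.
Proof. by elim: s => [|c s IHs] /=; rewrite ?rmorph0 // rmorphD rmorphM IHs rmorph_int. Qed.

Lemma ev_rmorph (R S : comNzRingType) (f : {rmorphism R -> S}) q t l :
  f (ev q t l) = ev (f q) (f t) l.
Proof. by elim: l => [|r l IHl] /=; rewrite ?rmorph0 // rmorphD rmorphM IHl evz_rmorph. Qed.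

Lemma mon_rmorph (R S : comNzRingType) (f : {rmorphism R -> S}) q t e :
  f (mon q t e) = mon (f q) (f t) e.
Proof. by rewrite rmorphM !rmorphXn. Qed.

Lemma den_rmorph (R S : comNzRingType) (f : {rmorphism R -> S}) q t d :
  f (den q t d) = den (f q) (f t) d.
Proof.
rewrite rmorph_prod; apply: eq_bigr => e _.
by rewrite rmorphB rmorph1 mon_rmorph.
Qed.

Lemma subspace_countE (R : comNzRingType) (q rho u r : nat) : (1 < q)%N ->
  (subspace_count q rho u r)%:R = evz (q%:R : R) (zcount rho u r).
Proof.
move=> q1; suff E : (subspace_count q rho u r)%:Z = evz (q%:Z : int) (zcount rho u r).
  rewrite -[LHS]/((Posz (subspace_count q rho u r))%:~R : R) E.
  exact: (evz_rmorph (intr : {rmorphism int -> R})).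
rewrite /subspace_count /zcount; case: eqP => [->|/eqP rrho].
  by rewrite leqnn subnn !big_ord0 divn1 -[RHS]/(zr int 1 + q%:Z * 0) mulr0 addr0.
rewrite ltn_neqAle rrho /=; case: leqP => rr; last by rewrite andbF.
rewrite andbT; set d := (rho - r)%N.
have d0 : (0 < d)%N by rewrite subn_gt0 ltn_neqAle rrho.
case: leqP => ur; last first.
  have id : (rho - u < d)%N by rewrite /d; lia.
  rewrite (bigD1 (Ordinal id)) //= (_ : q ^ rho - _ = 0)%N ?mul0n ?div0n //.
  by apply/eqP; rewrite subn_eq0 leq_exp2l //; lia.
have den0 : (0 < \prod_(i < d) (q ^ d - q ^ i))%N.
  by rewrite prodn_gt0 // => i; rewrite subn_gt0 ltn_exp2l.
have prodE b c : (forall i : 'I_d, c + i <= b)%N ->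
    (\prod_(i < d) (q ^ b - q ^ (c + i)))%N%:Z = \prod_(i < d) (q%:Z ^+ b - q%:Z ^+ (c + i)).
  move=> cb; rewrite -[LHS]natz natr_prod.
  by apply: eq_bigr => i _; rewrite natrB ?leq_exp2l // !natrX !natz.
rewrite -divz_nat prodE => [|i]; last by have := ltn_ord i; rewrite /d; lia.
have -> : \prod_(i < d) (q%:Z ^+ rho - q%:Z ^+ (u + i)) =
    evz q%:Z (tshift (u * d) (zbinomial (rho - u) d)) * (\prod_(i < d) (q ^ d - q ^ (0 + i)))%N%:Z.
  rewrite prodE => [|i]; last by rewrite add0n ltnW.
  rewrite evz_shift -mulrA zbinomialE; last by rewrite /d; lia.
  have -> : q%:Z ^+ (u * d) = \prod_(i < d) q%:Z ^+ u by rewrite prodr_const card_ord exprM.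
  rewrite -big_split; apply: eq_bigr => i _ /=; rewrite mulrBr -!exprD subnKC //.
  by lia.
by rewrite mulzK // gt_eqF // ltz_nat.
Qed.

Lemma transitionE (R : comNzRingType) (q : nat) a b : (1 < q)%N ->
  (transition q a b)%:R = evz (q%:R : R) (ztransition a b).
Proof. by move=> q1; rewrite !natrM !evz_mul -!subspace_countE. Qed.

Section GaussIgusa.
Variables (F : fieldType) (q : F).
Hypothesis q0 : q != 0.

Lemma one_sub_expN m i : (i <= m)%N -> 1 - q ^- (m - i) = (q ^+ m - q ^+ i) / q ^+ m.
Proof.
move=> im; have qm k : q ^+ k != 0 by rewrite expf_neq0.
rewrite mulrBl divff //; congr (_ - _); apply: (mulIf (qm m)); rewrite divfK //.
by rewrite -{2}(subnK im) exprD mulrA mulVf // mul1r.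
Qed.

Lemma gauss_binomialE a b : (b <= a)%N -> (forall k, (0 < k <= b)%N -> 1 - q ^- k != 0) ->
  gauss_binomial q a b * q ^+ (b * (a - b)) = evz q (zbinomial a b).
Proof.
move=> ba qk; have qm k : q ^+ k != 0 by rewrite expf_neq0.
have qk' (i : 'I_b) : q ^+ b - q ^+ i != 0.
  have ib := ltnW (ltn_ord i); have := qk (b - i)%N; rewrite subn_gt0 ltn_ord leq_subr => /(_ isT).
  by rewrite one_sub_expN // mulf_eq0 negb_or => /andP[].
have p0 : \prod_(i < b) (q ^+ b - q ^+ i) != 0 by apply/prodf_neq0 => i _.
apply: (mulIf p0); rewrite zbinomialE // /gauss_binomial big_add1 /= big_mkord.
rewrite (reindex_inj rev_ord_inj) /=.
have -> : q ^+ (b * (a - b)) = \prod_(i < b) q ^+ (a - b) by rewrite prodr_const card_ord mulnC exprM.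
rewrite -!big_split /=; apply: eq_bigr => i _; have ib := ltn_ord i.
have -> : (b - i.+1).+1 = (b - i)%N by lia.
have -> : (a - b + (b - i) = a - i)%N by lia.
rewrite !one_sub_expN ?(ltnW ib) //; last by lia.
rewrite -{2}(subnK ba) exprD; field.
by rewrite !qm qk'.
Qed.
End GaussIgusa.

End Evaluation.
Import Evaluation.

Module IgusaRecursion.
Definition set_seq n (S : {set 'I_n}) : seq nat := [seq val i | i <- enum S].

Definition set_ext n (x : {set 'I_n} * bool) : {set 'I_n.+1} :=
  [set i | if insub (val i) is Some j then j \in x.1 else x.2].

Lemma set_ext_bij n : bijective (@set_ext n).
Proof.
exists (fun S : {set 'I_n.+1} => ([set j | widen_ord (leqnSn n) j \in S], ord_max \in S)).
  move=> [S b]; congr pair; last by rewrite inE insubN //= ltnn.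
  by apply/setP => j; rewrite !inE /= valK.
move=> S; apply/setP => i; rewrite inE; case: insubP => [j _ ji|] /=.
  by rewrite inE; congr (_ \in S); exact: val_inj.
rewrite -leqNgt => ni; congr (_ \in S); apply: val_inj => /=.
by apply/eqP; rewrite eqn_leq ni -ltnS ltn_ord.
Qed.

Lemma set_seq_ext n (S : {set 'I_n}) b :
  set_seq (set_ext (S, b)) = if b then rcons (set_seq S) n else set_seq S.
Proof.
rewrite /set_seq {1}/enum_mem -enumT enum_ordSr filter_rcons filter_map.
have -> : mem (set_ext (S, b)) ord_max = b.
  by rewrite -[LHS]/(ord_max \in set_ext (S, b)) inE insubN //= ltnn.
have -> : [seq i <- enum 'I_n | preim (widen_ord (leqnSn n)) (mem (set_ext (S, b))) i] = enum S.
  rewrite [RHS]/enum_mem -enumT; apply: eq_filter => j.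
  by rewrite /= inE /= valK.
by case: b; rewrite ?map_rcons -map_comp; [congr rcons|]; apply: eq_map.
Qed.

Lemma sum_sets (V : nmodType) n (g : seq nat -> V) :
  \sum_(S : {set 'I_n.+1}) g (set_seq S) =
  \sum_(S : {set 'I_n}) g (set_seq S) + \sum_(S : {set 'I_n}) g (rcons (set_seq S) n).
Proof.
rewrite (reindex (@set_ext n)); last exact: onW_bij (set_ext_bij n).
rewrite -(pair_big predT predT (fun S b => g (set_seq (set_ext (S, b))))) /=.
rewrite -big_split; apply: eq_bigr => S _ /=.
by rewrite big_bool /= !set_seq_ext addrC.
Qed.

Section IgusaRecursion.
Variables (F : fieldType) (q : F).

Definition igusa_term (X : seq F) n (s : seq nat) : F :=
  if all (ltn 0) s then
    gauss_flag q (rcons s n) * \prod_(k <- s) (X`_k.-1 / (1 - X`_k.-1))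
  else 0.

Definition igusa_sum X m n : F := \sum_(S : {set 'I_m}) igusa_term X n (set_seq S).

Lemma igusaE X : igusa q X = (1 - X`_(size X).-1)^-1 * igusa_sum X (size X) (size X).
Proof.
rewrite /igusa big_mkcond; congr (_ * _); apply: eq_bigr => S _ /=.
rewrite /igusa_term /set_seq all_map; have -> : all (preim val (ltn 0)) (enum S) = [forall i in S, (0 < i)%N].
  apply/allP/'forall_implyP => h i; first by move=> iS; apply: h; rewrite mem_enum.
  by rewrite mem_enum; exact: h.
by case: ifP => // _; rewrite big_map big_enum.
Qed.

Lemma gauss_flag_rcons s m n :
  gauss_flag q (rcons (rcons s m) n) = gauss_flag q (rcons s m) * gauss_binomial q n m.
Proof.
elim: s => [|a [|b s] IHs] /=; first by rewrite mulr1 mul1r.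
  by rewrite !mulr1.
by move: IHs => /= ->; rewrite mulrA.
Qed.

Lemma igusa_sumS X m n : igusa_sum X m.+1 n = igusa_sum X m n +
  (if (0 < m)%N then gauss_binomial q n m * (X`_m.-1 / (1 - X`_m.-1) * igusa_sum X m m) else 0).
Proof.
rewrite /igusa_sum sum_sets; congr (_ + _).
case: ifP => m0; last by rewrite big1 // => S _; rewrite /igusa_term all_rcons /= m0.
rewrite !mulr_sumr; apply: eq_bigr => S _; rewrite /igusa_term all_rcons /= m0 /=.
case: ifP => _; last by rewrite !mulr0.
by rewrite gauss_flag_rcons big_rcons /=; ring.
Qed.

Lemma igusa_take X m : (0 < m <= size X)%N ->
  igusa q (take m X) = (1 - X`_m.-1)^-1 * igusa_sum X m m.
Proof.
move=> /andP[m0 mX]; rewrite igusaE size_takel //; congr (_ * _).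
  by rewrite nth_take // prednK.
apply: eq_bigr => S _; rewrite /igusa_term; case: ifP => // _; congr (_ * _).
rewrite !big_map; apply: eq_bigr => i _; rewrite nth_take //.
by case: i => -[|i] //= im; rewrite (leq_trans _ im).
Qed.

Lemma igusa_rec X : (0 < size X)%N -> igusa q X =
  (1 + \sum_(1 <= k < size X) gauss_binomial q (size X) k * (X`_k.-1 * igusa q (take k X)))
  / (1 - X`_(size X).-1).
Proof.
move=> X0; rewrite igusaE mulrC; congr (_ / _).
suff H m n : (0 < m <= size X)%N -> igusa_sum X m n =
    1 + \sum_(1 <= k < m) gauss_binomial q n k * (X`_k.-1 * igusa q (take k X)).
  by rewrite H ?X0 ?leqnn.
elim: m => // -[|m] IHm mX.
  rewrite igusa_sumS big_geq // addr0 /= addr0 /igusa_sum.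
  rewrite (big_pred1 (finset.set0 : {set 'I_0})) => [|S]; last by apply/esym/eqP/setP => -[].
  by rewrite /igusa_term /set_seq enum_set0 /= big_nil mulr1.
rewrite igusa_sumS IHm; last by case/andP: mX => _ /ltnW.
rewrite [in RHS]big_nat_recr //= addrA; congr (_ + _).
rewrite igusa_take; last exact: ltnW.
by rewrite !mulrA.
Qed.
End IgusaRecursion.

Section Fractions.
Variables (F : fieldType) (q t : F).
Hypothesis q0 : q != 0.
Hypothesis qk : forall k, (0 < k <= 8)%N -> 1 - q ^- k != 0.

Local Notation mon := (mon q t).
Local Notation den := (den q t).
Local Notation ev := (ev q t).

Lemma igusa_numE fuel L : (0 < size L <= fuel)%N -> (size L <= 8)%N -> igusa_ok L ->
  {in L, forall e, 1 - mon e != 0} -> igusa q (map mon L) * den L = ev (igusa_num fuel L).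
Proof.
elim: fuel L => [|fuel IHf] L; first by case/andP => /leq_trans h /h.
case/andP=> L0 Lf L8 Lok Lnz; rewrite igusa_rec ?size_map //; set n := size L.
have nthL k : (k < n)%N -> (map mon L)`_k = mon (nth (0, 0)%N L k).
  by move=> kn; rewrite (nth_map (0, 0)%N).
have n1 : (n.-1 < n)%N by rewrite prednK.
have -> : den L = den (take n.-1 L) * (1 - (map mon L)`_n.-1).
  rewrite -{1}(cat_take_drop n.-1 L) den_cat (drop_nth (0, 0)%N) // drop_oversize ?prednK //.
  by rewrite nthL // /Evaluation.den big_seq1.
have nz : 1 - (map mon L)`_n.-1 != 0 by rewrite nthL //; apply/Lnz/mem_nth.
rewrite [X in _ * X]mulrC mulrA divfK // mulrDl mul1r.
have evf s0 (f : nat -> qtpoly) r : ev (foldr (fun k acc => qtadd (f k) acc) s0 r) =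
    ev s0 + \sum_(k <- r) ev (f k).
  elim: r => [|k r IHr] /=; first by rewrite big_nil addr0.
  by rewrite ev_add IHr big_cons addrCA.
rewrite [igusa_num _ _]/= evf ev_mul1Bs ev_const mul1r; congr (_ + _).
rewrite mulr_suml /index_iota subn1 !big_seq; apply: eq_bigr => k.
rewrite mem_iota add1n prednK // => /andP[k0 kn].
rewrite ev_mul1Bs ev_shift ev_qmul -map_take -IHf.
- have k1 : (k <= n.-1)%N by rewrite -ltnS prednK.
  have -> : den (take n.-1 L) = den (take k L) * den (drop k (take n.-1 L)).
    by rewrite -den_cat -{1}(take_takel _ k1) cat_take_drop.
  have := allP Lok k; rewrite mem_iota add1n prednK // k0 kn => /(_ isT) ka.
  rewrite nthL ?(leq_trans _ kn) ?leq_pred // -/n in ka *; last by rewrite prednK // ltnW.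
  set e := nth _ L k.-1 in ka *.
  rewrite -gauss_binomialE //; last 2 first.
  - exact: ltnW.
  - by move=> j /andP[j0 jk]; apply: qk; rewrite j0 (leq_trans jk) // (leq_trans (ltnW kn)).
  rewrite /Evaluation.mon -{1}(subnK ka) exprD; ring.
- by rewrite size_takel ?k0 /= ?(ltnW kn) // -ltnS (leq_trans kn).
- by rewrite size_takel ?(ltnW kn) // (leq_trans (ltnW kn)).
- apply/allP => j; rewrite mem_iota add1n size_takel ?(ltnW kn) // prednK // => /andP[j0 jk].
  have := allP Lok j; rewrite mem_iota add1n prednK // j0 (ltn_trans jk kn) => /(_ isT).
  rewrite nth_take ?(leq_ltn_trans (leq_pred _) jk) //; apply: leq_trans.
  by rewrite leq_mul2l leq_sub2r ?orbT // ltnW.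
- by move=> e /mem_take; exact: Lnz.
Qed.
End Fractions.

End IgusaRecursion.
Import IgusaRecursion.

Module ClosedForms.
Definition dens3 : seq (nat * nat) := [:: (0, 1); (1, 1); (2, 1)]%N.

Definition num33_ok (N : qtpoly) : bool :=
  [&& size N == 82, all (fun r => size r == 109) N, rev (map rev N) == N,
      has (predC (Z.eqb Z0)) (nth [::] N 81), has (fun r => ~~ Z.eqb Z0 (nth Z0 r 108)) N,
      qteq (qtmul1Bs W_num dens33) (qtshift 8 0 (qtmul1Bs N (W_dens ++ dens3))) &
      qteq (qtmul1Bs total dens33) (qtmul1Bs N total_dens)]%N.

Lemma num33_ex : exists N, num33_ok N.
Proof. by exists num33; vm_cast_no_check (erefl true). Qed.

(* The 25 states are listed so that the transition matrix is lower triangular, with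
   monomials on the diagonal. *)
Definition states_ok : bool :=
  [&& uniq states, states == (0, 0, 0) :: behead states,
   all (fun a => ztransition a a == tshift (diag a).1 [:: Zpos xH]) (behead states),
   pairwise (fun b a => all (Z.eqb Z0) (ztransition a b)) (rev (behead states)) &
   W_ok && all (all (fun y => expr_ok y && (size (qtexpr_frac y).2 <= 8))) W_terms]%N.

Lemma states_okT : states_ok.
Proof. by vm_cast_no_check (erefl true). Qed.

Section Solution.
Variables (F : fieldType) (q t : F).
Hypothesis q0 : q != 0.

Local Notation mon := (mon q t).
Local Notation den := (den q t).
Local Notation ev := (ev q t).

Section Terms.
Hypothesis qk : forall k, (0 < k <= 8)%N -> 1 - q ^- k != 0.

Definition qtexpr_val (x : qtexpr) : F :=
  match x with
  | QBin a b => gauss_binomial q a b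
  | QIgusa L => igusa q (map mon L)
  | QCirc L => igusa_circ q (map mon L)
  end.

Definition regular (d : seq (nat * nat)) := {in d, forall e, 1 - mon e != 0}.

Lemma regular_den d : regular d -> den d != 0.
Proof. by move=> dr; rewrite /Evaluation.den prodf_seq_neq0; apply/allP => e /dr. Qed.

Lemma qtexpr_fracE x : expr_ok x && (size (qtexpr_frac x).2 <= 8)%N -> regular (qtexpr_frac x).2 ->
  qtexpr_val x * (q ^+ (qtexpr_frac x).1.1 * den (qtexpr_frac x).2) = ev (qtexpr_frac x).1.2.
Proof.
case: x => [a b|L|L] /=.
- move=> /andP[/andP[ba a8] _] _; rewrite /Evaluation.den big_nil mulr1 ev_qpoly gauss_binomialE //.
  by move=> k /andP[k0 kb]; apply: qk; rewrite k0 (leq_trans kb) // (leq_trans ba).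
- move=> /andP[/andP[Lok L0] L8] Lr; rewrite expr0 mul1r (@igusa_numE _ q t q0 qk (size L)) //.
  by rewrite L0 /=.
move=> /andP[/andP[Lok L0] L8] Lr; rewrite expr0 mul1r ev_shift -(@igusa_numE _ q t q0 qk (size L)) //; last by rewrite L0 /=.
rewrite /igusa_circ size_map -mulrA; congr (_ * _).
by rewrite (nth_map (0, 0)%N) // prednK.
Qed.

Definition term_val (x : seq qtexpr) : F := \prod_(y <- x) qtexpr_val y.

Lemma term_fracE x : all (fun y => expr_ok y && (size (qtexpr_frac y).2 <= 8)%N) x ->
  regular (term_frac x).2 ->
  term_val x * (q ^+ (term_frac x).1.1 * den (term_frac x).2) = ev (term_frac x).1.2.
Proof.
elim: x => [_ _|y x IHx /= /andP[yok xok] r].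
  by rewrite /term_val /Evaluation.den !big_nil ev_const expr0 !mulr1.
rewrite /term_val big_cons -/(term_val x) ev_mul exprD den_cat.
rewrite -qtexpr_fracE //; last by move=> e ey; apply: r; rewrite mem_cat ey.
rewrite -IHx //; last by move=> e ey; apply: r; rewrite mem_cat ey orbT.
ring.
Qed.

Lemma W_termsE : regular W_dens ->
  (\sum_(x <- W_terms) term_val x) * (q ^+ 8 * den W_dens) = ev W_num.
Proof.
move=> r; have /and5P [_ _ _ _ /andP[ok eok]] := states_okT.
rewrite /W_num; move: ok eok; rewrite /W_ok; elim: W_terms => [|x s IHs]; first by rewrite big_nil mul0r.
move=> /andP[/andP[e8 pd] /IHs{}IHs] /andP[xeok /IHs{}IHs].
rewrite big_cons mulrDl IHs [foldr _ _ _]/= ev_add; congr (_ + _).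
rewrite ev_mul1Bs ev_shift -term_fracE //; last first.
  by move=> e ex; apply: r; rewrite (perm_mem pd) mem_cat ex.
rewrite (den_perm q t pd) den_cat -{1}(subnK e8) exprD; ring.
Qed.

Lemma W_formulaE : W_formula q t = (\sum_(x <- W_terms) term_val x) / den dens3.
Proof.
have monsE (f : nat -> nat * nat) r : map mon (map f r) = [seq mon (f i) | i <- r] by rewrite -map_comp.
have -> : \sum_(x <- W_terms) term_val x = term_val W_A + \sum_(1 <= j < 6) term_val (W_B j) +
    (term_val W_C1 + \sum_(2 <= j < 6) term_val (W_C j)) +
    (term_val W_E1 + \sum_(2 <= j < 5) term_val (W_E j)).
  have sumE (A : seq qtexpr) B r s : \sum_(x <- A :: map B r ++ s) term_val x =
      term_val A + \sum_(j <- r) term_val (B j) + \sum_(x <- s) term_val x.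
    by rewrite big_cons big_cat big_map addrA.
  by rewrite /W_terms !sumE -[map W_E _]cats0 sumE big_nil addr0 -!addrA.
rewrite /W_formula; congr (_ / _); last first.
  by rewrite /Evaluation.den !big_cons big_nil /Evaluation.mon /= !expr0 !expr1 !mul1r mulr1 mulrA.
have xE a b : map mon (xmons a b) = [seq q ^+ (i * (8 - i)) * t ^+ (6 + i) | i <- index_iota a b.+1].
  exact: monsE.
have yE a b : map mon (ymons a b) = [seq q ^+ (2 + i * (5 - i)) * t ^+ (5 + i) | i <- index_iota a b.+1].
  exact: monsE.
have valE x s : term_val (x :: s) = qtexpr_val x * term_val s by rewrite /term_val big_cons.
have val0 : term_val [::] = 1 by rewrite /term_val big_nil.
have e6 : mon (0, 6)%N = t ^+ 6 by rewrite /Evaluation.mon expr0 mul1r.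
congr (_ + _ + (_ + _) + (_ + _)).
- by rewrite /W_A !valE val0 mulr1 /qtexpr_val xE !map_cons e6.
- by apply: eq_bigr => j _; rewrite /W_B !valE val0 mulr1 /qtexpr_val xE yE !mulrA.
- by rewrite /W_C1 !valE val0 mulr1 /qtexpr_val xE !mulrA.
- by apply: eq_bigr => j _; rewrite /W_C !valE val0 mulr1 expr2 /qtexpr_val xE yE !mulrA.
- by rewrite /W_E1 !valE val0 mulr1 /qtexpr_val xE !mulrA.
- by apply: eq_bigr => j _; rewrite /W_E !valE val0 mulr1 /qtexpr_val xE yE !mulrA.
Qed.
End Terms.


Lemma W_formula_den N : num33_ok N -> (forall k, (0 < k <= 8)%N -> 1 - q ^- k != 0) ->
  regular W_dens -> regular dens3 -> W_formula q t * den dens33 = ev N.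
Proof.
move=> /and5P [_ _ _ _ /and3P[_ /(qteq_ev q t) E _]] qk rW r3.
move: E; rewrite ev_shift !ev_mul1Bs den_cat -(W_termsE qk rW) W_formulaE // expr0 mulr1 => E.
have q8 : q ^+ 8 * den W_dens != 0 by rewrite mulf_neq0 ?expf_neq0 ?regular_den.
have d3 := regular_den r3.
apply: (mulIf d3); rewrite mulrAC divfK //; apply: (mulIf q8); rewrite mulrAC E; ring.
Qed.

Definition weight a b := t ^+ size_state a * evz q (ztransition a b).

Fixpoint chain (s : seq (state * qtpoly)) : Prop :=
  if s is x :: s' then
    (nilp s' \/ ev x.2 * (1 - mon (diag x.1)) = \sum_(y <- s') weight x.1 y.1 * ev y.2) /\ chain s'
  else True.

Lemma solve_step_chain s a : ~~ nilp s -> chain s -> chain (solve_step s a).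
Proof.
move=> s0 sP; split; last first.
  elim: s sP {s0} => //= x s IHs [xP /IHs sP]; split=> //.
  case: xP => [|xP]; [by left; rewrite /nilp size_map|right].
  rewrite ev_mul1B mulrAC xP mulr_suml big_map; apply: eq_bigr => y _.
  by rewrite /= ev_mul1B mulrA.
right; rewrite /= ev_shift expr0 mul1r big_map.
have H z l : ev (foldl (fun s x => qtadd s (qmul (ztransition a x.1) x.2)) z l) =
    ev z + \sum_(x <- l) evz q (ztransition a x.1) * ev x.2.
  elim: l z => [|x l IHl] z /=; first by rewrite big_nil addr0.
  by rewrite IHl big_cons ev_add ev_qmul addrA.
rewrite H add0r mulr_sumr mulr_suml; apply: eq_bigr => x _.
by rewrite ev_mul1B /weight !mulrA.
Qed.

Lemma solutionP : [/\ chain solution, map fst solution = rev states &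
  exists s n, solution = rcons s ((0, 0, 0)%N, n) /\ ev n = den total_dens].
Proof.
have /and5P [_ /eqP st0 _ _ _] := states_okT.
suff H l acc d : chain acc -> 
    (exists s n, acc = rcons s ((0, 0, 0)%N, n) /\ ev n = den d) ->
  let r := foldl solve_step acc l in
  [/\ chain r, map fst r = rev l ++ map fst acc &
  exists s n, r = rcons s ((0, 0, 0)%N, n) /\ ev n = den (d ++ map diag l)].
  rewrite st0 rev_cons -cats1; apply: (H _ [:: _] [::]) => //=; first by split=> //; left.
  by exists [::], (qtconst (Zpos xH)); split=> //; rewrite ev_const /Evaluation.den big_nil.
elim: l acc d => [|a l IHl] acc d ch [s [n [accE En]]] r.
  by split=> //; exists s, n; rewrite cats0.
have [] := IHl (solve_step acc a) (rcons d (diag a)).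
- by apply: solve_step_chain => //; rewrite accE /nilp size_rcons.
- rewrite accE /solve_step map_rcons -rcons_cons; eexists _, _; split; first by [].
  by rewrite /= ev_mul1B En -cats1 den_cat [den [:: _]]big_seq1.
move=> H1 H2 H3; split=> //; last by rewrite cat_rcons in H3.
by rewrite /r /= H2 rev_cons cat_rcons /=; congr (_ ++ _ :: _); rewrite -map_comp.
Qed.

Definition solution_val a := (\sum_(x <- solution | x.1 == a) ev x.2) / den total_dens.

Lemma solution_sum (f : state -> F) :
  \sum_(a <- states) f a * solution_val a = (\sum_(x <- solution) f x.1 * ev x.2) / den total_dens.
Proof.
have /and5P [us _ _ _ _] := states_okT; have [_ keys _] := solutionP.
have keys' : perm_eq (map fst solution) states by rewrite keys perm_rev.
rewrite mulr_suml; under eq_bigr do rewrite mulrA mulr_sumr mulr_suml big_mkcond.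
rewrite exchange_big.
have : all (fun x => x \in states) (map fst solution).
  by apply/allP => x; rewrite (perm_mem keys').
move: us; generalize states => l ul {keys keys'}.
elim: solution => [|x s IHs]; first by rewrite !big_nil.
rewrite [map _ _]/= => /andP[xs /IHs]; rewrite !big_cons => ->; congr (_ + _).
rewrite (bigD1_seq x.1) // eqxx big1_seq; first exact: addr0.
move=> a /andP[ax _]; by rewrite eq_sym (negbTE ax).
Qed.

Lemma solution_val0 : regular total_dens -> solution_val (0, 0, 0)%N = 1.
Proof.
move=> r; rewrite /solution_val.
have /and5P [us _ _ _ _] := states_okT; have [_ keys [s [n [sE En]]]] := solutionP.
have : uniq (map fst solution) by rewrite keys rev_uniq.
rewrite sE map_rcons rcons_uniq /= => /andP[s0 _].
rewrite big_rcons /= En -big_filter.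
suff -> : [seq x <- s | x.1 == (0, 0, 0)%N] = [::] by rewrite big_nil add0r divff ?regular_den.
elim: s s0 {sE} => //= x s IHs; rewrite inE negb_or eq_sym => /andP[/negbTE -> ]; exact: IHs.
Qed.

Lemma solution_valE a : regular total_dens -> a \in behead states ->
  solution_val a = \sum_(b <- states) weight a b * solution_val b.
Proof.
move=> r ain; have /and5P [us /eqP st0 dg tri _] := states_okT.
have [ch keys [s [n [sE _]]]] := solutionP.
rewrite solution_sum; apply: (congr1 (fun z => z / den total_dens)).
move: ain dg tri us keys; rewrite st0; move: (behead states) => {st0} l ain dg tri us keys.
have a0 : a != (0, 0, 0)%N.
  by move: us; rewrite /= => /andP[n0 _]; apply: contraNneq n0 => <-.
have zeros : pairwise (fun b a => (a != (0, 0, 0)%N) ==> all (Z.eqb Z0) (ztransition a b)) (map fst solution).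
  rewrite keys rev_cons -cats1 pairwise_cat /= andbT; apply/andP; split.
    by rewrite allrel1r; apply/allP => b _ /=.
  by apply: sub_pairwise tri => x y /= ->; exact: implybT.
have ak : a \in map fst solution.
  by rewrite keys mem_rev inE ain orbT.
have uk : uniq (map fst solution) by rewrite keys rev_uniq.
have [s1 [x [s2 [xa solE]]]] : exists s1 x s2, x.1 = a /\ solution = s1 ++ x :: s2.
  elim: (solution) ak => //= x s' IHs; rewrite inE => /orP[/eqP ax|/IHs [s1 [y [s2 [ya ->]]]]].
    by exists [::], x, s'.
  by exists (x :: s1), y, s2.
have ch' : chain (x :: s2).
  by move: ch; rewrite solE; elim: (s1) => //= y s' IHs [_ /IHs].
have s20 : ~~ nilp s2.
  case: (s2) solE => // solE.
  by move: sE; rewrite solE cats1 => /rcons_inj [_ xE]; rewrite -xa xE eqxx in a0.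
case: ch' => -[s2n|xP] _; first by rewrite s2n in s20.
move: uk zeros; rewrite solE map_cat cat_uniq pairwise_cat /= xa.
move=> /and3P[_ /norP[as1 _] /andP[as2 _]] /and3P[z1 _ _].
have lookup s' : a \notin map fst s' -> \sum_(y <- s' | y.1 == a) ev y.2 = 0.
  elim: s' => [|y s' IHs] /=; first by rewrite big_nil.
  by rewrite inE negb_or eq_sym big_cons => /andP[/negbTE -> /IHs].
rewrite !big_cat !big_cons /= xa eqxx !lookup // add0r addr0.
have -> : \sum_(y <- s1) weight a y.1 * ev y.2 = 0.
  move: z1; rewrite allrel_consr => /andP[z1 _].
  elim: s1 z1 {solE as1} => [|y s1 IHs] /=; first by rewrite big_nil.
  move=> /andP[yz /IHs]; rewrite big_cons => ->; rewrite addr0 /weight.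
  move: yz; rewrite a0 /= => yz.
  suff -> : evz q (ztransition a y.1) = 0 by rewrite mulr0 mul0r.
  elim: (ztransition _ _) yz => //= c z IHz /andP[c0 /IHz ->].
  by rewrite mulr0 addr0; case: c c0.
rewrite add0r; move: xP; rewrite xa => /esym E.
have -> : weight a a = mon (diag a).
  rewrite /weight (eqP (allP dg _ ain)) evz_shift /= mulr0 addr0 (_ : zr _ _ = 1) //.
  by rewrite mulr1 mulrC.
by rewrite E; ring.
Qed.

Lemma solution_total N : num33_ok N -> regular total_dens ->
  (\sum_(a <- states) solution_val a) * den dens33 = ev N.
Proof.
move=> /and5P [_ _ _ _ /and3P[_ _ /(qteq_ev q t) E]] /regular_den d0.
have := solution_sum (fun=> 1); under eq_bigr do rewrite mul1r; move=> ->.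
under eq_bigr do rewrite mul1r.
have H z l : ev (foldl (fun s (x : state * qtpoly) => qtadd s x.2) z l) = ev z + \sum_(x <- l) ev x.2.
  elim: l z => [|x l IHl] z /=; first by rewrite big_nil addr0.
  by rewrite IHl big_cons ev_add addrA.
have totalE : ev total = \sum_(x <- solution) ev x.2 by rewrite [LHS]H add0r.
rewrite -totalE; move: E; move: (total) => T; rewrite !ev_mul1Bs => E.
by move: d0 E; move: (den total_dens) => d d0 E; rewrite mulrAC E mulfK.
Qed.
End Solution.

End ClosedForms.
Import ClosedForms.

Module RationalFunction.
Section Reversal.
Variables (F : fieldType).
Implicit Types (q t : F).

Lemma evz_rcons x s c : evz (x : F) (rcons s c) = evz x s + x ^+ size s * zr F c.
Proof.
elim: s => [|a s IHs] /=; first by rewrite expr0 mulr0 addr0 mul1r add0r.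
by rewrite IHs mulrDr addrA exprS mulrA.
Qed.

Lemma evz_rev x s : x != 0 :> F -> evz x (rev s) * x = evz x^-1 s * x ^+ size s.
Proof.
move=> x0; elim: s => [|c s IHs] /=; first by rewrite !mul0r.
rewrite rev_cons evz_rcons mulrDl IHs size_rev exprS mulrDl addrC; congr (_ + _); first by ring.
by rewrite (mulrC x^-1) mulrA mulfVK.
Qed.

Lemma ev_rcons q t l r : ev q t (rcons l r) = ev q t l + q ^+ size l * evz t r.
Proof.
elim: l => [|a l IHl] /=; first by rewrite expr0 mulr0 addr0 mul1r add0r.
by rewrite IHl mulrDr addrA exprS mulrA.
Qed.

Lemma ev_rev q t l n : q != 0 -> t != 0 -> all (fun r => size r == n) l ->
  ev q t (rev (map rev l)) * (q * t) = ev q^-1 t^-1 l * (q ^+ size l * t ^+ n).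
Proof.
move=> q0 t0; elim: l => [|r l IHl] /=; first by rewrite !mul0r.
move=> /andP[/eqP rn /IHl{}IHl]; rewrite rev_cons ev_rcons mulrDl IHl size_rev size_map.
rewrite exprS mulrDl addrC; congr (_ + _).
  by have := evz_rev r t0; rewrite rn => E; transitivity (q ^+ size l * q * (evz t (rev r) * t));
    [ring|rewrite E; ring].
by rewrite (mulrC q^-1) !mulrA mulfVK.
Qed.

Lemma den_inv q t d : q != 0 -> t != 0 ->
  den q^-1 t^-1 d * (q ^+ sumn (map fst d) * t ^+ sumn (map snd d)) = (-1) ^+ size d * den q t d.
Proof.
move=> q0 t0; rewrite /den; elim: d => [|e d IHd]; first by rewrite !big_nil !expr0 !mulr1.
rewrite !big_cons /= !exprD exprS.
have E : (1 - mon q^-1 t^-1 e) * (q ^+ e.1 * t ^+ e.2) = - (1 - mon q t e).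
  rewrite mulrBl mul1r /mon !exprVn mulrACA !mulVf ?expf_neq0 //; ring.
transitivity (((1 - mon q^-1 t^-1 e) * (q ^+ e.1 * t ^+ e.2)) *
  (\prod_(e <- d) (1 - mon q^-1 t^-1 e) * (q ^+ sumn (map fst d) * t ^+ sumn (map snd d)))).
  by ring.
by rewrite E IHd; ring.
Qed.
End Reversal.

Section Sizes.
Definition size_ok (m n : nat) (l : qtpoly) : bool :=
  [&& size l == m.+1, all (fun r => size r <= n.+1) l,
      has (predC (Z.eqb Z0)) (nth [::] l m) & has (fun r => ~~ Z.eqb Z0 (nth Z0 r n)) l]%N.

Local Notation toP := (fun l => ev ('X : {poly {poly rat}}) 'Y l).

Lemma evz_Poly (R : comNzRingType) s : evz ('X : {poly R}) s = Poly (map (zr R) s).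
Proof.
elim: s => //= c s ->; rewrite cons_poly_def addrC mulrC; congr (_ + _).
by rewrite /zr rmorph_int.
Qed.

Lemma ev_Poly l : toP l = Poly (map (fun s => evz 'X s) l).
Proof.
elim: l => //= s l ->; rewrite cons_poly_def addrC mulrC; congr (_ + _).
by rewrite (evz_rmorph (polyC : {rmorphism {poly rat} -> {poly {poly rat}}})).
Qed.

Lemma zr_eq0 c : (zr rat c == 0) = Z.eqb Z0 c.
Proof. by rewrite /zr intr_eq0; case: c => //= p; rewrite /int_of_Z; lia. Qed.

Lemma coef_lt_size (R : nzRingType) (p : {poly R}) i : p`_i != 0 -> (i < size p)%N.
Proof. by rewrite ltnNge; apply: contra => /(nth_default 0) ->. Qed.

Lemma size_evP m n l : size_ok m n l -> size (toP l) = m.+1 /\ sizeY (toP l) = n.+1.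
Proof.
case/and4P=> /eqP sl rows top side; rewrite ev_Poly.
have coefE i : (Poly (map (fun s => evz ('X : {poly rat}) s) l))`_i = Poly (map (zr rat) (nth [::] l i)).
  rewrite coef_Poly; case: (ltnP i (size l)) => il; first by rewrite (nth_map [::]) // evz_Poly.
  by rewrite !nth_default ?size_map.
have nz r i : ~~ Z.eqb Z0 (nth Z0 r i) -> (Poly (map (zr rat) r))`_i != 0.
  move=> ri; rewrite coef_Poly (nth_map Z0) ?zr_eq0 // ltnNge.
  by apply: contra ri => /(nth_default Z0) ->.
set P := Poly _ in coefE *.
have Pnz i j : ~~ Z.eqb Z0 (nth Z0 (nth [::] l i) j) -> P`_i`_j != 0 by rewrite coefE; exact: nz.
have sE : size P = m.+1.
  rewrite -sl; apply/eqP; rewrite eqn_leq (leq_trans (size_Poly _)) ?size_map //= sl.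
  have /hasP [c /(nthP Z0) [i _ ci] c0] := top.
  apply: coef_lt_size; have : P`_m`_i != 0 by apply: Pnz; rewrite ci.
  by apply: contraNneq => ->; rewrite coef0.
split=> //; apply/eqP; rewrite eqn_leq; apply/andP; split.
  apply/bigmax_leqP => i _; rewrite coefE (leq_trans (size_Poly _)) // size_map.
  by have := allP rows _ (mem_nth [::] (_ : i < size l)%N); apply; rewrite sl -sE.
have /hasP [r /(nthP [::]) [i il ri] r0] := side.
have : (n < size (P`_i)%R)%N by apply/coef_lt_size/Pnz; rewrite ri.
move=> /leq_trans; apply; rewrite sl -sE in il.
exact: (leq_bigmax (Ordinal il)).
Qed.
End Sizes.

Section Values.
Variables (F : fieldType) (g : {rmorphism rat -> F}).

Lemma ratr_rmorph : (ratr : rat -> F) =1 g.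
Proof.
by move=> a; rewrite -[in RHS](divq_num_den a) fmorph_div !rmorph_int.
Qed.

Lemma poly_value_ev (x y : F) l : poly_value (ev 'X 'Y l) x y = ev x y l.
Proof.
rewrite /poly_value.
have -> : map_poly (map_poly (ratr : rat -> F)) (ev 'X 'Y l) = map_poly (map_poly g) (ev 'X 'Y l).
  by apply: eq_map_poly => p; apply: eq_map_poly; exact: ratr_rmorph.
pose h1 : {rmorphism {poly rat} -> {poly F}} := map_poly g.
pose h : {rmorphism {poly {poly rat}} -> {poly {poly F}}} := map_poly h1.
pose e1 : {rmorphism {poly {poly F}} -> {poly F}} := horner_eval x%:P.
pose e2 : {rmorphism {poly F} -> F} := horner_eval y.
rewrite -[LHS]/(e2 (e1 (h (ev 'X 'Y l)))) !ev_rmorph.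
congr ev; first by rewrite /= map_polyX /horner_eval hornerX hornerC.
by rewrite /= map_polyC /= map_polyX /horner_eval hornerC hornerX.
Qed.
End Values.

Lemma D33E : D33 = den 'X 'Y dens33.
Proof.
rewrite /D33 /den /dens33 !big_cons big_nil /mon /= !expr0 !expr1 !mul1r mulr1.
by rewrite !mulrA.
Qed.

Lemma den_ev (R : comNzRingType) (q t : R) d :
  den q t d = ev q t (qtmul1Bs (qtconst (Zpos xH)) d).
Proof. by rewrite ev_mul1Bs ev_const mul1r. Qed.

Definition den33_ok : bool :=
  size_ok 115 131 (qtmul1Bs (qtconst (Zpos xH)) dens33) &&
  (size dens33 == 18) && (sumn (map fst dens33) == 115) && (sumn (map snd dens33) == 131).
Lemma den33_okT : den33_ok.
Proof. by vm_cast_no_check (erefl true). Qed.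

Local Notation tofracM := (@tofrac {poly {poly rat}} : {rmorphism {poly {poly rat}} -> ratfun}).

Lemma mon_neq1 e : (0 < e.2)%N -> 1 - mon ('X : {poly {poly rat}}) 'Y e != 0.
Proof.
case: e => a [|b] //= _; apply: contra_neq (oner_neq0 rat) => E.
have := congr1 (fun P : {poly {poly rat}} => P.[1].[0]) E.
by rewrite /mon /= !hornerE expr0n mulr0 subr0.
Qed.

Lemma ratfun_regular d : all (fun e => 0 < e.2)%N d -> regular Xfrac Yfrac d.
Proof.
move=> /allP dP e /dP e0; rewrite /Xfrac /Yfrac -(mon_rmorph tofracM).
by rewrite -(rmorph1 tofracM) -rmorphB tofrac_eq0 mon_neq1.
Qed.

Lemma Xfrac_neq0 : Xfrac != 0. Proof. by rewrite tofrac_eq0 polyX_eq0. Qed.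
Lemma Yfrac_neq0 : Yfrac != 0. Proof. by rewrite tofrac_eq0 polyC_eq0 polyX_eq0. Qed.

Definition positive_ok : bool :=
  all (fun e => 0 < e.2)%N W_dens && all (fun e => 0 < e.2)%N dens3 &&
  all (fun e => 0 < e.2)%N dens33.
Lemma positive_okT : positive_ok. Proof. by vm_compute. Qed.

Lemma W33E N : num33_ok N -> W33 = tofrac (ev 'X 'Y N) / tofrac D33.
Proof.
move=> Nok; have /andP[/andP[pW p3] p33] := positive_okT.
have d33 : tofrac D33 != 0.
  rewrite D33E (den_rmorph tofracM); exact: regular_den (ratfun_regular p33).
apply: (mulIf d33); rewrite divfK // D33E (den_rmorph tofracM) (ev_rmorph tofracM).
rewrite /W33; apply: (W_formula_den Xfrac_neq0 Nok); last 2 first.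
- exact: ratfun_regular pW.
- exact: ratfun_regular p3.
move=> k /andP[k0 _]; apply: contra_neq (Xfrac_neq0) => /eqP; rewrite subr_eq0 => /eqP E.
have : Xfrac ^+ k = 1 by rewrite -[LHS]invrK -E invr1.
rewrite -(rmorphXn tofracM) -(rmorph1 tofracM) => /eqP; rewrite tofrac_eq => /eqP.
move/(congr1 (fun P : {poly {poly rat}} => size P)); rewrite size_polyXn size_poly1 => -[k00].
by rewrite k00 in k0.
Qed.

Lemma size_D33 : size D33 = 116%N /\ sizeY D33 = 132%N.
Proof.
have /andP[/andP[/andP[/size_evP sz _] _] _] := den33_okT.
by rewrite D33E den_ev.
Qed.

Lemma num33_size N : num33_ok N ->
  size (ev ('X : {poly {poly rat}}) 'Y N) = 82%N /\ sizeY (ev ('X : {poly {poly rat}}) 'Y N) = 109%N.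
Proof.
case/and5P=> /eqP sN rows _ top /and3P[side _ _]; apply: size_evP.
rewrite /size_ok sN top side /= andbT.
by apply/allP => r /(allP rows) /eqP ->.
Qed.

Fact cancel_frac (F : fieldType) (n d u v : F) : d != 0 -> u != 0 -> v != 0 ->
  u * (n * v / (d * (u * v))) = n / d.
Proof. by move=> d0 u0 v0; field; rewrite d0 u0 v0. Qed.

Lemma W33_inversion N : num33_ok N ->
  ratfun_value W33 (Xfrac^-1) (Yfrac^-1) (Xfrac ^+ 34 * Yfrac ^+ 23 * W33).
Proof.
move=> Nok; exists (ev 'X 'Y N), D33.
pose g : {rmorphism rat -> ratfun} :=
  tofracM \o (polyC : {rmorphism {poly rat} -> {poly {poly rat}}}) \o (polyC : {rmorphism rat -> {poly rat}}).
have dE : poly_value D33 (Xfrac^-1) (Yfrac^-1) * (Xfrac ^+ 115 * Yfrac ^+ 131) = tofrac D33.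
  have /andP[/andP[/andP[_ s18] sX] sY] := den33_okT.
  have := den_inv dens33 Xfrac_neq0 Yfrac_neq0.
  rewrite (eqP s18) (eqP sX) (eqP sY) -signr_odd /= expr0 mul1r.
  rewrite -(den_rmorph tofracM) -D33E => <-; congr (_ * _).
  by rewrite D33E den_ev (poly_value_ev g) -den_ev.
have nE : poly_value (ev 'X 'Y N) (Xfrac^-1) (Yfrac^-1) * (Xfrac ^+ 81 * Yfrac ^+ 108) = tofrac (ev 'X 'Y N).
  have /and5P[/eqP sN rows /eqP pal _ _] := Nok.
  have := ev_rev Xfrac_neq0 Yfrac_neq0 rows; rewrite pal sN -(ev_rmorph tofracM) -(poly_value_ev g).
  move: (poly_value _ _ _) => v E.
  apply: (mulIf (mulf_neq0 Xfrac_neq0 Yfrac_neq0)); apply: etrans (esym E).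
  move: Xfrac Yfrac => x y; rewrite (exprS x 81) (exprS y 108); ring.
have d0 : tofrac D33 != 0.
  have /andP[_ p33] := positive_okT.
  rewrite D33E (den_rmorph tofracM); exact: regular_den (ratfun_regular p33).
have v0 : poly_value D33 Xfrac^-1 Yfrac^-1 != 0.
  by move: d0; rewrite -dE mulf_eq0 negb_or; case/andP=> v0 _; exact: v0.
split; [exact: W33E|exact: v0|].
rewrite (W33E Nok) -dE -nE; move: v0 Xfrac_neq0 Yfrac_neq0 {d0 dE nE}.
move: (poly_value D33 _ _) (poly_value (ev _ _ _) _ _) => d n.
move: Xfrac Yfrac => x y d0 x0 y0.
have -> : x ^+ 115 * y ^+ 131 = (x ^+ 34 * y ^+ 23) * (x ^+ 81 * y ^+ 108).
  by rewrite [RHS]mulrACA -(exprD x) -(exprD y).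
have : x ^+ 34 * y ^+ 23 != 0 := mulf_neq0 (expf_neq0 _ x0) (expf_neq0 _ y0).
have : x ^+ 81 * y ^+ 108 != 0 := mulf_neq0 (expf_neq0 _ x0) (expf_neq0 _ y0).
move: (x ^+ 34 * _) (x ^+ 81 * _) => u v v0 u0.
exact: (@cancel_frac ratfun n d u v d0 u0 v0).
Qed.

End RationalFunction.
Import RationalFunction.

Module TransferLimit.
Definition first_row_ok : bool :=
  all (fun b => ztransition (0, 0, 0)%N b == if b == (0, 0, 0)%N then [:: Zpos xH] else [::]) states
  && all (fun e => 0 < e.2)%N total_dens && all (fun a => 0 < size_state a)%N (behead states).
Lemma first_row_okT : first_row_ok.
Proof. by vm_cast_no_check (erefl true). Qed.

Section Rate.
Variables (o : comNzRingType) (pi : o) (F : finFieldType) (red : {rmorphism o -> F}).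
Hypothesis piP : uniformizer pi red.
Local Notation q := #|F|.
Variable C : numFieldType.

(* How small t has to be for the transfer operator to halve distances and for the
   denominators not to vanish. *)
Definition convergence_bound : nat :=
  (2 * q ^ sumn (map fst (total_dens ++ dens33)) *
    (\sum_(a <- states) \sum_(b <- states) transition q a b).+1)%N.

Section Small.
Variables (t : C).
Hypothesis t_small : `|t| * convergence_bound%:R <= 1.

Let q1 : (1 < q)%N. Proof. exact: finNzRing_gt1. Qed.
Let q0 : (q%:R : C) != 0. Proof. by rewrite pnatr_eq0 -lt0n ltnW. Qed.

Let t_le (n : nat) : (n <= convergence_bound)%N -> `|t| * n%:R <= 1.
Proof.
move=> nb; apply: le_trans t_small; rewrite ler_wpM2l // ler_nat //.
Qed.

Let t1 : `|t| <= 1.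
Proof.
have := t_le (n := 1); rewrite mulr1; apply.
by rewrite /convergence_bound; move: (sumn _) => m; rewrite !muln_gt0 expn_gt0 (ltnW q1).
Qed.

Let t_exp n : (0 < n)%N -> `|t| ^+ n <= `|t|.
Proof.
by case: n => // n _; rewrite exprS ler_piMr // exprn_ile1.
Qed.

Lemma small_regular : regular (q%:R : C) t (total_dens ++ dens33).
Proof.
move=> e ein; have e2 : (0 < e.2)%N.
  have /andP[/andP[_ p] _] := first_row_okT; have /andP[_ p33] := positive_okT.
  by move: ein; rewrite mem_cat => /orP[/(allP p)|/(allP p33)].
rewrite subr_eq0; apply/negP => /eqP E.
have e1 : (e.1 <= sumn (map fst (total_dens ++ dens33)))%N.
  elim: (total_dens ++ dens33) ein => //= x s IHs; rewrite inE => /orP[/eqP ->|/IHs].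
    exact: leq_addr.
  by move=> h; rewrite (leq_trans h) ?leq_addl.
have : `|t| * (2 * q ^ e.1)%:R <= 1.
  apply: t_le; rewrite /convergence_bound; move: (sumn _) e1 => m e1.
  apply: leq_trans (leq_pmulr _ _) => //.
  by rewrite leq_mul2l /= leq_exp2l.
have : 1 <= q%:R ^+ e.1 * `|t|.
  apply: (@le_trans _ _ `|mon (q%:R : C) t e|); first by rewrite -E normr1.
  rewrite normrM !normrX normr_nat.
  by rewrite ler_wpM2l ?exprn_ge0 ?ler0n // t_exp.
move=> h1 h2; have h3 : (2 : C) * 1 <= 2 * (q%:R ^+ e.1 * `|t|) by rewrite ler_pM2l ?ltr0n.
have : (2 : C) <= 1.
  rewrite -[X in X <= _]mulr1; apply: le_trans h3 _; move: h2.
  by rewrite natrM natrX mulrCA (mulrC `|t|).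
by rewrite (ler_nat _ 2 1).
Qed.

Lemma partial_zeta_rate N : num33_ok N -> exists z B,
  [/\ z * den (q%:R : C) t dens33 = ev (q%:R : C) t N, 0 <= B &
      forall K, `|\sum_(T <- ideals red K) t ^+ colength3 F T - z| <= B / 2 ^+ K].
Proof.
move=> Nok; have reg := small_regular.
have rT : regular (q%:R : C) t total_dens by move=> e eT; apply: reg; rewrite mem_cat eT.
have /and5P [_ /eqP st0 _ _ _] := states_okT.
have /andP[/andP[/allP row0 _] /allP size0] := first_row_okT.
pose Z := solution_val (q%:R : C) t.
pose d K a : C := partial_zeta red t K a - Z a.
pose D K := \sum_(a <- states) `|d K a|.
have D_ge0 K : 0 <= D K by apply: sumr_ge0.
have z0 : (0, 0, 0)%N \in states by rewrite st0 mem_head.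
have us : uniq states by have /andP[] := states_okT.
have r00 : ztransition (0, 0, 0)%N (0, 0, 0)%N = [:: Zpos xH] by have /eqP -> := row0 _ z0.
have r0 b : b \in states -> b != (0, 0, 0)%N -> ztransition (0, 0, 0)%N b = [::].
  by move=> bs /negbTE b0; have /eqP -> := row0 _ bs; rewrite b0.
have ZE a : a \in states -> Z a = \sum_(b <- states) (t ^+ size_state a * (transition q a b)%:R) * Z b.
  rewrite {1}st0 inE => /orP[/eqP ->|ab]; last first.
    rewrite [LHS]solution_valE //; apply: eq_bigr => b _.
    by rewrite /weight transitionE.
  rewrite (bigD1_seq _ z0 us) /= big1_seq ?addr0 => [|b /andP[b0 bs]].
    by rewrite transitionE // r00 /= mulr0 addr0 (_ : zr _ _ = 1) // expr0 !mul1r.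
  by rewrite transitionE // (r0 _ bs b0) /= mulr0 mul0r.
have recE K a : a \in states -> d K.+1 a = \sum_(b <- states) (t ^+ size_state a * (transition q a b)%:R) * d K b.
  move=> ain; rewrite /d (partial_zetaS piP) [in LHS]ZE // -sumrB.
  by apply: eq_bigr => b _; rewrite mulrBr.
have d0 K : d K (0, 0, 0)%N = 0.
  elim: K => [|K IHK].
    by rewrite /d (partial_zeta0 piP) eqxx [Z _]solution_val0 // subrr.
  rewrite recE // (bigD1_seq _ z0 us) /= big1_seq ?addr0 => [|b /andP[b0 bs]]; first by rewrite IHK mulr0.
  by rewrite transitionE // (r0 _ bs b0) /= mulr0 mul0r.
have Dle K b : b \in states -> `|d K b| <= D K.
  move=> bs; rewrite /D (bigD1_seq _ bs us) /= lerDl; exact: sumr_ge0.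
have dstep K a : a \in states -> `|d K.+1 a| <= `|t| * (\sum_(b <- states) transition q a b)%N%:R * D K.
  move=> ain; move: (ain); rewrite {1}st0 inE => /orP[/eqP ->|ab].
    by rewrite d0 normr0 !mulr_ge0 ?ler0n.
  move: (D K) (D_ge0 K) (Dle K) => DK DK0 DKle; rewrite recE // (le_trans (ler_norm_sum _ _ _)) // natr_sum mulr_sumr mulr_suml.
  rewrite big_seq [X in _ <= X]big_seq; apply: ler_sum => b bs.
  rewrite !normrM normrX normr_nat; apply: ler_pM; rewrite ?mulr_ge0 ?exprn_ge0 ?ler0n //.
    by rewrite ler_wpM2r ?ler0n // t_exp // size0.
  exact: DKle.
have Dstep K : D K.+1 <= D K / 2.
  pose S := (\sum_(a <- states) \sum_(b <- states) transition q a b)%N.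
  apply: (@le_trans _ _ (`|t| * S%:R * D K)).
    rewrite {1}/D; move: (D K) (dstep K) => DK dstepK; rewrite natr_sum mulr_sumr mulr_suml.
    rewrite big_seq [X in _ <= X]big_seq; apply: ler_sum => a; exact: dstepK.
  rewrite ler_pdivlMr ?ltr0n // mulrAC -[X in _ <= X]mul1r ler_wpM2r // -mulrA -natrM; apply: t_le.
  rewrite /convergence_bound; move: (sumn _) => m; rewrite -/S [X in (X <= _)%N]mulnC.
  by apply: leq_mul => //; rewrite leq_pmulr // expn_gt0 (ltnW q1).
exists (\sum_(a <- states) Z a), (D 0%N); split.
- exact: solution_total.
- exact: D_ge0.
move=> K; rewrite (partial_zeta_total piP) -sumrB.
apply: (le_trans (ler_norm_sum _ _ _)); rewrite -/(D K).
elim: K => [|K IHK]; first by rewrite expr0 divr1.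
apply: (le_trans (Dstep K)); rewrite exprSr invfM mulrA ler_wpM2r // invr_ge0 ler0n.
Qed.
End Small.
End Rate.

End TransferLimit.
Import TransferLimit.

Module Summation.
Lemma perm_sub_cat (T : eqType) (r s : seq T) : uniq r -> uniq s -> {subset r <= s} ->
  perm_eq s (r ++ [seq x <- s | x \notin r]).
Proof.
move=> ur us rs; apply: uniq_perm => //.
  rewrite cat_uniq ur filter_uniq // andbT; apply/hasPn => x.
  by rewrite mem_filter => /andP[].
by move=> x; rewrite mem_cat mem_filter; case: (boolP (x \in r)) => //= /rs ->.
Qed.

Lemma map_lift (I T : eqType) (g : I -> T) (s : seq T) :
  (forall t, t \in s -> exists i, g i = t) -> exists r, map g r = s.
Proof.
elim: s => [_|t s IHs H]; first by exists [::].
have [|r rs] := IHs; first by move=> u us; apply: H; rewrite inE us orbT.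
by have [i it] := H t (mem_head _ _); exists (i :: r); rewrite /= it rs.
Qed.

Section Exhaustion.
Variables (C : numFieldType) (I : choiceType) (T : eqType) (g : I -> T) (f : T -> C).
Variable s : nat -> seq T.
Hypothesis g_inj : injective g.
Hypothesis s_uniq : forall K, uniq (s K).
Hypothesis s_mono : forall K M, (K <= M)%N -> {subset s K <= s M}.
Hypothesis s_img : forall K t, t \in s K -> exists i, g i = t.
Hypothesis s_all : forall i, exists K, g i \in s K.

Lemma has_sum_exhaustion z y :
  (forall e, 0 < e -> exists K, forall M, (K <= M)%N ->
     `|\sum_(t <- s M) f t - z| <= e /\ `|\sum_(t <- s M) `|f t| - y| <= e) ->
  has_sum (f \o g) z.
Proof.
have FF : Filter (@totally I) by case: (@totally_filter I).
move=> lim; apply/cvgrPdist_le => e e0.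
have [K HK] := lim _ (divr_gt0 e0 (ltr0n C 3)).
have [r rs] := map_lift (@s_img K).
have ur : uniq r by rewrite -(map_inj_uniq g_inj) rs.
exists [fset i in r]%fset => // A /= /fsubsetP rA.
have {rA}rA : {subset r <= A} by move=> i ir; apply: rA; rewrite inE.
have [M KM AM] : exists2 M, (K <= M)%N & {subset map g A <= s M}.
  have [M0 H0] : exists M, {subset map g (A : seq I) <= s M}.
    elim: (A : seq I) => [|i B [M HM]]; first by exists 0%N.
    have [M' iM'] := s_all i; exists (maxn M M') => t; rewrite inE => /orP[/eqP ->|/HM].
      by apply: s_mono iM'; exact: leq_maxr.
    by apply: s_mono; exact: leq_maxl.
  by exists (maxn K M0); [exact: leq_maxl|move=> t /H0; apply: s_mono; exact: leq_maxr].
have [z1 y1] := HK _ (leqnn K); have [_ y2] := HK _ KM.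
have pA := perm_sub_cat ur (fset_uniq A) rA.
set B := [seq i <- _ | _] in pA.
have split_sum (V : nmodType) (h : I -> V) : \sum_(i <- A) h i = \sum_(i <- r) h i + \sum_(i <- B) h i.
  by rewrite (perm_big _ pA) big_cat.
have -> : partial_sum (f \o g) A = \sum_(t <- s K) f t + \sum_(i <- B) f (g i).
  rewrite /partial_sum -(big_seq_fsetE _ _ predT (f \o g)) /= split_sum.
  by rewrite -rs big_map.
have Bsum : \sum_(i <- B) `|f (g i)| <= \sum_(t <- s M) `|f t| - \sum_(t <- s K) `|f t|.
  rewrite lerBrDl -[in X in X <= _]rs big_map -(split_sum _ (fun i => `|f (g i)|)).
  have ugA : uniq (map g A) by rewrite map_inj_uniq // fset_uniq.
  rewrite (perm_big _ (perm_sub_cat ugA (s_uniq M) AM)) big_cat big_map lerDl /=.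
  by apply: sumr_ge0.
set S := \sum_(t <- s K) _ in z1 *; set SK := \sum_(t <- s K) _ in Bsum y1; set SM := \sum_(t <- s M) _ in Bsum y2.
have -> : z - (S + \sum_(i <- B) f (g i)) = - (S - z) - \sum_(i <- B) f (g i).
  by rewrite opprB opprD addrA.
apply: (le_trans (ler_normB _ _)); rewrite normrN.
have le2 : `|\sum_(i <- B) f (g i)| <= e / 3 + e / 3.
  apply: (le_trans (ler_norm_sum _ _ _)).
  have h0 : 0 <= SM - SK by apply: le_trans Bsum; apply: sumr_ge0.
  apply: (le_trans Bsum); rewrite -(ger0_norm h0).
  have -> : SM - SK = (SM - y) - (SK - y) by rewrite opprB addrA subrK.
  by apply: (le_trans (ler_normB _ _)); exact: lerD.
apply: (le_trans (lerD z1 le2)).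
by rewrite (_ : e / 3 + (e / 3 + e / 3) = e) //; field.
Qed.
End Exhaustion.

End Summation.
Import Summation.

Module ComplexPowers.
Section ComplexPowers.
Variable R : realType.
Local Open Scope complex_scope.
Implicit Types (z w s : R[i]) (x : R).

Lemma complex_expD z w : complex_exp (z + w) = complex_exp z * complex_exp w.
Proof.
case: z w => [a b] [c d]; rewrite /complex_exp /= expRD cosD sinD.
apply/eqP; rewrite eq_complex /=; apply/andP; split; apply/eqP; ring.
Qed.

Lemma complex_exp0 : complex_exp (0 : R[i]) = 1.
Proof.
by rewrite /complex_exp /= expR0 cos0 sin0 mul1r.
Qed.

Lemma complex_expMn z n : complex_exp (z *+ n) = complex_exp z ^+ n.
Proof.
elim: n => [|n IHn]; first by rewrite mulr0n complex_exp0 expr0.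
by rewrite mulrS complex_expD IHn exprS.
Qed.

Lemma norm_complex_exp z : `|complex_exp z| = (expR (complex.Re z))%:C.
Proof.
rewrite /complex_exp normrM ger0_norm; last by rewrite lecR expR_ge0.
rewrite -[RHS]mulr1; congr (_ * _).
by rewrite normc_def /= cos2Dsin2 sqrtr1.
Qed.

Lemma nat_cpowX n l s : (0 < n)%N -> nat_cpow (n ^ l) s = nat_cpow n s ^+ l.
Proof.
move=> n0; rewrite /nat_cpow -complex_expMn; congr complex_exp.
by rewrite natrX lnXn ?ltr0n // rmorphMn mulrnAr.
Qed.

Lemma norm_nat_cpow n s : `|nat_cpow n s| = (expR (complex.Re s * ln n%:R))%:C.
Proof.
rewrite /nat_cpow norm_complex_exp; congr (expR _)%:C.
by case: s => a b; rewrite /= mulr0 subr0.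
Qed.

Lemma nat_cpow_small n b s : (1 < n)%N -> (0 < b)%N ->
  ln b%:R / ln n%:R < complex.Re s -> `|nat_cpow n (- s)| * b%:R <= 1.
Proof.
move=> n1 b0; rewrite ltr_pdivrMr ?ln_gt0 ?ltr1n // => /ltW h.
rewrite norm_nat_cpow -(rmorph_nat (real_complex R)) -rmorphM -(rmorph1 (real_complex R)) lecR.
rewrite -[b%:R]lnK ?posrE ?ltr0n // -expRD -[X in _ <= X]expR0 ler_expR.
by case: s h => u v /= h; rewrite mulNr addrC subr_le0.
Qed.

Lemma exp2_beats (b e : R[i]) : 0 <= b -> 0 < e -> exists K, forall M, (K <= M)%N -> b / 2 ^+ M <= e.
Proof.
move=> b0 e0; have [x x0 xE] : exists2 x, 0 <= x & b = x%:C.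
  by exists (complex.Re b); [move: b0; case: b => u v; rewrite lecE /= => /andP[_]|rewrite RRe_real // ger0_real].
have [y y0 yE] : exists2 y, 0 < y & e = y%:C.
  by exists (complex.Re e); [move: e0; case: e => u v; rewrite ltcE /= => /andP[_]|rewrite RRe_real // gtr0_real].
exists (Num.bound (x / y)) => M KM; rewrite ler_pdivrMr ?exprn_gt0 ?ltr0n // yE xE.
rewrite -(rmorph_nat (real_complex R) 2) -rmorphXn -rmorphM lecR mulrC -ler_pdivrMr //.
by apply: ltW; apply: upper_nthrootP.
Qed.
End ComplexPowers.

End ComplexPowers.
Import ComplexPowers.

Lemma ratfun_value_W33 (C : numFieldType) (x y z : C) N : num33_ok N ->
  den x y dens33 != 0 -> z * den x y dens33 = ev x y N -> ratfun_value W33 x y z.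
Proof.
move=> Nok d0 zE; exists (ev 'X 'Y N), D33.
pose g : {rmorphism rat -> C} := ratr.
have dE : poly_value D33 x y = den x y dens33 by rewrite D33E den_ev (poly_value_ev g) -den_ev.
split; [exact: W33E|by rewrite dE|].
by rewrite dE (poly_value_ev g) -zE mulfK.
Qed.

Section Zeta.
Variables (o : comNzRingType) (pi : o) (F : finFieldType) (red : {rmorphism o -> F}).
Hypothesis piP : uniformizer pi red.
Local Notation L := (base_change (free_nilpotent_lie 3 3) o).

Lemma gr_lat_inj (I J : graded_ideal L 3) : gr_lat I = gr_lat J -> I = J.
Proof.
case: I J => [I IL Ig If] [J JL Jg Jf] /= IJ.
have [_ IE] := gr_lat_ideal IL Ig; have [_ JE] := gr_lat_ideal JL Jg.
have E : I = J by rewrite -IE -JE IJ.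
by move: IL Ig If; rewrite E => IL Ig If; congr GradedIdeal; exact: Prop_irrelevance.
Qed.

Lemma gr_lat_index (I : graded_ideal L 3) : lat_ideal (gr_lat I) /\
  (bounded pi (gr_lat I).1.1 /\ mod_index I = (#|F| ^ colength3 F (gr_lat I))%N).
Proof.
case: I => I IL Ig If /=; have [TI IE] := gr_lat_ideal IL Ig.
have B := finite_index_bounded piP IL Ig If.
by have [_ E] := lat_gr_index piP TI B; split=> //; split=> //; rewrite -E IE.
Qed.

Lemma gr_lat_img K (T : lat3 o) : T \in ideals red K -> exists I : graded_ideal L 3, gr_lat I = T.
Proof.
case/(mem_ideals piP) => TI TK; have B : bounded pi T.1.1 by exists K.
have [IL Ig] := lat_gr_ideal TI; have [If _] := lat_gr_index piP TI B.
by exists (GradedIdeal IL Ig If); exact: gr_latK.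
Qed.

Lemma graded_zeta_has_sum (R : realType) (s : R[i]) N : num33_ok N ->
  let t := nat_cpow #|F| (- s) in
  `|t| * (convergence_bound F)%:R <= 1 ->
  exists2 z : R[i], ratfun_value W33 #|F|%:R t z & graded_ideal_zeta L 3 s z.
Proof.
move=> Nok t t1; have q1 : (1 < #|F|)%N := finNzRing_gt1 F.
have t2 : `| `|t| | * (convergence_bound F)%:R <= 1 by rewrite normr_id.
have [z [B [zE B0 zB]]] := partial_zeta_rate piP t1 Nok.
have [y [B' [_ B'0 yB]]] := partial_zeta_rate piP t2 Nok.
exists z.
  apply: ratfun_value_W33 Nok _ zE; apply: regular_den => e e33.
  by apply: (small_regular t1); rewrite mem_cat e33 orbT.
rewrite /graded_ideal_zeta.
have -> : (fun I : graded_ideal L 3 => nat_cpow (mod_index I) (- s)) =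
    (fun T : lat3 o => t ^+ colength3 F T) \o (fun I : graded_ideal L 3 => gr_lat I).
  by apply/funext => I; have [_ [_ ->]] := gr_lat_index I; rewrite nat_cpowX // ltnW.
apply: (@has_sum_exhaustion _ _ _ _ _ (ideals red) _ _ _ _ _ z y).
- by move=> I J; exact: gr_lat_inj.
- exact: ideals_uniq piP.
- exact: ideals_mono piP.
- exact: gr_lat_img.
- move=> I; have [TI [[K TK] _]] := gr_lat_index I; exists K.
  by apply/(mem_ideals piP).
move=> e e0; have [K HK] := exp2_beats (addr_ge0 B0 B'0) e0; exists K => M KM; split.
  apply: (le_trans (zB M)); apply: le_trans (HK M KM).
  by rewrite ler_wpM2r ?invr_ge0 ?exprn_ge0 // lerDl.
under eq_bigr do rewrite normrX.
apply: (le_trans (yB M)); apply: le_trans (HK M KM).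
by rewrite ler_wpM2r ?invr_ge0 ?exprn_ge0 // lerDr.
Qed.
End Zeta.

Theorem theorem1p1 :
  (forall (R : realType) (p : nat) (p_pr : prime p)
      (K : fieldExtType (padic p_pr)),
    let o := integer_ring K in
    let q := residue_card o in
    exists sigma : R, forall s : R[i], sigma < complex.Re s ->
      exists2 z : R[i],
        ratfun_value W33 q%:R (nat_cpow q (- s)) z &
        graded_ideal_zeta (base_change (free_nilpotent_lie 3 3) o) 3 s z)
  /\ (size D33 = 116%N /\ sizeY D33 = 132%N)
  /\ (exists N : {poly {poly rat}},
        [/\ W33 = tofrac N / tofrac D33, size N = 82%N & sizeY N = 109%N])
  /\ ratfun_value W33 (Xfrac^-1) (Yfrac^-1) (Xfrac ^+ 34 * Yfrac ^+ 23 * W33).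
Proof.
have [N Nok] := num33_ex; split=> [R p p_pr K o q|].
  have [pi piU] := integer_ring_is_uniformizer K.
  have [F [red [piP cF]]] := residue_field_ex piU.
  rewrite /q -cF; exists (ln (convergence_bound F)%:R / ln #|F|%:R) => s hs.
  apply: (graded_zeta_has_sum piP Nok); apply: nat_cpow_small hs; first exact: finNzRing_gt1.
  rewrite /convergence_bound; move: (sumn _) => m.
  by rewrite !muln_gt0 expn_gt0 (ltnW (finNzRing_gt1 F)).
split; first exact: size_D33; split; last exact: W33_inversion Nok.
have [sX sY] := num33_size Nok.
by exists (ev 'X 'Y N); split=> //; exact: W33E.
Qed.
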